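(* Fix $\gamma\ge1$, $0<v_+<1$, $\mu_0>0$, $\sigma>0$, $B_1^*\ge0$ and $\mu=1$. In the limit $r:=\mu/(2\mu+\eta)\to\infty$, the reduced Evans function $D^r$ converges uniformly on compact subsets of $\{\Re\lambda\ge0\}$ to $$D^0(\lambda)=\det(R^+(\lambda),R^-(\lambda)),$$ where $R^\pm$ are the $4\times2$ matrices solving Kato's ODE whose columns span the stable subspace of $A_+(\lambda)$ (for $R^+$), respectively the unstable subspace of $A_-(\lambda)$ (for $R^-$).
   Context: Setting. $\mu=1$ and $2\mu+\eta=1/r>0$ arbitrary; $v_-:=1$, $a=v_+^\gamma\frac{1-v_+}{1-v_+^\gamma}$. $\hat v(x)=\bar v(rx)$, where $\bar v$ (independent of $r$) is the monotone decreasing solution, with a fixed translation, of $\bar v'=\bar v(\bar v-1+a(\bar v^{-\gamma}-1))$, $\bar v(-\infty)=1$, $\bar v(+\infty)=v_+$. Reduced eigenvalue equations: $\lambda w+w'-\frac{B_1^*\alpha'}{\mu_0\hat v}=\mu\frac{w''}{\hat v}$, $\lambda\alpha+\alpha'-B_1^*w'=\frac{1}{\sigma\mu_0\hat v}(\alpha'/\hat v)'$. With $W=(w,\mu w',\alpha,\alpha'/(\sigma\mu_0\hat v))^T$ they read $W'=A(x,\lambda)W$, $$A=\begin{pmatrix}0&1/\mu&0&0\\ \lambda\hat v&\hat v/\mu&0&-\sigma B_1^*\hat v\\0&0&0&\sigma\mu_0\hat v\\0&-B_1^*\hat v/\mu&\lambda\hat v&\sigma\mu_0\hat v^2\end{pmatrix},\qquad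 A_\pm(\lambda)=\lim_{x\to\pm\infty}A(x,\lambda).$$ For $\Re\lambda\ge0$, $\lambda\neq0$, each $A_\pm$ has two eigenvalues of positive and two of negative real part. Let $\Pi_+$ be the eigenprojection of $A_+$ onto its stable subspace and $\Pi_-$ that of $A_-$ onto its unstable subspace. Fix $\lambda_0>0$; $R^\pm=(R_1^\pm,R_2^\pm)$ solve Kato's ODE $\frac{dR^\pm}{d\lambda}=\frac{d\Pi_\pm}{d\lambda}R^\pm$, $R^\pm(\lambda_0)=R_0^\pm$, with $R_0^\pm$ real, of rank 2, $\Pi_\pm(\lambda_0)R_0^\pm=R_0^\pm$ (these do not depend on $r$). Let $P_\pm(x,\lambda)$ be invertible matrices on $x\gtrless0$, converging exponentially to $I$ as $x\to\pm\infty$, such that $W=P_\pm Z$ transforms $W'=AW$ into $Z'=A_\pm Z$. The reduced Evans function is $D^r(\lambda)=\det(P_+R_1^+,P_+R_2^+,P_-R_1^-,P_-R_2^-)|_{x=0}$ (independent of the choice of $P_\pm$); values at $\lambda=0$ are by continuous extension.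
   Formalization: When the compact set contains λ=0, it is assumed that R^± extend continuously to λ=0; this fails only if (B_1^* )^2=μ_0 or (B_1^* )^2=μ_0 v_+, where D^0 blows up like λ^{-1/4} and the claim at 0 has no meaning. *)

(* Defs.v *)
From mathcomp Require Import all_boot all_order all_algebra.
From mathcomp Require Import all_classical all_reals all_analysis.
From mathcomp Require Import complex.

Set Implicit Arguments.
Unset Strict Implicit.
Unset Printing Implicit Defensive.

Import Order.TTheory GRing.Theory Num.Theory numFieldNormedType.Exports.

Local Open Scope classical_set_scope.
Local Open Scope ring_scope.

(* R[i] itself carries no topology; packed as a numClosedFieldType it gets the
   one of its norm, and 'M[Cplx R]_(m, n) the one of the sup norm. Derivatives
   in direction 1 of functions on Cplx R are then complex derivatives. *)
Definition Cplx (R : realType) : numClosedFieldType := R[i].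

Definition toC (R : realType) (x : R) : Cplx R := x%:C%C.

Definition ReC (R : realType) (z : Cplx R) : R := complex.Re z.

Definition ImC (R : realType) (z : Cplx R) : R := complex.Im z.

Definition closedRHP (R : realType) : set (Cplx R) := [set z | 0 <= ReC z].

Definition puncturedRHP (R : realType) : set (Cplx R) :=
  [set z | 0 <= ReC z /\ z != 0].

Definition shock_coef (R : realType) (gamma vp : R) : R :=
  vp `^ gamma * (1 - vp) / (1 - vp `^ gamma).

Definition is_profile (R : realType) (gamma vp : R) (v : R -> R) : Prop :=
  [/\ forall x : R, is_derive x 1 v
        (v x * (v x - 1 + shock_coef gamma vp * (v x `^ (- gamma) - 1))),
      {homo v : x y /~ x < y},
      v x @[x --> -oo] --> (1 : R) &
      v x @[x --> +oo] --> (vp : R)].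

Definition rescaled (R : realType) (v : R -> R) (r : R) : R -> R :=
  fun x => v (r * x).

(* In the unknown (w, mu w', alpha, alpha' / (sigma mu0 v))^T. *)
Definition evans_mx (R : realType) (mu mu0 sigma B : R) (v : R -> R)
    (x : R) (l : Cplx R) : 'M[Cplx R]_4 :=
  let c := @toC R in
  \matrix_(i < 4, j < 4) nth 0 (nth [::]
    [:: [:: 0;           c (1 / mu);            0;           0];
        [:: l * c (v x); c (v x / mu);          0;           c (- (sigma * B * v x))];
        [:: 0;           0;                     0;           c (sigma * mu0 * v x)];
        [:: 0;           c (- (B * v x / mu));  l * c (v x); c (sigma * mu0 * v x ^+ 2)]]
    i) j.

(* P is the projection onto the sum of the generalized eigenspaces of A (acting
   on column vectors) for the eigenvalues in S, along the sum of the others;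
   this determines P, as the generalized eigenvectors span. *)
Definition is_eigenprojection (R : realType) (n : nat) (A : 'M[Cplx R]_n.+1)
    (S : pred (Cplx R)) (P : 'M[Cplx R]_n.+1) : Prop :=
  forall (a : Cplx R) (k : nat) (u : 'cV[Cplx R]_n.+1),
    (A - a%:M) ^+ k *m u = 0 -> P *m u = if S a then u else 0.

Definition stable_eig (R : realType) : pred (Cplx R) := fun a => ReC a < 0.

Definition unstable_eig (R : realType) : pred (Cplx R) := fun a => 0 < ReC a.

Definition solves (R : realType) (n : nat) (A : R -> 'M[Cplx R]_n) (I : set R)
    (W : R -> 'cV[Cplx R]_n) : Prop :=
  forall x, I x -> forall i,
    is_derive x 1 (fun t => ReC (W t i 0)) (ReC ((A x *m W x) i 0)) /\
    is_derive x 1 (fun t => ImC (W t i 0)) (ImC ((A x *m W x) i 0)).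

(* I is ]0, +oo[ or ]-oo, 0[; P 0 is the boundary value at 0. *)
Definition is_conjugator (R : realType) (n : nat) (A : R -> 'M[Cplx R]_n)
    (Ainf : 'M[Cplx R]_n) (I : set R) (P : R -> 'M[Cplx R]_n) : Prop :=
  [/\ forall x, (I `|` [set 0]) x -> P x \in unitmx,
      P x @[x --> within I (nbhs 0)] --> P 0,
      exists M theta : R, 0 < theta /\ forall x, I x -> forall i j,
        `|P x i j - (1%:M : 'M[Cplx R]_n) i j|
          <= toC (M * expR (- (theta * `|x|))) &
      forall Z : R -> 'cV[Cplx R]_n,
        solves (fun=> Ainf) I Z <-> solves A I (fun x => P x *m Z x)].

Definition kato_solution (R : realType) (Pi : Cplx R -> 'M[Cplx R]_4)
    (l0 : R) (R0 : 'M[R]_(4, 2)) (Rs : Cplx R -> 'M[Cplx R]_(4, 2)) : Prop :=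
  (forall l : Cplx R, puncturedRHP l ->
     is_derive l 1 Rs ('D_1 Pi l *m Rs l)) /\
  Rs (toC l0) = map_mx (@toC R) R0.

Definition det_cols (R : realType) (X Y : 'M[Cplx R]_(4, 2)) : Cplx R :=
  \det (row_mx X Y : 'M[Cplx R]_(2 + 2)).

Definition ext0 (R : realType) (f : Cplx R -> Cplx R) : Cplx R -> Cplx R :=
  fun l => if l == 0 then lim (f @ within (@puncturedRHP R) (nbhs 0)) else f l.

Definition reduced_evans (R : realType) (Pp Pm : R -> Cplx R -> 'M[Cplx R]_4)
    (Rp Rm : Cplx R -> 'M[Cplx R]_(4, 2)) : Cplx R -> Cplx R :=
  ext0 (fun l => det_cols (Pp 0 l *m Rp l) (Pm 0 l *m Rm l)).

(* Main.v *)
(* The Evans function only sees the planes spanned by the columns of W = P R,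
   encoded by the antisymmetric matrices wedge W = W J W^T (Pluecker coordinates):
   det(P+ R+, P- R-) is a bilinear pairing of two such matrices. On each
   half-line Y = wedge R satisfies Ai Y + Y Ai^T = eta Y, where eta is the sum of
   the two stable eigenvalues of the limit matrix Ai, and the deviation
   D = P Y P^T - Y solves
     D' = A D + D A^T - eta D + (A - Ai) Y + Y (A - Ai)^T,   |A - Ai| <= C w,
   where w, the distance of the profile to its limit, decays at a rate rho = c r.
   On antisymmetric matrices eta has the smallest real part in the spectrum of
   D |-> Ai D + D Ai^T, so D, which decays at some rate, is in fact O(w). Once
   this is known, integration from infinity absorbs the terms linear in D as soon
   as rho exceeds a multiple of |A|, which gives D(0) = O(|Y| / r) uniformly in
   lambda, even near lambda = 0 where the spectral gap closes. The same estimate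
   for the difference of the deviations at two values of lambda makes D(0) Cauchy
   as lambda -> 0, so that the Evans function extends to 0.
   Kato's R stays in the range of Pi because Q = (1 - Pi) R solves the linear
   equation Q' = - Pi Pi' Q; Pi is differentiable since the blocks of
   Pi(lambda) - Pi(lambda0) solve Sylvester equations with disjoint spectra. *)
Require Import Defs.
From mathcomp Require Import all_boot all_order all_algebra.
From mathcomp Require Import all_classical all_reals all_analysis.
From mathcomp Require Import complex ring lra.
Set Implicit Arguments.
Unset Strict Implicit.
Unset Printing Implicit Defensive.
Import Order.TTheory GRing.Theory Num.Theory numFieldNormedType.Exports.
Local Open Scope classical_set_scope.
Local Open Scope ring_scope.

(** The constants $M,\theta$ of the given conjugators may vary with $\lambda$ and $r$ without any
    uniformity. Their decay is therefore used only qualitatively: it selects the decaying solution,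
    and the constant in the resulting $D=O(w)$ drops out of the bootstrap, which leaves constants
    built from $|A|$, the decay rate of the profile and $|Y|$ alone. For every $\lambda$ one of two
    things happens: the columns of $R$ are dependent, so $Y=0$ and the deviation vanishes, or they
    span the whole stable subspace. There is no third case, because an energy identity shows that a
    stable vector of the limit system is determined by two of its four components. Spectral theory
    is carried out with polynomials. The range of a projection is annihilated by a product of
    factors $A-a$ along a list of eigenvalues, and induction on such lists takes the place of
    resolvent integrals and Jordan forms, both for Sylvester equations and for differential
    equations. *)

Section Norms.
Variable R : realType.
Local Notation C := (Cplx R).
Implicit Types (x y z : C).

Lemma ReCD x y : ReC (x + y) = ReC x + ReC y.
Proof. by case: x; case: y. Qed.

Lemma ImCD x y : ImC (x + y) = ImC x + ImC y.
Proof. by case: x; case: y. Qed.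

Lemma ReCN x : ReC (- x) = - ReC x.
Proof. by case: x. Qed.

Lemma ImCN x : ImC (- x) = - ImC x.
Proof. by case: x. Qed.

Lemma ReC0 : ReC (0 : C) = 0. Proof. by []. Qed.
Lemma ImC0 : ImC (0 : C) = 0. Proof. by []. Qed.
Lemma ReC1 : ReC (1 : C) = 1. Proof. by []. Qed.
Lemma ImC1 : ImC (1 : C) = 0. Proof. by []. Qed.

Lemma ReCM x y : ReC (x * y) = ReC x * ReC y - ImC x * ImC y.
Proof. by case: x; case: y. Qed.

Lemma ImCM x y : ImC (x * y) = ReC x * ImC y + ImC x * ReC y.
Proof. by case: x; case: y. Qed.

Lemma ReC_toC (a : R) : ReC (toC a) = a. Proof. by []. Qed.
Lemma ImC_toC (a : R) : ImC (toC a) = 0. Proof. by []. Qed.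

Definition ReCE := (ReCD, ReCN, ReCM, ReC0, ReC1, ReC_toC,
                    ImCD, ImCN, ImCM, ImC0, ImC1, ImC_toC).

Lemma ReC_sum (I : Type) (s : seq I) (P : pred I) (F : I -> C) :
  ReC (\sum_(i <- s | P i) F i) = \sum_(i <- s | P i) ReC (F i).
Proof. by apply: (big_morph _ ReCD ReC0). Qed.

Lemma ImC_sum (I : Type) (s : seq I) (P : pred I) (F : I -> C) :
  ImC (\sum_(i <- s | P i) F i) = \sum_(i <- s | P i) ImC (F i).
Proof. by apply: (big_morph _ ImCD ImC0). Qed.

Lemma ReIm_eq x y : ReC x = ReC y -> ImC x = ImC y -> x = y.
Proof. by case: x => a b; case: y => c d /= -> ->. Qed.

(** The norm of [Cplx R] takes its values in [Cplx R]. This equivalent one is real-valued and still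
    submultiplicative, so real linear arithmetic applies to all estimates. *)
Definition nc z : R := `|ReC z| + `|ImC z|.

Lemma nc_ge0 z : 0 <= nc z. Proof. by rewrite addr_ge0. Qed.

Lemma nc0 : nc 0 = 0. Proof. by rewrite /nc !ReCE !normr0 addr0. Qed.

Lemma ncN z : nc (- z) = nc z. Proof. by rewrite /nc !ReCE !normrN. Qed.

Lemma ncD x y : nc (x + y) <= nc x + nc y.
Proof.
rewrite /nc !ReCE; have := ler_normD (ReC x) (ReC y).
have := ler_normD (ImC x) (ImC y); lra.
Qed.

Lemma ncB x y : nc (x - y) <= nc x + nc y.
Proof. by rewrite -(ncN y) ncD. Qed.

Lemma ncM x y : nc (x * y) <= nc x * nc y.
Proof.
rewrite /nc !ReCE.
have h1 := ler_normB (ReC x * ReC y) (ImC x * ImC y).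
have h2 := ler_normD (ReC x * ImC y) (ImC x * ReC y).
rewrite !normrM in h1 h2; nra.
Qed.

Lemma nc_toC (a : R) : nc (toC a) = `|a|.
Proof. by rewrite /nc !ReCE normr0 addr0. Qed.

Lemma nc1 : nc 1 = 1. Proof. by rewrite /nc !ReCE normr0 normr1 addr0. Qed.

Lemma nc_eq0 z : nc z <= 0 -> z = 0.
Proof.
rewrite /nc => h; have h1 := normr_ge0 (ReC z); have h2 := normr_ge0 (ImC z).
by apply: ReIm_eq; rewrite !ReCE; apply/eqP; rewrite -normr_eq0 eq_le normr_ge0 andbT; lra.
Qed.

Lemma ReC_nc z : `|ReC z| <= nc z. Proof. by rewrite lerDl. Qed.
Lemma ImC_nc z : `|ImC z| <= nc z. Proof. by rewrite lerDr. Qed.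

Lemma toCD (a b : R) : toC (a + b) = toC a + toC b.
Proof. by apply: ReIm_eq; rewrite !ReCE ?addr0. Qed.

Lemma toCN (a : R) : toC (- a) = - toC a.
Proof. by apply: ReIm_eq; rewrite !ReCE ?oppr0. Qed.

Lemma toCM (a b : R) : toC (a * b) = toC a * toC b.
Proof. by apply: ReIm_eq; rewrite !ReCE; ring. Qed.

Lemma toC_eq0 (a : R) : (toC a == 0) = (a == 0).
Proof.
apply/eqP/eqP => [h|->]; last by apply: ReIm_eq.
by rewrite -[a]ReC_toC h.
Qed.

Lemma norm_nc z : `|z| <= toC (nc z).
Proof.
case: z => a b.
have -> : (a +i* b)%C = (a%:C + 'i * b%:C)%C :> R[i].
  by apply/eqP; rewrite eq_complex /=; apply/andP; split; apply/eqP; ring.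
apply: (le_trans (ler_normD _ _)); rewrite normrM normCi mul1r.
have hr (t : R) : `|t%:C|%C = (`|t|)%:C%C :> R[i].
  by rewrite normc_def /= expr0n /= addr0 sqrtr_sqr.
rewrite !hr /toC /nc /=.
suff -> : `|a|%:C%C + `|b|%:C%C = (`|a + (0 * b - 1 * 0)| + `|0 + (0 * 0 + 1 * b)|)%:C%C :> R[i] by [].
by rewrite -rmorphD; congr (_%:C)%C; rewrite !(mul0r,mulr0,mul1r,subr0,addr0,add0r).
Qed.

(** Each of the two real parts is bounded by the modulus, hence the factor 2. *)
Lemma nc_norm z e : `|z| < toC e -> nc z < 2 * e.
Proof.
case: z => a b; rewrite normc_def /toC ltcR /= /nc /= => h.
have hs : 0 <= a ^+ 2 + b ^+ 2 by rewrite addr_ge0 ?sqr_ge0.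
have h2 t : t ^+ 2 <= a ^+ 2 + b ^+ 2 -> `|t| < e.
  by move=> ht; apply: le_lt_trans h; rewrite -sqrtr_sqr ler_sqrt.
have := h2 a _; have := h2 b _; rewrite lerDl lerDr !sqr_ge0.
by move=> /(_ isT) ? /(_ isT); lra.
Qed.

Section Matrices.
Implicit Types (m n p : nat).

(** Summing over the entries, instead of taking their maximum, keeps products free of dimension
    factors. *)
Definition nm m n (M : 'M[C]_(m, n)) : R := \sum_i \sum_j nc (M i j).

Lemma nm_ge0 m n (M : 'M[C]_(m, n)) : 0 <= nm M.
Proof. by apply: sumr_ge0 => i _; apply: sumr_ge0 => j _; apply: nc_ge0. Qed.

Lemma nm0 m n : nm (0 : 'M[C]_(m, n)) = 0.
Proof. by rewrite /nm big1 // => i _; rewrite big1 // => j _; rewrite mxE nc0. Qed.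

Lemma nmN m n (M : 'M[C]_(m, n)) : nm (- M) = nm M.
Proof. by apply: eq_bigr => i _; apply: eq_bigr => j _; rewrite mxE ncN. Qed.

Lemma nmD m n (M N : 'M[C]_(m, n)) : nm (M + N) <= nm M + nm N.
Proof.
rewrite /nm -big_split; apply: ler_sum => i _ /=.
by rewrite -big_split; apply: ler_sum => j _ /=; rewrite mxE ncD.
Qed.

Lemma nmB m n (M N : 'M[C]_(m, n)) : nm (M - N) <= nm M + nm N.
Proof. by rewrite -(nmN N) nmD. Qed.

Lemma nmZ m n a (M : 'M[C]_(m, n)) : nm (a *: M) <= nc a * nm M.
Proof.
rewrite /nm mulr_sumr; apply: ler_sum => i _.
by rewrite mulr_sumr; apply: ler_sum => j _; rewrite mxE ncM.
Qed.

Lemma nmT m n (M : 'M[C]_(m, n)) : nm M^T = nm M.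
Proof.
rewrite /nm exchange_big; apply: eq_bigr => i _.
by apply: eq_bigr => j _; rewrite mxE.
Qed.

Lemma nc_nm m n (M : 'M[C]_(m, n)) i j : nc (M i j) <= nm M.
Proof.
rewrite /nm (bigD1 i) //= (bigD1 j) //= -addrA lerDl addr_ge0 //.
  by apply: sumr_ge0 => *; apply: nc_ge0.
by apply: sumr_ge0 => *; apply: sumr_ge0 => *; apply: nc_ge0.
Qed.

Lemma nm_entries m n (M : 'M[C]_(m, n)) (K : R) :
  (forall i j, nc (M i j) <= K) -> nm M <= (m * n)%:R * K.
Proof.
move=> h; apply: (@le_trans _ _ (\sum_(i < m) \sum_(j < n) K)).
  by apply: ler_sum => i _; apply: ler_sum => j _.
by rewrite sumr_const card_ord sumr_const card_ord -mulrnA mulr_natl mulnC.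
Qed.

Lemma nc_sum (I : Type) (s : seq I) (P : pred I) (F : I -> C) :
  nc (\sum_(i <- s | P i) F i) <= \sum_(i <- s | P i) nc (F i).
Proof.
elim/big_rec2: _ => [|i x y _ h]; first by rewrite nc0.
by apply: (le_trans (ncD _ _)); rewrite lerD2l.
Qed.

Lemma nmM m n p (M : 'M[C]_(m, n)) (N : 'M[C]_(n, p)) :
  nm (M *m N) <= nm M * nm N.
Proof.
rewrite /nm mulr_suml; apply: ler_sum => i _.
apply: (@le_trans _ _ (\sum_j \sum_k nc (M i j) * nc (N j k))).
  rewrite exchange_big; apply: ler_sum => k _; rewrite mxE.
  by apply: (le_trans (nc_sum _ _ _)); apply: ler_sum => j _; apply: ncM.
rewrite mulr_suml; apply: ler_sum => j _; rewrite -mulr_sumr.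
apply: ler_wpM2l; first exact: nc_ge0.
rewrite (bigD1 j) //= lerDl; apply: sumr_ge0 => *.
by apply: sumr_ge0 => *; apply: nc_ge0.
Qed.

Lemma nm_eq0 m n (M : 'M[C]_(m, n)) : nm M <= 0 -> M = 0.
Proof.
move=> h; apply/matrixP => i j; rewrite mxE; apply: nc_eq0.
exact: le_trans (nc_nm _ _ _) h.
Qed.

Lemma nm_scalar n (a : C) : nm (a%:M : 'M[C]_n) = n%:R * nc a.
Proof.
rewrite /nm (eq_bigr (fun=> nc a)); first by rewrite sumr_const card_ord mulr_natl.
move=> i _; rewrite (bigD1 i) //= big1 ?addr0 ?mxE ?eqxx //.
by move=> j ij; rewrite !mxE eq_sym (negPf ij) nc0.
Qed.

End Matrices.
End Norms.

(** * Real derivatives, decay at infinity and weights *)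

Section RealDerivatives.
Variable R : realType.

Definition rder (f : R -> R) (x d : R) := is_derive x (1 : R) f d.

Lemma rder_eq f x d d' : rder f x d -> d = d' -> rder f x d'.
Proof. by move=> h <-. Qed.

Lemma rder_cst c x : rder (fun=> c) x 0.
Proof. exact: is_derive_cst. Qed.

Lemma rder_id x : rder id x 1.
Proof. exact: is_derive_id. Qed.

Lemma rderD f g x df dg : rder f x df -> rder g x dg ->
  rder (fun t => f t + g t) x (df + dg).
Proof. by move=> hf hg; apply: is_deriveD. Qed.

Lemma rderN f x df : rder f x df -> rder (fun t => - f t) x (- df).
Proof. by move=> hf; apply: is_deriveN. Qed.

Lemma rderB f g x df dg : rder f x df -> rder g x dg ->
  rder (fun t => f t - g t) x (df - dg).
Proof. by move=> hf /rderN hg; apply: rderD. Qed.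

Lemma rderM f g x df dg : rder f x df -> rder g x dg ->
  rder (fun t => f t * g t) x (df * g x + f x * dg).
Proof.
move=> hf hg; have h := @is_deriveM _ _ f g x 1 df dg hf hg.
by apply: (rder_eq h); rewrite /GRing.scale /=; ring.
Qed.

Lemma rder_comp f g x df dg : rder f (g x) df -> rder g x dg ->
  rder (fun t => f (g t)) x (df * dg).
Proof. by move=> hf hg; have := @is_derive1_comp _ f g x df dg hf hg. Qed.

Lemma rder_sum (I : Type) (s : seq I) (f : I -> R -> R) x (df : I -> R) :
  (forall i, rder (f i) x (df i)) ->
  rder (fun t => \sum_(i <- s) f i t) x (\sum_(i <- s) df i).
Proof.
move=> h; elim: s => [|i s ih].
  rewrite big_nil (_ : (fun _ => _) = fun=> 0); first exact: rder_cst.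
  by apply/funext => t; rewrite big_nil.
rewrite big_cons (_ : (fun _ => _) = fun t => f i t + \sum_(i <- s) f i t); first exact: rderD.
by apply/funext => t; rewrite big_cons.
Qed.

Lemma nonincreasing_rder (f df : R -> R) a b : a <= b ->
  (forall x, a <= x <= b -> rder f x (df x)) ->
  (forall x, a <= x <= b -> df x <= 0) -> f b <= f a.
Proof.
rewrite le_eqVlt => /predU1P[-> //|ab] hd hn.
have hc : {within `[a, b], continuous f}.
  by apply: derivable_within_continuous => x; rewrite in_itv /= => /hd [].
have [|c ci e] := @MVT R f df a b ab _ hc.
  move=> x; rewrite in_itv /= => /andP[h1 h2]; apply: hd.
  by rewrite !ltW.
rewrite -subr_le0 e; move: ci; rewrite in_itv /= => /andP[h1 h2].
by apply: mulr_le0_ge0; [apply: hn; rewrite !ltW | rewrite subr_ge0 ltW].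
Qed.

Definition lim0 (f : R -> R) :=
  forall e : R, 0 < e -> exists X : R, forall x, X < x -> `|f x| < e.

Lemma lim0_le (f g : R -> R) k : 0 <= k -> lim0 g ->
  (forall x, 0 < x -> `|f x| <= k * `|g x|) -> lim0 f.
Proof.
move=> k0 hg h e e0; have [|X hX] := hg (e / (k + 1)); first by rewrite divr_gt0 //; lra.
exists (Num.max X 0) => x; rewrite gt_max => /andP[/hX h1 x0].
apply: (le_lt_trans (h _ x0)).
have h2 : `|g x| * (k + 1) < e by rewrite -ltr_pdivlMr //; lra.
have := normr_ge0 (g x); nra.
Qed.

Lemma lim0D (f g : R -> R) : lim0 f -> lim0 g -> lim0 (fun x => f x + g x).
Proof.
move=> hf hg e e0; have [|X hX] := hf (e / 2); first by lra.
have [|Y hY] := hg (e / 2); first by lra.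
exists (Num.max X Y) => x; rewrite gt_max => /andP[/hX h1 /hY h2].
by apply: (le_lt_trans (ler_normD _ _)); lra.
Qed.

(** A weight models the distance of the profile to its limit; the rate [rho] enters as a
    differential inequality, the form in which a barrier argument uses it. *)
Definition is_weight (rho : R) (w dw : R -> R) :=
  [/\ 0 < rho, forall x, 0 < x -> rder w x (dw x),
      forall x, 0 < x -> dw x <= - (rho * w x),
      forall x, 0 < x -> 0 < w x & lim0 w].

(** Barrier argument: $(M/\rho)w$ has derivative at most $-Mw$, so $\pm G+(M/\rho)w$ is
    nonincreasing; as it tends to $0$ at infinity, it is nonnegative. *)
Lemma tail_real rho w dw (G dG : R -> R) M x0 : is_weight rho w dw ->
  0 < x0 -> (forall x, x0 <= x -> rder G x (dG x)) ->
  (forall x, x0 <= x -> `|dG x| <= M * w x) -> lim0 G ->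
  `|G x0| <= M / rho * w x0.
Proof.
move=> [r0 hw hdw wp wl] x00 hG hdG Gl.
have M0 : 0 <= M.
  have := le_trans (normr_ge0 _) (hdG _ (lexx x0)).
  by rewrite pmulr_lge0 // wp.
have key (F dF : R -> R) : (forall x, x0 <= x -> rder F x (dF x)) ->
    (forall x, x0 <= x -> `|dF x| <= M * w x) -> lim0 F -> - F x0 <= M / rho * w x0.
  move=> hF hdF Fl.
  pose phi x := F x + M / rho * w x.
  have hphi x : x0 <= x -> rder phi x (dF x + (0 * w x + M / rho * dw x)).
    move=> hx; apply: rderD; first exact: hF.
    by apply: rderM; [exact: rder_cst | apply: hw; lra].
  have phil : lim0 phi.
    apply: lim0D => //; apply: (@lim0_le _ w (M / rho)) => //.
      by rewrite divr_ge0 // ltW.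
    by move=> x _; rewrite normrM ger0_norm // divr_ge0 // ltW.
  suff : 0 <= phi x0 by rewrite /phi; lra.
  rewrite leNgt; apply/negP => hlt.
  have [|X hX] := phil (- phi x0); first by lra.
  pose y := Num.max X x0 + 1.
  have hy : X < y /\ x0 < y.
    have h : Num.max X x0 < y by rewrite ltrDl.
    by split; apply: le_lt_trans h; rewrite le_max lexx ?orbT.
  have := hX y hy.1.
  have : phi y <= phi x0.
    apply: (@nonincreasing_rder phi (fun x => dF x + (0 * w x + M / rho * dw x)) x0 y).
    - exact: ltW hy.2.
    - by move=> x /andP[h _]; apply: hphi.
    - move=> x /andP[h _].
      have h1 := le_trans (ler_norm _) (hdF x h).
      have h2 : dw x <= - (rho * w x) by apply: hdw; lra.
      have h3 : M / rho * dw x <= M / rho * - (rho * w x).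
        by apply: ler_wpM2l => //; rewrite divr_ge0 // ltW.
      have h4 : M / rho * - (rho * w x) = - (M * w x) by field; rewrite gt_eqF.
      by lra.
  move=> h1; have := ler_norm (- phi y); rewrite normrN; lra.
rewrite ler_norml; apply/andP; split; first by have := key G dG hG hdG Gl; lra.
have := key (fun x => - G x) (fun x => - dG x).
rewrite opprK; apply.
- by move=> x hx; apply: rderN; apply: hG.
- by move=> x hx; rewrite normrN; apply: hdG.
- by move=> e /Gl[X hX]; exists X => x /hX; rewrite normrN.
Qed.

(** The passage to the limit that ends the bootstrap in [absorb]. *)
Lemma le_halving (a b c : R) : (forall n, a <= b + c / 2 ^+ n) -> a <= b.
Proof.
move=> h; rewrite leNgt; apply/negP => ba.
have e0 : 0 < a - b by lra.
have c0 : 0 <= c by have := h 0; rewrite expr0 divr1; lra.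
have := archi_boundP (divr_ge0 c0 (ltW e0)).
set n := Num.bound _ => hn.
have := h n; rewrite -lerBlDl ler_pdivlMr ?exprn_gt0 //.
rewrite ltr_pdivrMr // in hn.
have h2 : (n%:R : R) <= 2 ^+ n.
  by rewrite -natrX ler_nat ltnW // ltn_expl.
have : (a - b) * n%:R <= (a - b) * 2 ^+ n by rewrite ler_wpM2l // ltW.
by lra.
Qed.

End RealDerivatives.

(** * Complex and matrix functions of a real variable, integrated from infinity *)

Section ComplexDerivatives.
Variable R : realType.
Local Notation C := (Cplx R).

(** The two real parts are differentiated separately, as in [solves], so that the two notions
    convert into each other. *)
Definition cder (f : R -> C) (x : R) (d : C) :=
  rder (fun t => ReC (f t)) x (ReC d) /\ rder (fun t => ImC (f t)) x (ImC d).

Lemma cder_eq f x d d' : cder f x d -> d = d' -> cder f x d'.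
Proof. by move=> h <-. Qed.

Lemma cder_cst (c : C) x : cder (fun=> c) x 0.
Proof. by split; apply: rder_cst. Qed.

Lemma cderD f g x df dg : cder f x df -> cder g x dg ->
  cder (fun t => f t + g t) x (df + dg).
Proof.
move=> [h1 h2] [h3 h4]; split; rewrite ReCE.
  by under [fun t => ReC _]funext => t do rewrite ReCE; apply: rderD.
by under [fun t => ImC _]funext => t do rewrite ReCE; apply: rderD.
Qed.

Lemma cderM f g x df dg : cder f x df -> cder g x dg ->
  cder (fun t => f t * g t) x (df * g x + f x * dg).
Proof.
move=> [h1 h2] [h3 h4]; split.
  under [fun t => ReC _]funext => t do rewrite ReCE.
  apply: (rder_eq (rderB (rderM h1 h3) (rderM h2 h4))).
  by rewrite !ReCE; ring.
under [fun t => ImC _]funext => t do rewrite ReCE.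
apply: (rder_eq (rderD (rderM h1 h4) (rderM h2 h3))).
by rewrite !ReCE; ring.
Qed.

Lemma cderN f x df : cder f x df -> cder (fun t => - f t) x (- df).
Proof.
move=> [h1 h2]; split; rewrite ReCE.
  by under [fun t => ReC _]funext => t do rewrite ReCE; apply: rderN.
by under [fun t => ImC _]funext => t do rewrite ReCE; apply: rderN.
Qed.

Lemma cder_toC f x df : rder f x df -> cder (fun t => toC (f t)) x (toC df).
Proof. by move=> h; split => //; apply: rder_cst. Qed.

Lemma cder_sum (I : Type) (s : seq I) (f : I -> R -> C) x (df : I -> C) :
  (forall i, cder (f i) x (df i)) ->
  cder (fun t => \sum_(i <- s) f i t) x (\sum_(i <- s) df i).
Proof.
move=> h; split; rewrite ?ReC_sum ?ImC_sum.
  under [fun t => ReC _]funext => t do rewrite ReC_sum.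
  by apply: rder_sum => i; apply: (h i).1.
under [fun t => ImC _]funext => t do rewrite ImC_sum.
by apply: rder_sum => i; apply: (h i).2.
Qed.

Lemma cder_comp f g x df dg : cder f (g x) df -> rder g x dg ->
  cder (fun t => f (g t)) x (toC dg * df).
Proof.
move=> [h1 h2] hg; split; rewrite !ReCE.
  by apply: (rder_eq (rder_comp h1 hg)); ring.
by apply: (rder_eq (rder_comp h2 hg)); ring.
Qed.

(** This is $e^{ax}$. *)
Definition cexp (a : C) (x : R) : C :=
  (expR (ReC a * x) * cos (ImC a * x) +i* (expR (ReC a * x) * sin (ImC a * x)))%C.

Lemma cexp0 a : cexp a 0 = 1.
Proof. by apply: ReIm_eq; rewrite /cexp /= !mulr0 expR0 ?cos0 ?sin0 mul1r. Qed.

Lemma rder_expM (p x : R) : rder (fun t => expR (p * t)) x (p * expR (p * x)).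
Proof.
apply: (rder_eq (rder_comp (is_derive_expR _) (rderM (rder_cst p x) (rder_id x)))).
by rewrite /=; ring.
Qed.

Lemma cder_cexp a x : cder (cexp a) x (a * cexp a x).
Proof.
have hq (q : R) : rder (fun t => q * t) x q.
  by apply: (rder_eq (rderM (rder_cst q x) (rder_id x))); rewrite /=; ring.
have hc := rder_comp (is_derive_cos (ImC a * x)) (hq (ImC a)).
have hs := rder_comp (is_derive_sin (ImC a * x)) (hq (ImC a)).
have he := rder_expM (ReC a) x.
split; rewrite !ReCE.
  by apply: (rder_eq (rderM he hc)); rewrite /=; ring.
by apply: (rder_eq (rderM he hs)); rewrite /=; ring.
Qed.

Lemma nc_cexp a x : nc (cexp a x) <= 2 * expR (ReC a * x).
Proof.
rewrite /nc /= !normrM !(ger0_norm (expR_ge0 _)).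
have : `|cos (ImC a * x)| <= 1 by rewrite ler_norml cos_geN1 cos_le1.
have : `|sin (ImC a * x)| <= 1 by rewrite ler_norml sin_geN1 sin_le1.
have := expR_ge0 (ReC a * x); nra.
Qed.

(** The integrating factor $e^{c(x_0-x)}$ removes the linear term and stays bounded on $x\ge x_0$
    because $\mathrm{Re}\,c\ge0$. The constant 4 is a 2 from [nc_cexp] times a 2 from adding real
    and imaginary parts. *)
Lemma tail_complex rho w dw (c : C) (f g : R -> C) M : is_weight rho w dw ->
  0 <= ReC c -> (forall x, 0 < x -> cder f x (c * f x + g x)) ->
  (forall x, 0 < x -> nc (g x) <= M * w x) -> lim0 (fun x => nc (f x)) ->
  forall x, 0 < x -> nc (f x) <= 4 * M / rho * w x.
Proof.
move=> W c0 hf hg fl x0 x00.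
pose F x := cexp c (x0 - x) * f x.
pose dF x := cexp c (x0 - x) * g x.
have hE x : x0 <= x -> nc (cexp c (x0 - x)) <= 2.
  move=> hx; apply: le_trans (nc_cexp _ _) _.
  by rewrite -[leRHS]mulr1 ler_wpM2l // -expR0 ler_expR mulr_ge0_le0 // subr_le0.
have hF x : x0 <= x -> cder F x (dF x).
  move=> hx; have hs : rder (fun t : R => x0 - t) x (-1).
    by apply: (rder_eq (rderB (rder_cst x0 x) (rder_id x))); ring.
  apply: (cder_eq (cderM (cder_comp (cder_cexp c _) hs) (hf x _))); first by lra.
  rewrite /dF (_ : toC (-1) = -1); last by rewrite toCN.
  by ring.
have hdF x : x0 <= x -> nc (dF x) <= (2 * M) * w x.
  move=> hx; apply: le_trans (ncM _ _) _.
  have h1 := hE x hx; have h2 : nc (g x) <= M * w x by apply: hg; lra.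
  have := nc_ge0 (g x); have := nc_ge0 (cexp c (x0 - x)); nra.
have Fl : lim0 (fun x => nc (F x)).
  move=> e e0; have [|X hX] := fl (e / 2); first by lra.
  exists (Num.max X x0) => x; rewrite gt_max => /andP[/hX h1 h2].
  rewrite ger0_norm ?nc_ge0 // in h1; rewrite ger0_norm ?nc_ge0 //.
  apply: le_lt_trans (ncM _ _) _; have := hE x (ltW h2); have := nc_ge0 (f x); nra.
have lr (h : C -> R) : (forall z, `|h z| <= nc z) -> lim0 (fun x => h (F x)).
  move=> hh e /Fl[X hX]; exists X => x /hX; apply: le_lt_trans.
  exact: le_trans (hh _) (ler_norm _).
have r1 : `|ReC (F x0)| <= (2 * M) / rho * w x0.
  apply: (tail_real W x00 (fun x hx => (hF x hx).1)) => [x hx|].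
    exact: le_trans (ReC_nc _) (hdF x hx).
  exact: (lr _ (@ReC_nc R)).
have r2 : `|ImC (F x0)| <= (2 * M) / rho * w x0.
  apply: (tail_real W x00 (fun x hx => (hF x hx).2)) => [x hx|].
    exact: le_trans (ImC_nc _) (hdF x hx).
  exact: (lr _ (@ImC_nc R)).
have e : F x0 = f x0 by rewrite /F subrr cexp0 mul1r.
by rewrite e in r1 r2; rewrite /nc; lra.
Qed.

Section MatrixDerivatives.
Implicit Types m n p : nat.

Definition mder m n (F : R -> 'M[C]_(m, n)) (x : R) (D : 'M[C]_(m, n)) :=
  forall i j, cder (fun t => F t i j) x (D i j).

Lemma mder_eq m n (F : R -> 'M[C]_(m, n)) x D D' : mder F x D -> D = D' -> mder F x D'.
Proof. by move=> h <-. Qed.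

Lemma mder_cst m n (D : 'M[C]_(m, n)) x : mder (fun=> D) x 0.
Proof. by move=> i j; rewrite mxE; apply: cder_cst. Qed.

Lemma mderD m n (F G : R -> 'M[C]_(m, n)) x dF dG : mder F x dF -> mder G x dG ->
  mder (fun t => F t + G t) x (dF + dG).
Proof.
move=> h1 h2 i j; rewrite mxE.
by under [fun t => _]funext => t do rewrite mxE; apply: cderD.
Qed.

Lemma mderN m n (F : R -> 'M[C]_(m, n)) x dF : mder F x dF ->
  mder (fun t => - F t) x (- dF).
Proof.
move=> h1 i j; rewrite mxE.
by under [fun t => _]funext => t do rewrite mxE; apply: cderN.
Qed.

Lemma mderB m n (F G : R -> 'M[C]_(m, n)) x dF dG : mder F x dF -> mder G x dG ->
  mder (fun t => F t - G t) x (dF - dG).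
Proof. by move=> h1 /mderN; apply: mderD. Qed.

Lemma mderT m n (F : R -> 'M[C]_(m, n)) x dF : mder F x dF ->
  mder (fun t => (F t)^T) x dF^T.
Proof.
move=> h1 i j; rewrite mxE.
by under [fun t => _]funext => t do rewrite mxE; apply: h1.
Qed.

Lemma mderM m n p (F : R -> 'M[C]_(m, n)) (G : R -> 'M[C]_(n, p)) x dF dG :
  mder F x dF -> mder G x dG ->
  mder (fun t => F t *m G t) x (dF *m G x + F x *m dG).
Proof.
move=> h1 h2 i j; rewrite !mxE -big_split /=.
under [fun t => _]funext => t do rewrite mxE.
by apply: cder_sum => k; apply: cderM.
Qed.

Lemma mderMl m n p (A : 'M[C]_(m, n)) (G : R -> 'M[C]_(n, p)) x dG :
  mder G x dG -> mder (fun t => A *m G t) x (A *m dG).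
Proof.
move=> h; apply: (mder_eq (mderM (mder_cst A x) h)).
by rewrite mul0mx add0r.
Qed.

Lemma mderMr m n p (F : R -> 'M[C]_(m, n)) (B : 'M[C]_(n, p)) x dF :
  mder F x dF -> mder (fun t => F t *m B) x (dF *m B).
Proof.
move=> h; apply: (mder_eq (mderM h (mder_cst B x))).
by rewrite mulmx0 addr0.
Qed.

Lemma mderZ m n (f : R -> C) (F : R -> 'M[C]_(m, n)) x df dF :
  cder f x df -> mder F x dF ->
  mder (fun t => f t *: F t) x (df *: F x + f x *: dF).
Proof.
move=> h1 h2 i j; rewrite !mxE.
by under [fun t => _]funext => t do rewrite mxE; apply: cderM.
Qed.

Lemma mder_comp m n (F : R -> 'M[C]_(m, n)) (g : R -> R) x dF dg :
  mder F (g x) dF -> rder g x dg -> mder (fun t => F (g t)) x (toC dg *: dF).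
Proof. by move=> h1 h2 i j; rewrite mxE; exact: (cder_comp (h1 i j) h2). Qed.

Lemma tail_matrix rho w dw m n (c : C) (F G : R -> 'M[C]_(m, n)) M :
  is_weight rho w dw -> 0 <= ReC c ->
  (forall x, 0 < x -> mder F x (c *: F x + G x)) ->
  (forall x, 0 < x -> nm (G x) <= M * w x) -> lim0 (fun x => nm (F x)) ->
  forall x, 0 < x -> nm (F x) <= (m * n)%:R * (4 * M / rho) * w x.
Proof.
move=> W c0 hF hG Fl x x0; rewrite -mulrA; apply: nm_entries => i j.
apply: (@tail_complex rho w dw c (fun t => F t i j) (fun t => G t i j) M W c0) => //.
- by move=> y y0; have := hF y y0 i j; rewrite !mxE.
- by move=> y y0; apply: le_trans (hG y y0); apply: nc_nm.
- move=> e /Fl[X hX]; exists X => y /hX.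
  rewrite !ger0_norm ?nc_ge0 ?nm_ge0 //; apply: le_lt_trans; exact: nc_nm.
Qed.

(** Bootstrap: a bound $Bw$ put into the equation and integrated from infinity comes back as
    $(B/2+k/2)w$, since $8NK_1\le\rho$ halves the contribution of the linear term. Iteration leads
    to the fixed point $k$, and the initial constant [M] disappears. *)
Lemma absorb rho w dw m n (D dD : R -> 'M[C]_(m, n)) K1 K2 M :
  is_weight rho w dw -> 0 <= K1 -> 0 <= K2 ->
  8 * (m * n)%:R * K1 <= rho ->
  (forall x, 0 < x -> mder D x (dD x)) ->
  (forall x, 0 < x -> nm (dD x) <= K1 * nm (D x) + K2 * w x) ->
  (forall x, 0 < x -> nm (D x) <= M * w x) ->
  forall x, 0 < x -> nm (D x) <= 8 * (m * n)%:R * K2 / rho * w x.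
Proof.
move=> W K10 K20 hr hD hdD hM.
have [r0 _ _ wp wl] := W.
set N : R := (m * n)%:R in hr *; have N0 : 0 <= N by rewrite ler0n.
have M0 : 0 <= M.
  by have := le_trans (nm_ge0 _) (hM 1 ltr01); rewrite pmulr_lge0 // wp.
pose k := 8 * N * K2 / rho.
have k0 : 0 <= k by rewrite !mulr_ge0 // invr_ge0 ltW.
have step B : 0 <= B -> (forall x, 0 < x -> nm (D x) <= B * w x) ->
    forall x, 0 < x -> nm (D x) <= (B / 2 + k / 2) * w x.
  move=> B0 hB x x0.
  have h : nm (D x) <= N * (4 * (K1 * B + K2) / rho) * w x.
    apply: (@tail_matrix rho w dw m n 0 D dD (K1 * B + K2)) => //.
    - by move=> y y0; apply: (mder_eq (hD y y0)); rewrite scale0r add0r.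
    - move=> y y0; apply: le_trans (hdD y y0) _.
      by rewrite mulrDl lerD2r -mulrA ler_wpM2l // hB.
    - apply: (lim0_le B0 wl) => y y0; rewrite !ger0_norm ?nm_ge0 ?(ltW (wp _ y0)) //.
      exact: hB.
  apply: le_trans h _; apply: ler_wpM2r; first exact: ltW (wp x x0).
  rewrite /k -subr_ge0.
  have -> : B / 2 + 8 * N * K2 / rho / 2 - N * (4 * (K1 * B + K2) / rho)
      = B / 2 * (1 - 8 * N * K1 / rho) by field; rewrite gt_eqF.
  rewrite mulr_ge0 //; first by lra.
  by rewrite subr_ge0 ler_pdivrMr // mul1r.
move=> x x0; apply: (@le_halving _ _ _ (M * w x)) => q.
have : forall q, forall x, 0 < x -> nm (D x) <= (k + M / 2 ^+ q) * w x.
  elim=> [y y0|q' ih y y0].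
    rewrite expr0 divr1 mulrDl; apply: le_trans (hM y y0) _.
    by rewrite lerDr mulr_ge0 // ltW // wp.
  apply: le_trans (step _ _ ih y y0) _.
    by rewrite addr_ge0 // divr_ge0 // exprn_ge0.
  rewrite exprS invfM; apply: ler_wpM2r; [exact: ltW (wp y y0)|].
  set z := _^-1; lra.
move=> /(_ q x x0); rewrite mulrDl; move/le_trans; apply.
by rewrite lerD2l mulrAC.
Qed.

End MatrixDerivatives.
End ComplexDerivatives.

(** * Generalized eigenvectors, eigenprojections and their annihilators *)

Section MatrixPolynomials.
Variables (R : realType) (n : nat).
Local Notation C := (Cplx R).
Implicit Types (A B X : 'M[C]_n.+1) (u v w : 'cV[C]_n.+1) (p q : {poly C}).

Lemma matrix_cols m (M N : 'M[C]_(m, n.+1)) :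
  (forall u, M *m u = N *m u) -> M = N.
Proof.
move=> h; apply/matrixP => i j.
have := congr1 (fun v : 'cV_m => v i 0) (h (delta_mx j 0)).
by rewrite -!colE !mxE.
Qed.

Lemma horner_mxMl A p q u :
  horner_mx A (p * q) *m u = horner_mx A p *m (horner_mx A q *m u).
Proof. by rewrite rmorphM -mulmxE mulmxA. Qed.

Lemma horner_mx_XsubC_exp A a k :
  horner_mx A (('X - a%:P) ^+ k) = (A - a%:M) ^+ k.
Proof. by rewrite rmorphXn rmorphB /= horner_mx_X horner_mx_C. Qed.

Lemma coprime_kill A p q u : coprimep p q ->
  horner_mx A p *m u = 0 -> horner_mx A q *m u = 0 -> u = 0.
Proof.
move=> /Bezout_eq1_coprimepP[[s t] /= e] hp hq.
have : horner_mx A (s * p + t * q) *m u = u by rewrite e rmorph1 mul1mx.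
by rewrite rmorphD /= mulmxDl !horner_mxMl hp hq !mulmx0 addr0.
Qed.

(** A root is split off with its full multiplicity. Bezout's identity for the two coprime factors
    writes $u$ as a generalized eigenvector plus a vector killed by the cofactor, which has smaller
    degree. *)
Lemma geneig_ind A (Q : 'cV[C]_n.+1 -> Prop) p : Q 0 ->
  (forall u v, Q u -> Q v -> Q (u + v)) -> p != 0 ->
  (forall a k u, root p a -> (A - a%:M) ^+ k *m u = 0 -> Q u) ->
  forall u, horner_mx A p *m u = 0 -> Q u.
Proof.
move=> Q0 QD; have [N] := ubnP (size p); elim: N p => // N ih p sp p0 hQ u hu.
have [s1|] := eqVneq (size p) 1%N.
  have /size_poly1P[c c0 e] : size p == 1%N by rewrite s1.
  move: hu; rewrite e horner_mx_C mul_scalar_mx => /eqP.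
  by rewrite scaler_eq0 (negPf c0) /= => /eqP ->.
move=> /closed_rootP[a ra].
have [m [q]] := multiplicity_XsubC p a; rewrite p0 /= => nq e.
have m0 : (0 < m)%N.
  by case: m e => // e; move: nq; rewrite -[q]mulr1 -[1](expr0 ('X - a%:P)) -e ra.
have cop : coprimep q (('X - a%:P) ^+ m) by rewrite coprimep_expr // coprimep_XsubC.
have /Bezout_eq1_coprimepP[[s t] /= est] := cop.
have q0 : q != 0 by apply: contraNneq nq => ->; rewrite root0.
have eu : u = horner_mx A (s * q) *m u + horner_mx A (t * ('X - a%:P) ^+ m) *m u.
  by rewrite -mulmxDl -rmorphD est rmorph1 mul1mx.
rewrite eu; apply: QD.
  apply: (hQ a m) => //; rewrite -horner_mx_XsubC_exp -horner_mxMl.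
  by rewrite mulrCA [_ * q]mulrC -e horner_mxMl hu mulmx0.
apply: (ih q) => //.
- move: sp; rewrite e size_Mmonic ?monic_exp ?monicXsubC //.
  rewrite size_exp_XsubC addnS /= ltnS; apply: leq_trans.
  by rewrite -[X in (X < _)%N]addn0 ltn_add2l.
- move=> b k v rb; apply: hQ; rewrite e rootM rb //.
- by rewrite -horner_mxMl mulrCA -e horner_mxMl hu mulmx0.
Qed.

(** Primary decomposition as an induction principle: by Cayley-Hamilton every vector falls under
    [geneig_ind]. Since [is_eigenprojection] specifies a projection on generalized eigenvectors
    only, all its properties are checked this way. *)
Lemma geneig_all A (Q : 'cV[C]_n.+1 -> Prop) : Q 0 ->
  (forall u v, Q u -> Q v -> Q (u + v)) ->
  (forall a k u, (A - a%:M) ^+ k *m u = 0 -> Q u) -> forall u, Q u.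
Proof.
move=> Q0 QD hQ u; apply: (@geneig_ind A Q (char_poly A)) => //.
- exact: monic_neq0 (char_poly_monic A).
- by move=> a k v _; apply: hQ.
- by rewrite Cayley_Hamilton mul0mx.
Qed.

(** An annihilating polynomial given by the list of its roots with multiplicity, so that one can
    induct on single factors $A-a$. *)
Definition kp (s : seq C) A := horner_mx A (\prod_(a <- s) ('X - a%:P)).

Lemma kp_nil A : kp [::] A = 1%:M.
Proof. by rewrite /kp big_nil rmorph1. Qed.

Lemma kp_cons a s A : kp (a :: s) A = (A - a%:M) *m kp s A.
Proof. by rewrite /kp big_cons rmorphM rmorphB /= horner_mx_X horner_mx_C. Qed.

Lemma kp_consC a s A : kp (a :: s) A = kp s A *m (A - a%:M).
Proof. by rewrite /kp big_cons mulrC rmorphM rmorphB /= horner_mx_X horner_mx_C. Qed.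

Lemma kp_tr s A : kp s A^T = (kp s A)^T.
Proof.
elim: s => [|a s ih]; first by rewrite !kp_nil trmx1.
by rewrite kp_cons kp_consC ih trmx_mul linearB /= tr_scalar_mx.
Qed.

(** [eigenvalue] concerns row vectors, hence the detour through the transpose. *)
Lemma root_eigenvector A z : root (char_poly A) z ->
  exists2 u : 'cV[C]_n.+1, u != 0 & A *m u = z *: u.
Proof.
have e : char_poly A^T = char_poly A.
  by rewrite /char_poly -[RHS]det_tr /char_poly_mx linearB /= tr_scalar_mx map_trmx.
rewrite -e -eigenvalue_root_char => /eigenvalueP[v hv v0].
exists v^T; first by rewrite -trmx0 (inj_eq trmx_inj).
by rewrite -[A]trmxK -trmx_mul hv linearZ.
Qed.

Section Eigenprojection.
Variables (A P : 'M[C]_n.+1) (S : pred C).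
Hypothesis hP : is_eigenprojection A S P.

Lemma eigproj_idem : P *m P = P.
Proof.
apply: matrix_cols; apply: (@geneig_all A) => [|u v hu hv|a k u hu].
- by rewrite !mulmx0.
- by rewrite !mulmxDr hu hv.
- by rewrite -mulmxA (hP hu); case: ifP => Sa; rewrite ?mulmx0 // (hP hu) Sa.
Qed.

Lemma eigproj_comm : P *m A = A *m P.
Proof.
apply: matrix_cols; apply: (@geneig_all A) => [|u v hu hv|a k u hu].
- by rewrite !mulmx0.
- by rewrite !mulmxDr hu hv.
- rewrite -!mulmxA (hP hu).
  have hAu : (A - a%:M) ^+ k *m (A *m u) = 0.
    rewrite -horner_mx_XsubC_exp; have e : A = horner_mx A 'X by rewrite horner_mx_X.
    by rewrite {2}e -horner_mxMl mulrC horner_mxMl horner_mx_XsubC_exp hu mulmx0.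
  by rewrite (hP hAu); case: ifP => _; rewrite ?mulmx0.
Qed.

(** The roots of the characteristic polynomial are sorted by [S]. On a generalized eigenvector the
    product of both annihilators vanishes by Cayley-Hamilton, and the one that omits its eigenvalue
    acts injectively, so the other one vanishes by itself. *)
Lemma eigproj_lists : exists s t,
  [/\ all S s, all (predC S) t, (size s + size t = n.+1)%N,
      forall z, z \in s ++ t -> exists2 u : 'cV[C]_n.+1, u != 0 & A *m u = z *: u &
      kp s A *m P = 0 /\ kp t A *m (1%:M - P) = 0].
Proof.
have [r] := closed_field_poly_normal (char_poly A).
rewrite (monicP (char_poly_monic A)) scale1r => er.
exists [seq z <- r | S z], [seq z <- r | predC S z].
have eprod : (\prod_(a <- [seq z <- r | S z]) ('X - a%:P)) *
    (\prod_(a <- [seq z <- r | predC S z]) ('X - a%:P)) = char_poly A.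
  by rewrite !big_filter er [RHS](bigID S).
have sub a T k u : a \notin [seq z <- r | T z] -> (A - a%:M) ^+ k *m u = 0 ->
    kp [seq z <- r | T z] A *m u = 0 -> u = 0.
  move=> ha hk hT; apply: (@coprime_kill A _ (('X - a%:P) ^+ k) u _ hT); last first.
    by rewrite horner_mx_XsubC_exp; exact: hk.
  by rewrite coprimep_expr // coprimep_XsubC root_prod_XsubC.
have comk s a k u : (A - a%:M) ^+ k *m u = 0 -> (A - a%:M) ^+ k *m (kp s A *m u) = 0.
  move=> hu; rewrite -horner_mx_XsubC_exp -horner_mxMl mulrC horner_mxMl.
  by rewrite horner_mx_XsubC_exp hu mulmx0.
have CH u : horner_mx A (char_poly A) *m u = 0 by rewrite Cayley_Hamilton mul0mx.
split.
- exact: filter_all.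
- exact: filter_all.
- rewrite !size_filter count_predC; have := size_char_poly A.
  by rewrite er size_prod_XsubC => -[].
- move=> z; rewrite mem_cat !mem_filter -andb_orl => /andP[_ zr].
  by apply: root_eigenvector; rewrite er root_prod_XsubC.
- split.
    apply: matrix_cols; apply: (@geneig_all A) => [|u v hu hv|a k u hu].
    + by rewrite !mulmx0.
    + by rewrite !mulmxDr hu hv.
    + rewrite mul0mx -mulmxA (hP hu); case: ifP => Sa; last by rewrite mulmx0.
      apply: (sub a (predC S) k) => //; first by rewrite mem_filter /= Sa.
        exact: comk.
      by rewrite /kp -horner_mxMl mulrC eprod CH.
  apply: matrix_cols; apply: (@geneig_all A) => [|u v hu hv|a k u hu].
  + by rewrite !mulmx0.
  + by rewrite ![_ *m (u + v)]mulmxDr hu hv.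
  + rewrite mul0mx -mulmxA mulmxBl mul1mx (hP hu); case: ifP => Sa.
      by rewrite subrr mulmx0.
    rewrite subr0; apply: (sub a S k) => //; first by rewrite mem_filter Sa.
      exact: comk.
    by rewrite /kp -horner_mxMl eprod CH.
Qed.

End Eigenprojection.

(** * Solutions of systems with constant coefficients *)

Section Exponential.

(** Half of the exponential absorbs one factor $x$, by $e^y\ge1+y$; the other half is left to the
    induction. *)
Lemma lim0_expX j (c : R) : 0 < c -> lim0 (fun x : R => x ^+ j * expR (- (c * x))).
Proof.
elim: j c => [|j ih] c c0.
  move=> e e0; exists (Num.max 0 (1 / (c * e))) => x; rewrite gt_max => /andP[x0 hx].
  rewrite expr0 mul1r ger0_norm ?expR_ge0 // expRN.
  have h := expR_ge1Dx (c * x); rewrite -[e]invrK ltf_pV2 ?posrE ?expR_gt0 ?invr_gt0 //.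
  have : e^-1 < c * x.
    move: hx; rewrite ltr_pdivrMr ?mulr_gt0 // -[e^-1]mul1r ltr_pdivrMr // => h1.
    by rewrite mulrAC mulrC.
  by lra.
have c2 : 0 < c / 2 by lra.
apply: (@lim0_le _ _ _ (c / 2)^-1 _ (ih _ c2)); first by rewrite invr_ge0 ltW.
move=> x x0; rewrite !normrM !(ger0_norm (expR_ge0 _)) !ger0_norm ?exprn_ge0 ?(ltW x0) //.
have -> : expR (- (c * x)) = expR (- (c / 2 * x)) * expR (- (c / 2 * x)).
  by rewrite -expRD; congr expR; lra.
have h : x * expR (- (c / 2 * x)) <= (c / 2)^-1.
  rewrite expRN ler_pdivrMr ?expR_gt0 // -ler_pdivrMl ?invr_gt0 // invrK.
  by have := expR_ge1Dx (c / 2 * x); lra.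
rewrite exprSr; have := expR_ge0 (- (c / 2 * x)); have := exprn_ge0 j (ltW x0).
move: h; set E := expR _; set Z := x ^+ j; set k := _^-1 => h hZ hE.
have -> : Z * x * (E * E) = (Z * E) * (x * E) by ring.
by rewrite [k * _]mulrC ler_wpM2l // mulr_ge0.
Qed.

(** The series of $e^{(A-a)x}u$ cut off at order $k$, which is exact when $(A-a)^ku=0$. *)
Let T A a u k (x : R) : 'cV[C]_n.+1 :=
  \sum_(j < k) toC (x ^+ j / j`!%:R) *: ((A - a%:M) ^+ j *m u).

Lemma rder_pow (x : R) j : rder (fun t : R => t ^+ j.+1 / (j.+1)`!%:R) x (x ^+ j / j`!%:R).
Proof.
have h : forall m, rder (fun t : R => t ^+ m.+1) x (m.+1%:R * x ^+ m).
  elim=> [|m ih]; first by apply: (rder_eq (rder_id x)); rewrite expr0 mulr1.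
  under [fun t => _]funext => t do rewrite exprS.
  apply: (rder_eq (rderM (rder_id x) ih)); rewrite mul1r exprS.
  by rewrite -[in RHS]addn1 natrD; ring.
apply: (rder_eq (rderM (h j) (rder_cst _ x))).
rewrite mulr0 addr0 factS natrM.
have a0 : (j.+1%:R : R) != 0 by rewrite pnatr_eq0.
have b0 : (j`!%:R : R) != 0 by rewrite pnatr_eq0 -lt0n fact_gt0.
have key (a b z : R) : a != 0 -> b != 0 -> a * z / (a * b) = z / b.
  by move=> ? ?; field; apply/andP; split.
exact: key.
Qed.

Lemma geneig_flow A a k u : (A - a%:M) ^+ k *m u = 0 -> exists Z : R -> 'cV[C]_n.+1,
  [/\ Z 0 = u, forall x, mder Z x (A *m Z x) &
      ReC a < 0 -> lim0 (fun x => nm (Z x))].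
Proof.
case: k => [|k] hu.
  exists (fun=> 0); split.
  - by rewrite -hu expr0 mul1mx.
  - by move=> x; rewrite mulmx0; apply: mder_cst.
  - by move=> _ e e0; exists 0 => x _; rewrite nm0 normr0.
have hT m x : mder (T A a u m.+1) x ((A - a%:M) *m T A a u m x).
  elim: m x => [|m ih] x.
    rewrite (_ : T A a u 1 = fun=> u).
      by rewrite /T big_ord0 mulmx0; apply: mder_cst.
    apply/funext => t; rewrite /T big_ord1 expr0 fact0 divr1 mul1mx.
    by rewrite (_ : toC 1 = 1) ?scale1r.
  rewrite (_ : T A a u m.+2 = fun t => T A a u m.+1 t + toC (t ^+ m.+1 / (m.+1)`!%:R) *: ((A - a%:M) ^+ m.+1 *m u)).
    apply: (mder_eq (mderD (ih x) (mderZ (cder_toC (rder_pow x m)) (mder_cst _ x)))).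
    rewrite scaler0 addr0 {2}/T big_ord_recr /= mulmxDr; congr (_ + _).
    by rewrite -scalemxAr exprS -mulmxE mulmxA.
  by apply/funext => t; rewrite /T big_ord_recr.
exists (fun x => cexp a x *: T A a u k.+1 x); split.
- rewrite cexp0 scale1r /T big_ord_recl /= big1 ?addr0.
    by rewrite fact0 divr1 expr0 mul1mx (_ : toC 1 = 1) ?scale1r.
  by move=> i _; rewrite /bump /= add1n expr0n mul0r (_ : toC 0 = 0) ?scale0r.
- move=> x; apply: (mder_eq (mderZ (cder_cexp a x) (hT k x))).
  (* Differentiation loses the last term of the sum; it may be put back because $(A-a)^{k+1}u=0$. *)
  have hk : (A - a%:M) *m T A a u k x = (A - a%:M) *m T A a u k.+1 x.
    rewrite /T big_ord_recr /= mulmxDr -scalemxAr mulmxA mulmxE -exprS hu.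
    by rewrite scaler0 addr0.
  rewrite hk mulmxBl mul_scalar_mx scalerBr scalerA mulrC addrC subrK.
  by rewrite -scalemxAr.
- move=> a0; have sum0 (I : Type) (s : seq I) (f : I -> R -> R) :
      (forall i, lim0 (f i)) -> lim0 (fun x => \sum_(i <- s) f i x).
    move=> hf; elim: s => [|i s ih].
      by move=> e e0; exists 0 => x _; rewrite big_nil normr0.
    under [fun x => _]funext => x do rewrite big_cons.
    exact: lim0D.
  pose f (j : 'I_k.+1) x := 2 * nm ((A - a%:M) ^+ j *m u) / j`!%:R *
    (x ^+ j * expR (- (- ReC a * x))).
  have hf (j : 'I_k.+1) : lim0 (f j).
    have c0 : 0 < - ReC a by lra.
    apply: (@lim0_le _ _ _ (2 * nm ((A - a%:M) ^+ j *m u) / j`!%:R) _ (lim0_expX j c0)).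
      by rewrite divr_ge0 ?mulr_ge0 ?nm_ge0 ?ler0n.
    move=> x x0; rewrite normrM ger0_norm // divr_ge0 ?mulr_ge0 ?nm_ge0 ?ler0n //.
  apply: (@lim0_le _ _ _ 1 _ (sum0 _ (index_enum _) f hf)) => // x x0.
  rewrite mul1r ger0_norm ?nm_ge0 //; apply: le_trans (ler_norm _).
  apply: le_trans (nmZ _ _) _.
  apply: (@le_trans _ _ (2 * expR (ReC a * x) * \sum_(j < k.+1) x ^+ j / j`!%:R * nm ((A - a%:M) ^+ j *m u))).
    apply: ler_pM; rewrite ?nc_ge0 ?nm_ge0 ?nc_cexp //.
    rewrite /T; elim/big_rec2: _ => [|j y M _ h]; first by rewrite nm0.
    apply: le_trans (nmD _ _) _; apply: lerD => //.
    apply: le_trans (nmZ _ _) _; rewrite nc_toC ger0_norm //.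
    by rewrite divr_ge0 ?exprn_ge0 ?ler0n // ltW.
  rewrite mulr_sumr; apply: ler_sum => j _; rewrite /f mulNr opprK.
  by rewrite le_eqVlt; apply/orP; left; apply/eqP; field; rewrite pnatr_eq0 -lt0n fact_gt0.
Qed.

Lemma lim0_nmD (Z1 Z2 : R -> 'cV[C]_n.+1) : lim0 (fun x => nm (Z1 x)) ->
  lim0 (fun x => nm (Z2 x)) -> lim0 (fun x => nm (Z1 x + Z2 x)).
Proof.
move=> h1 h2; apply: (@lim0_le _ _ _ 1 _ (lim0D h1 h2)) => // x _.
by rewrite mul1r !ger0_norm ?nm_ge0 ?addr_ge0 ?nm_ge0 // nmD.
Qed.

Lemma stable_flow A P u : is_eigenprojection A (@stable_eig R) P ->
  exists Z : R -> 'cV[C]_n.+1,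
  [/\ Z 0 = P *m u, forall x, mder Z x (A *m Z x) & lim0 (fun x => nm (Z x))].
Proof.
move=> hP; move: u.
have z0 : exists Z : R -> 'cV[C]_n.+1,
    [/\ Z 0 = 0, forall x, mder Z x (A *m Z x) & lim0 (fun x => nm (Z x))].
  exists (fun=> 0); split => //.
  - by move=> x; rewrite mulmx0; apply: mder_cst.
  - by move=> e e0; exists 0 => x _; rewrite nm0 normr0.
apply: (@geneig_all A) => [|u v [Z [h1 h2 h3]] [Y [k1 k2 k3]]|a k u hu].
- by rewrite mulmx0.
- exists (fun x => Z x + Y x); split.
  + by rewrite mulmxDr h1 k1.
  + by move=> x; rewrite mulmxDr; apply: mderD.
  + exact: lim0_nmD.
- rewrite (hP _ _ _ hu) /stable_eig; case: ifP => Sa //.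
  by have [Z [h1 h2 h3]] := geneig_flow hu; exists Z; split => //; apply: h3.
Qed.

Lemma flow A : exists Z : R -> 'M[C]_n.+1,
  Z 0 = 1%:M /\ forall x, mder Z x (A *m Z x).
Proof.
have h (u : 'cV[C]_n.+1) : exists Z : R -> 'cV[C]_n.+1, Z 0 = u /\ forall x, mder Z x (A *m Z x).
  move: u; apply: (@geneig_all A) => [|u v [Z [h1 h2]] [Y [k1 k2]]|a k u hu].
  - by exists (fun=> 0); split => // x; rewrite mulmx0; apply: mder_cst.
  - exists (fun x => Z x + Y x); split; first by rewrite h1 k1.
    by move=> x; rewrite mulmxDr; apply: mderD.
  - by have [Z [h1 h2 _]] := geneig_flow hu; exists Z.
have /choice[Z hZ] : forall j : 'I_n.+1, exists Z : R -> 'cV[C]_n.+1,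
    Z 0 = col j 1%:M /\ forall x, mder Z x (A *m Z x) by move=> j; apply: h.
exists (fun x => \matrix_(i, j) Z j x i 0); split.
  by apply/matrixP => i j; rewrite mxE (hZ j).1 mxE.
move=> x i j; under [fun t => _]funext => t do rewrite mxE.
apply: (cder_eq ((hZ j).2 x i 0)); rewrite !mxE; apply: eq_bigr => k _.
by rewrite mxE.
Qed.

End Exponential.
End MatrixPolynomials.

(** * Rearrangements in an abelian group *)

Section ZmoduleIdentities.
Variable V : zmodType.
Implicit Types p q x y a b u v w : V.

Lemma telescope_sub p q x y : p - q - (p - x) + (q - y) = x - y.
Proof. by rewrite opprB [p - q + _]addrC !subrKA. Qed.

Lemma sub_sub_cancel a b u v w : a - b - (u - v) = (a - w - u) - (b - w - v).
Proof. by rewrite !opprB [v + (w - b)]addrC [RHS]addrACA subrKA [- u + v]addrC. Qed.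

End ZmoduleIdentities.

(** * Sylvester equations between separated spectra *)

Section Sylvester.
Variables (R : realType) (n : nat).
Local Notation C := (Cplx R).
Implicit Types (A B X G P Q : 'M[C]_n.+1) (s t : seq C).

Lemma sqD_le (x y : R) : (x + y) ^+ 2 <= 2 * (x ^+ 2 + y ^+ 2).
Proof.
rewrite -subr_ge0 (_ : _ - _ = (x - y) ^+ 2) ?sqr_ge0 //; ring.
Qed.

Lemma sq_sum_le (x y : R) : 0 <= x -> 0 <= y -> 4 * (x ^+ 2 + y ^+ 2) <= (2 * (x + y)) ^+ 2.
Proof.
move=> x0 y0; rewrite -subr_ge0 (_ : _ - _ = 8 * (x * y)); last by ring.
by rewrite !mulr_ge0.
Qed.

(** The modulus is multiplicative, $(ac-bd)^2+(ad+bc)^2=(a^2+b^2)(c^2+d^2)$; comparing it with the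
    sum of absolute values on both sides costs the factor 2. *)
Lemma norm_prod_le (a b c d : R) :
  (`|a| + `|b|) * (`|c| + `|d|) <= 2 * (`|a * c - b * d| + `|a * d + b * c|).
Proof.
have e : (a * c - b * d) ^+ 2 + (a * d + b * c) ^+ 2 = (a ^+ 2 + b ^+ 2) * (c ^+ 2 + d ^+ 2) by ring.
move: e; set p := a * c - b * d; set q := a * d + b * c; move: p q => p q e.
have sq (t : R) : `|t| ^+ 2 = t ^+ 2 by rewrite real_normK ?num_real.
have h1 := sqD_le `|a| `|b|; have h2 := sqD_le `|c| `|d|.
have h3 := sq_sum_le (normr_ge0 p) (normr_ge0 q).
rewrite !sq in h1 h2 h3.
have h4 := ler_pM (sqr_ge0 _) (sqr_ge0 _) h1 h2.
have e2 : 2 * (a ^+ 2 + b ^+ 2) * (2 * (c ^+ 2 + d ^+ 2)) = 4 * (p ^+ 2 + q ^+ 2).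
  by rewrite e mulrACA; congr (_ * _); rewrite -natrM.
rewrite e2 in h4; have := le_trans h4 h3; rewrite -exprMn.
have n1 : 0 <= (`|a| + `|b|) * (`|c| + `|d|) by rewrite mulr_ge0 ?addr_ge0 ?normr_ge0.
have n2 : 0 <= 2 * (`|p| + `|q|) by rewrite mulr_ge0 ?addr_ge0 ?normr_ge0.
by rewrite ler_pXn2r.
Qed.

Lemma ncM_ge (x y : C) : nc x * nc y <= 2 * nc (x * y).
Proof. by rewrite /nc ReCM ImCM; apply: norm_prod_le. Qed.

Lemma nmZ_ge m k (z : C) (M : 'M[C]_(m, k)) : nc z * nm M <= 2 * nm (z *: M).
Proof.
rewrite /nm !mulr_sumr; apply: ler_sum => i _; rewrite !mulr_sumr.
by apply: ler_sum => j _; rewrite mxE ncM_ge.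
Qed.

Lemma eigenvalue_bound A (u : 'cV[C]_n.+1) z :
  u != 0 -> A *m u = z *: u -> nc z <= 2 * nm A.
Proof.
move=> u0 e; have up : 0 < nm u.
  rewrite lt_neqAle nm_ge0 andbT; apply: contraNneq u0 => h.
  by apply/eqP; apply: nm_eq0; rewrite -h.
rewrite -(ler_pM2r up); apply: le_trans (nmZ_ge _ _) _.
by rewrite -e -mulrA ler_wpM2l // nmM.
Qed.

Definition sylv A B X := A *m X - X *m B.

Lemma sylvD A B X Y : sylv A B (X + Y) = sylv A B X + sylv A B Y.
Proof. by rewrite /sylv mulmxDr mulmxDl opprD addrACA. Qed.

Lemma sylvN A B X : sylv A B (- X) = - sylv A B X.
Proof. by rewrite /sylv mulmxN mulNmx -opprD. Qed.

Lemma sylvZ A B z X : sylv A B (z *: X) = z *: sylv A B X.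
Proof. by rewrite /sylv -scalemxAr -scalemxAl scalerBr. Qed.

Let sylv_arith (c N D d x y g p : R) : 0 < c -> 0 <= N -> 2 * (1 + 2 * N) / c <= D ->
  1 <= d -> 0 <= g -> c * x <= 2 * y -> y <= g + d * (N * g) + d * (N * g) ->
  p = D * d -> x <= p * g.
Proof.
move=> c0 N0 hD d1 g0 hx hy ->.
have d0 : 0 <= d := le_trans ler01 d1.
have hg1 : g <= d * g by rewrite ler_peMl.
have h4 : c * x <= 2 * ((1 + 2 * N) * (d * g)).
  apply: le_trans hx _; rewrite ler_pM2l //; apply: le_trans hy _.
  have -> : (1 + 2 * N) * (d * g) = d * g + d * (N * g) + d * (N * g) by ring.
  by rewrite !lerD2r.
have h5 : x <= 2 * (1 + 2 * N) / c * (d * g).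
  by rewrite mulrAC ler_pdivlMr // mulrC -mulrA.
by apply: le_trans h5 _; rewrite -[leRHS]mulrA ler_wpM2r // mulr_ge0.
Qed.

(** Double induction on the lists. $(A-a)X$ and $X(B-b)$ have one annihilating factor less, and
    their Sylvester images are that of $X$ times a bounded factor. The identity
    $(a-b)X=(AX-XB)-(A-a)X+X(B-b)$ then recovers $X$, since $|a-b|$ is bounded below. Each factor
    costs one power of $D$. *)
Lemma sylv_bound s t A B X (N c D : R) : 0 < c -> 0 <= N -> 2 * (1 + 2 * N) / c <= D ->
  1 <= D ->
  (forall a, a \in s -> nm (A - a%:M) <= N) ->
  (forall b, b \in t -> nm (B - b%:M) <= N) ->
  (forall a b, a \in s -> b \in t -> c <= `|ReC a - ReC b|) ->
  kp s A *m X = 0 -> X *m kp t B = 0 ->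
  nm X <= D ^+ (size s + size t) * nm (sylv A B X).
Proof.
move=> c0 N0 hD D1; elim: s t X => [|a s ihs] t X.
  move=> _ _ _; rewrite kp_nil mul1mx => -> _.
  by rewrite nm0 mulr_ge0 ?nm_ge0 // exprn_ge0 //; lra.
elim: t X => [|b t iht] X.
  move=> _ _ _ _; rewrite kp_nil mulmx1 => ->.
  by rewrite nm0 mulr_ge0 ?nm_ge0 // exprn_ge0 //; lra.
move=> hs ht hg ks kt.
have X1 : nm ((A - a%:M) *m X) <= D ^+ (size s + (size t).+1) * nm (sylv A B ((A - a%:M) *m X)).
  apply: (ihs (b :: t)) => //.
  - by move=> z zs; apply: hs; rewrite inE zs orbT.
  - by move=> z w zs wt; apply: hg; rewrite // inE zs orbT.
  - by rewrite mulmxA -kp_consC.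
  - by rewrite -mulmxA kt mulmx0.
have X2 : nm (X *m (B - b%:M)) <= D ^+ ((size s).+1 + size t) * nm (sylv A B (X *m (B - b%:M))).
  apply: iht => //.
  - by move=> z zs; apply: ht; rewrite inE zs orbT.
  - by move=> z w zs wt; apply: hg; rewrite // inE wt orbT.
  - by rewrite mulmxA ks mul0mx.
  - by rewrite -mulmxA -kp_cons.
have e1 : sylv A B ((A - a%:M) *m X) = (A - a%:M) *m sylv A B X.
  rewrite /sylv mulmxBr !mulmxA; congr (_ *m X - _).
  by rewrite mulmxBl mulmxBr scalar_mxC.
have e2 : sylv A B (X *m (B - b%:M)) = sylv A B X *m (B - b%:M).
  rewrite /sylv mulmxBl -!mulmxA; congr (_ - X *m _).
  by rewrite mulmxBl mulmxBr scalar_mxC.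
have e3 : (a - b) *: X = sylv A B X - (A - a%:M) *m X + X *m (B - b%:M).
  rewrite /sylv mulmxBl mulmxBr !mul_scalar_mx mul_mx_scalar scalerBl.
  by rewrite telescope_sub.
have hc : c <= nc (a - b).
  have := hg a b (mem_head _ _) (mem_head _ _).
  by rewrite -ReCN -ReCD => h; apply: le_trans h (ReC_nc _).
have hX : c * nm X <= 2 * nm ((a - b) *: X).
  by apply: le_trans (nmZ_ge _ _); rewrite ler_wpM2r ?nm_ge0.
set g := nm (sylv A B X) in X1 X2 *.
have g0 : 0 <= g by exact: nm_ge0.
set d := D ^+ (size s + (size t).+1) in X1.
have d1 : 1 <= d by rewrite exprn_ege1.
have ed : D ^+ ((size s).+1 + size t) = d by rewrite /d addSnnS.
have h1 : nm ((A - a%:M) *m X) <= d * (N * g).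
  apply: le_trans X1 _; rewrite ler_wpM2l //; first exact: le_trans ler01 d1.
  rewrite e1; apply: le_trans (nmM _ _) _; rewrite ler_wpM2r ?nm_ge0 //.
  by apply: hs; rewrite mem_head.
have h2 : nm (X *m (B - b%:M)) <= d * (N * g).
  apply: le_trans X2 _; rewrite ed ler_wpM2l //; first exact: le_trans ler01 d1.
  rewrite e2; apply: le_trans (nmM _ _) _; rewrite mulrC ler_wpM2r ?nm_ge0 //.
  by apply: ht; rewrite mem_head.
have h3 : nm ((a - b) *: X) <= g + d * (N * g) + d * (N * g).
  rewrite e3; apply: le_trans (nmD _ _) _; apply: lerD => //.
  by apply: le_trans (nmB _ _) _; apply: lerD.
exact: (sylv_arith c0 N0 hD d1 g0 hX h3 (exprS D (size s + (size t).+1))).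
Qed.

(** The recursion of [sylv_bound] read as a construction: solutions for the right-hand sides
    $(A-a)G$ and $G(B-b)$ combine to one for $G$ after division by $a-b$. *)
Lemma sylv_solve s t A B G : (forall a b, a \in s -> b \in t -> a != b) ->
  kp s A *m G = 0 -> G *m kp t B = 0 -> exists X, sylv A B X = G.
Proof.
elim: s t G => [|a s ihs] t G.
  move=> _; rewrite kp_nil mul1mx => -> _.
  by exists 0; rewrite /sylv mulmx0 mul0mx subr0.
elim: t G => [|b t iht] G.
  move=> _ _; rewrite kp_nil mulmx1 => ->.
  by exists 0; rewrite /sylv mulmx0 mul0mx subr0.
move=> hg ks kt.
have [|||X1 h1] := ihs (b :: t) ((A - a%:M) *m G) _ _ _.
- by move=> z w zs wt; apply: hg; rewrite // inE zs orbT.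
- by rewrite mulmxA -kp_consC.
- by rewrite -mulmxA kt mulmx0.
have [|||X2 h2] := iht (G *m (B - b%:M)) _ _ _.
- by move=> z w zs wt; apply: hg; rewrite // inE wt orbT.
- by rewrite mulmxA ks mul0mx.
- by rewrite -mulmxA -kp_cons.
have ab : a - b != 0 by rewrite subr_eq0 hg ?mem_head.
exists ((a - b)^-1 *: (G - X1 + X2)).
have -> : sylv A B ((a - b)^-1 *: (G - X1 + X2)) =
    (a - b)^-1 *: (sylv A B G - sylv A B X1 + sylv A B X2).
  by rewrite sylvZ !sylvD sylvN.
rewrite h1 h2 /sylv mulmxBl mulmxBr !mul_scalar_mx mul_mx_scalar.
by rewrite telescope_sub -scalerBl scalerA mulVf ?scale1r.
Qed.

End Sylvester.

(** * Perturbation of eigenprojections *)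

Section ProjectionPerturbation.
Variables (R : realType) (n : nat).
Local Notation C := (Cplx R).
Local Notation eigproj A P := (is_eigenprojection A (@stable_eig R) P).
Implicit Types (A B X G P Q E F M : 'M[C]_n.+1).

(** The distance of the spectrum to the imaginary axis, in terms of eigenvectors because the
    dispersion relation is obtained by pairing with an eigenvector. *)
Definition gap (c : R) A := forall (z : C) (u : 'cV[C]_n.+1),
  u != 0 -> A *m u = z *: u -> c <= `|ReC z|.

(** The constant of [sylv_bound]: eigenvalues are at most $2N$, so $A-a$ is at most
    [N + n.+1%:R * (2 * N)], and either list has at most [n.+1] members. *)
Definition sylvK (c N : R) : R := (1 + 2 * (1 + 2 * (N + n.+1%:R * (2 * N))) / c) ^+ (n.+1 + n.+1).

Lemma kp_proj_comm s A P : P *m A = A *m P -> P *m kp s A = kp s A *m P.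
Proof.
move=> h; elim: s => [|a s ih]; first by rewrite kp_nil mulmx1 mul1mx.
by rewrite kp_cons mulmxA mulmxBr h scalar_mxC -mulmxBl -!mulmxA ih.
Qed.

(** [X] sends one spectral half of [B] into the opposite half of [A]. Their eigenvalues lie on
    different sides of the imaginary axis, so the two gaps separate them. *)
Lemma eigproj_sylv A B P Q c N X : 0 < c -> 0 <= N -> eigproj A P -> eigproj B Q ->
  gap c A -> gap c B -> nm A <= N -> nm B <= N ->
  ((1%:M - P) *m X = X /\ X *m Q = X) \/ (P *m X = X /\ X *m (1%:M - Q) = X) ->
  nm X <= sylvK c N * nm (sylv A B X).
Proof.
move=> c0 N0 hP hQ gA gB nA nB hX.
have [sA [tA [sAs tAs szA eA [kA1 kA2]]]] := eigproj_lists hP.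
have [sB [tB [sBs tBs szB eB [kB1 kB2]]]] := eigproj_lists hQ.
have cB := eigproj_comm hQ.
have cB' : (1%:M - Q) *m B = B *m (1%:M - Q) by rewrite mulmxBl mulmxBr cB mul1mx mulmx1.
set N' := N + n.+1%:R * (2 * N).
have N'0 : 0 <= N' by rewrite addr_ge0 // !mulr_ge0 ?ler0n.
set D := 1 + 2 * (1 + 2 * N') / c.
have q0 : 0 <= 2 * (1 + 2 * N') / c by rewrite divr_ge0 ?(ltW c0) //; lra.
have D1 : 1 <= D by rewrite /D; lra.
have D2 : 2 * (1 + 2 * N') / c <= D by rewrite /D; lra.
have bd A' (z : C) (l : seq C) : nm A' <= N ->
    (forall z, z \in l -> exists2 u : 'cV[C]_n.+1, u != 0 & A' *m u = z *: u) ->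
    z \in l -> nm (A' - z%:M) <= N'.
  move=> hA' hl /hl[u u0 /(eigenvalue_bound u0) hz].
  apply: le_trans (nmB _ _) _; rewrite nm_scalar; apply: lerD => //.
  by apply: ler_wpM2l; rewrite ?ler0n //; lra.
have fin (s t : seq C) : (size s <= n.+1)%N -> (size t <= n.+1)%N ->
    (forall z, z \in s -> z \in sA ++ tA) -> (forall z, z \in t -> z \in sB ++ tB) ->
    (forall a b, a \in s -> b \in t -> c <= `|ReC a - ReC b|) ->
    kp s A *m X = 0 -> X *m kp t B = 0 -> nm X <= sylvK c N * nm (sylv A B X).
  move=> ss st hs ht hg k1 k2.
  apply: le_trans (sylv_bound c0 N'0 D2 D1 _ _ hg k1 k2) _.
  - by move=> a /hs; apply: bd.
  - by move=> a /ht; apply: bd.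
  - by rewrite ler_wpM2r ?nm_ge0 // /sylvK ler_weXn2l // leq_add.
have st a : stable_eig a -> c <= `|ReC a| -> ReC a <= - c.
  by rewrite /stable_eig => h; rewrite ltr0_norm //; lra.
have un a : ~~ stable_eig a -> c <= `|ReC a| -> c <= ReC a.
  by rewrite /stable_eig -leNgt => h; rewrite ger0_norm.
have gA' a : a \in sA ++ tA -> c <= `|ReC a| by move=> /eA[u u0]; apply: gA.
have gB' a : a \in sB ++ tB -> c <= `|ReC a| by move=> /eB[u u0]; apply: gB.
have szA1 : (size sA <= n.+1)%N by rewrite -szA leq_addr.
have szA2 : (size tA <= n.+1)%N by rewrite -szA leq_addl.
have szB1 : (size sB <= n.+1)%N by rewrite -szB leq_addr.
have szB2 : (size tB <= n.+1)%N by rewrite -szB leq_addl.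
case: hX => -[h1 h2].
  apply: (fin tA sB) => //; try by move=> z h; rewrite mem_cat h ?orbT.
  - move=> a b ha hb.
    have := un a (allP tAs _ ha) (gA' a _); rewrite mem_cat ha orbT => /(_ isT).
    have := st b (allP sBs _ hb) (gB' b _); rewrite mem_cat hb => /(_ isT) => h3 h4.
    by apply: le_trans (ler_norm _); lra.
  - by rewrite -h1 mulmxA kA2 mul0mx.
  - by rewrite -h2 -mulmxA (kp_proj_comm _ cB) kB1 mulmx0.
apply: (fin sA tB) => //; try by move=> z h; rewrite mem_cat h ?orbT.
- move=> a b ha hb.
  have := un b (allP tBs _ hb) (gB' b _); rewrite mem_cat hb orbT => /(_ isT).
  have := st a (allP sAs _ ha) (gA' a _); rewrite mem_cat ha => /(_ isT) => h3 h4.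
  by rewrite -normrN; apply: le_trans (ler_norm _); lra.
- by rewrite -h1 mulmxA kA1 mul0mx.
- by rewrite -h2 -mulmxA (kp_proj_comm _ cB') kB2 mulmx0.
Qed.

Lemma sylvK_ge0 c N : 0 < c -> 0 <= N -> 0 <= sylvK c N.
Proof.
move=> c0 N0; rewrite exprn_ge0 // addr_ge0 // divr_ge0 ?(ltW c0) //.
have : 0 <= n.+1%:R * (2 * N) by rewrite !mulr_ge0.
lra.
Qed.

Lemma idem_compl P : P *m P = P -> (1%:M - P) *m (1%:M - P) = 1%:M - P.
Proof. by move=> h; rewrite mulmxBl mul1mx mulmxBr mulmx1 h subrr subr0. Qed.

Lemma nm_compl P p : nm P <= p -> nm (1%:M - P) <= n.+1%:R + p.
Proof.
move=> h; apply: le_trans (nmB _ _) _; rewrite lerD //.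
by rewrite nm_scalar nc1 mulr1.
Qed.

(** $P_1-P_0=(1-P_0)P_1-P_0(1-P_1)$, and both blocks solve Sylvester equations whose right-hand
    sides contain the factor $A_1-A_0$. As $P_1$ has no a priori bound, it is estimated by $P_0$
    plus $q=|P_1-P_0|$, and the smallness of $A_1-A_0$ absorbs the term in $q$. *)
Lemma eigproj_lipschitz A0 A1 P0 P1 c N p : 0 < c -> 0 <= N ->
  eigproj A0 P0 -> eigproj A1 P1 ->
  gap c A0 -> gap c A1 -> nm A0 <= N -> nm A1 <= N -> nm P0 <= p ->
  4 * (sylvK c N * (n.+1%:R + p)) * nm (A1 - A0) <= 1 ->
  nm (P1 - P0) <= 4 * (sylvK c N * (n.+1%:R + p) ^+ 2) * nm (A1 - A0).
Proof.
move=> c0 N0 h0 h1 g0 g1 n0 n1 np; set K := sylvK c N; set p' := _ + p.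
set e := nm (A1 - A0) => hsmall.
have K0 : 0 <= K by exact: sylvK_ge0.
have [i0 i1] := (eigproj_idem h0, eigproj_idem h1).
have [c0' c1'] := (eigproj_comm h0, eigproj_comm h1).
pose X := (1%:M - P0) *m P1; pose Y := P0 *m (1%:M - P1).
have eD : P1 - P0 = X - Y.
  by rewrite /X /Y mulmxBl mulmxBr mul1mx mulmx1 opprB addrA addrNK.
set q := nm (P1 - P0); have q0 : 0 <= q by exact: nm_ge0.
have e0 : 0 <= e by exact: nm_ge0.
have p0 : 0 <= p by apply: le_trans np; apply: nm_ge0.
have p'1 : p <= p' by rewrite lerDr ler0n.
have nP1 : nm P1 <= p' + q.
  by rewrite -[P1](subrK P0); apply: le_trans (nmD _ _) _; rewrite addrC lerD //; lra.
have nQ1 : nm (1%:M - P1) <= p' + q.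
  have -> : 1%:M - P1 = (1%:M - P0) - (P1 - P0) by rewrite opprB addrA subrK.
  by apply: le_trans (nmB _ _) _; rewrite lerD // nm_compl.
have hX : nm X <= K * (p' * e * (p' + q)).
  apply: le_trans (eigproj_sylv (c := c) (N := N) c0 N0 h0 h1 g0 g1 n0 n1 _) _.
    by left; rewrite /X mulmxA idem_compl // -mulmxA i1.
  rewrite ler_wpM2l //.
  have -> : sylv A0 A1 X = (1%:M - P0) *m - (A1 - A0) *m P1.
    have c0'' : (1%:M - P0) *m A0 = A0 *m (1%:M - P0).
      by rewrite mulmxBl mulmxBr mul1mx mulmx1 c0'.
    rewrite /sylv /X opprB mulmxA -c0'' -[_ *m P1 *m A1]mulmxA c1' -!mulmxA.
    by rewrite -mulmxBr -mulmxBl.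
  apply: le_trans (nmM _ _) _; apply: ler_pM; rewrite ?nm_ge0 //.
  by apply: le_trans (nmM _ _) _; rewrite nmN ler_wpM2r // nm_compl.
have hY : nm Y <= K * (p' * e * (p' + q)).
  apply: le_trans (eigproj_sylv (c := c) (N := N) c0 N0 h0 h1 g0 g1 n0 n1 _) _.
    by right; rewrite /Y mulmxA i0 -mulmxA idem_compl.
  rewrite ler_wpM2l //.
  have -> : sylv A0 A1 Y = P0 *m - (A1 - A0) *m (1%:M - P1).
    have c1'' : (1%:M - P1) *m A1 = A1 *m (1%:M - P1).
      by rewrite mulmxBl mulmxBr mul1mx mulmx1 c1'.
    rewrite /sylv /Y opprB mulmxA -c0' -[_ *m (1%:M - P1) *m A1]mulmxA c1'' -!mulmxA.
    by rewrite -mulmxBr -mulmxBl.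
  apply: le_trans (nmM _ _) _; apply: ler_pM; rewrite ?nm_ge0 //.
  apply: le_trans (nmM _ _) _; rewrite nmN ler_wpM2r //; lra.
have hq : q <= 2 * (K * (p' * e * (p' + q))).
  have hq0 : q <= nm X + nm Y by rewrite /q eD nmB.
  by apply: le_trans hq0 _; rewrite mulr_natl mulr2n lerD.
have : 2 * (K * (p' * e * (p' + q))) = 2 * (K * p' ^+ 2) * e + (4 * (K * p') * e) * q / 2 by field.
have : (4 * (K * p') * e) * q <= 1 * q by rewrite ler_wpM2r.
lra.
Qed.

(** First-order expansion of one off-diagonal block $E_0F_1$, where $F_1$ perturbs $F_0$ and [X0]
    solves the linearized Sylvester equation; the error is quadratic as soon as $q=O(h)$. Abstract
    idempotents are used so that the statement covers a projection as well as its complement. *)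
Lemma half_expansion A0 A1 E0 F0 F1 M (h : C) (K p' q : R) :
  0 <= K -> A1 = A0 + h *: M ->
  E0 *m E0 = E0 -> F0 *m F0 = F0 -> E0 *m F0 = 0 ->
  E0 *m A0 = A0 *m E0 -> F0 *m A0 = A0 *m F0 -> F1 *m F1 = F1 -> F1 *m A1 = A1 *m F1 ->
  (forall U, E0 *m U = U -> U *m F0 = U -> nm U <= K * nm (sylv A0 A0 U)) ->
  nm E0 <= p' -> nm F0 <= p' -> nm (F1 - F0) <= q ->
  forall X0, sylv A0 A0 X0 = - (E0 *m M *m F0) ->
  nm (E0 *m F1 - h *: (E0 *m X0 *m F0)) <=
    K * (2 * nc h * nm M * p' ^+ 2 * q) + p' * q ^+ 2.
Proof.
move=> K0 eA iE iF EF cE cF iF1 cF1 hK nE nF nq X0 hX0.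
set X := E0 *m F1; set Xi := E0 *m X0 *m F0; set Y := X *m F0.
have p0 : 0 <= p' by apply: le_trans nE; apply: nm_ge0.
have q0 : 0 <= q by apply: le_trans nq; apply: nm_ge0.
have eX : X = E0 *m (F1 - F0) by rewrite /X mulmxBr EF subr0.
have nX : nm X <= p' * q.
  by rewrite eX; apply: le_trans (nmM _ _) _; apply: ler_pM; rewrite ?nm_ge0.
have hXi : sylv A0 A0 Xi = - (E0 *m M *m F0).
  have -> : sylv A0 A0 Xi = E0 *m sylv A0 A0 X0 *m F0.
    rewrite /sylv mulmxBr mulmxBl /Xi !mulmxA -cE; congr (_ - _).
    by rewrite -!mulmxA cF.
  by rewrite hX0 mulmxN mulNmx !mulmxA iE -!mulmxA iF.
have hY : sylv A0 A0 Y = - (h *: (E0 *m M *m F1 *m F0)) + h *: (X *m M *m F0).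
  have s1 : sylv A0 A1 X = - (h *: (E0 *m M *m F1)).
    rewrite /sylv /X -mulmxA cF1 !mulmxA -cE -mulmxBl -mulmxBr eA opprD addNKr.
    by rewrite mulmxN mulNmx -scalemxAr -scalemxAl.
  have -> : sylv A0 A0 Y = sylv A0 A1 X *m F0 + X *m (A1 - A0) *m F0.
    rewrite /sylv /Y mulmxBr !mulmxBl !mulmxA addrA subrK; congr (_ - _).
    by rewrite -!mulmxA cF.
  rewrite s1 mulNmx -scalemxAl; congr (_ + _).
  by rewrite eA addrAC subrr add0r -scalemxAr -scalemxAl.
have hU : nm (Y - h *: Xi) <= K * (2 * nc h * nm M * p' ^+ 2 * q).
  apply: le_trans (hK _ _ _) _.
  - by rewrite mulmxBr -scalemxAr /Y /X /Xi !mulmxA iE.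
  - by rewrite mulmxBl -scalemxAl /Y /Xi -!mulmxA iF.
  rewrite ler_wpM2l //.
  have -> : sylv A0 A0 (Y - h *: Xi) =
      h *: (X *m M *m F0) - h *: (E0 *m M *m (F1 - F0) *m F0).
    rewrite sylvD sylvN sylvZ hY hXi mulmxBr mulmxBl -[E0 *m M *m F0 *m F0]mulmxA iF.
    move: (E0 *m M *m F1 *m F0) (X *m M *m F0) (E0 *m M *m F0) => u v w.
    by rewrite scalerBr scalerN opprK opprB addrA [X in X + _ = _]addrC addrAC.
  have b1 : nm (h *: (X *m M *m F0)) <= nc h * (p' * q * nm M * p').
    apply: le_trans (nmZ _ _) _; rewrite ler_wpM2l ?nc_ge0 //.
    apply: le_trans (nmM _ _) _; apply: ler_pM; rewrite ?nm_ge0 //.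
    by apply: le_trans (nmM _ _) _; rewrite ler_wpM2r ?nm_ge0.
  have b2 : nm (h *: (E0 *m M *m (F1 - F0) *m F0)) <= nc h * (p' * nm M * q * p').
    apply: le_trans (nmZ _ _) _; rewrite ler_wpM2l ?nc_ge0 //.
    apply: le_trans (nmM _ _) _; apply: ler_pM; rewrite ?nm_ge0 //.
    apply: le_trans (nmM _ _) _; apply: ler_pM; rewrite ?nm_ge0 //.
    by apply: le_trans (nmM _ _) _; rewrite ler_wpM2r ?nm_ge0.
  apply: le_trans (nmB _ _) _.
  have -> : 2 * nc h * nm M * p' ^+ 2 * q = nc h * (p' * q * nm M * p') + nc h * (p' * nm M * q * p') by ring.
  exact: lerD.
have -> : X - h *: Xi = (Y - h *: Xi) + X *m (F1 - F0).
  rewrite mulmxBr -/Y {2}/X -mulmxA iF1 -/X.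
  by rewrite [RHS]addrC addrA subrK.
apply: le_trans (nmD _ _) _; apply: lerD => //.
apply: le_trans (nmM _ _) _; rewrite expr2 mulrA.
by apply: ler_pM; rewrite ?nm_ge0.
Qed.

Lemma eigproj_expansion A0 P0 M c N : 0 < c -> 0 <= N -> eigproj A0 P0 ->
  gap c A0 -> nm A0 <= N -> exists Xi K (d : R), [/\ 0 < d, 0 <= K & forall h P1,
    eigproj (A0 + h *: M) P1 -> gap c (A0 + h *: M) -> nm (A0 + h *: M) <= N ->
    nc h <= d -> nm (P1 - P0 - h *: Xi) <= K * nc h ^+ 2].
Proof.
move=> c0 N0 h0 g0 n0.
have [i0 c0'] := (eigproj_idem h0, eigproj_comm h0).
have c0'' : (1%:M - P0) *m A0 = A0 *m (1%:M - P0).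
  by rewrite mulmxBl mulmxBr mul1mx mulmx1 c0'.
have [s [t [ss ts sz es [k1 k2]]]] := eigproj_lists h0.
have st a b : a \in s -> b \in t -> a != b.
  move=> /(allP ss) ha /(allP ts) hb; apply: contraTneq ha => ->; exact: hb.
have [X1 hX1] : exists X, sylv A0 A0 X = - ((1%:M - P0) *m M *m P0).
  apply: (@sylv_solve _ _ t s).
  - by move=> a b ha hb; rewrite eq_sym; apply: st.
  - by rewrite mulmxN !mulmxA k2 !mul0mx oppr0.
  - by rewrite mulNmx -!mulmxA (kp_proj_comm s c0') k1 !mulmx0 oppr0.
have [X2 hX2] : exists X, sylv A0 A0 X = - (P0 *m M *m (1%:M - P0)).
  apply: (@sylv_solve _ _ s t) => //.
  - by rewrite mulmxN !mulmxA k1 !mul0mx oppr0.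
  - by rewrite mulNmx -!mulmxA (kp_proj_comm t c0'') k2 !mulmx0 oppr0.
set E0 := 1%:M - P0 in hX1 hX2 c0''.
pose K0 := sylvK c N; have K00 : 0 <= K0 by exact: sylvK_ge0.
pose p' := n.+1%:R + nm P0; have p'0 : 0 <= p' by rewrite addr_ge0 ?nm_ge0 ?ler0n.
pose L := 4 * (K0 * p' ^+ 2) * nm M.
have L0 : 0 <= L by rewrite !mulr_ge0 ?nm_ge0 // exprn_ge0.
pose b := 4 * (K0 * p') * nm M.
have b0 : 0 <= b by rewrite !mulr_ge0 ?nm_ge0.
(* The first-order term is the difference of the two blocks, the constant is twice the error of
   [half_expansion] for $q=L|h|$, and the radius ensures the smallness condition of
   [eigproj_lipschitz]. *)
exists (E0 *m X1 *m P0 - P0 *m X2 *m E0),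
  (2 * (K0 * (2 * nm M * p' ^+ 2 * L) + p' * L ^+ 2)), (b + 1)^-1; split.
- by rewrite invr_gt0; lra.
- by rewrite !(mulr_ge0, addr_ge0) // ?exprn_ge0 ?nm_ge0.
move=> h P1 h1 g1 n1 hd.
have [i1 c1'] := (eigproj_idem h1, eigproj_comm h1).
have nh := nc_ge0 h.
have hq : nm (P1 - P0) <= L * nc h.
  have eD : nm (A0 + h *: M - A0) <= nc h * nm M by rewrite addrAC subrr add0r nmZ.
  apply: le_trans (eigproj_lipschitz (c := c) (N := N) (p := nm P0) c0 N0 h0 h1 g0 g1 n0 n1 _ _) _ => //.
    rewrite -/K0 -/p'; apply: (@le_trans _ _ (b * nc h)).
      by rewrite /b -[leRHS]mulrA ler_wpM2l ?mulr_ge0 // mulrC.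
    have : (b + 1) * nc h <= 1.
      by rewrite -ler_pdivlMl ?mulr1 //; lra.
    lra.
  have LL : 0 <= 4 * (K0 * p' ^+ 2).
    by apply: mulr_ge0 => //; apply: mulr_ge0 => //; apply: exprn_ge0.
  by rewrite /L -[leRHS]mulrA; apply: ler_wpM2l => //; rewrite [leRHS]mulrC.
have E0P0 : E0 *m P0 = 0 by rewrite mulmxBl mul1mx i0 subrr.
have P0E0 : P0 *m E0 = 0 by rewrite mulmxBr mulmx1 i0 subrr.
have iE0 := idem_compl i0; have iE1 := idem_compl i1.
have c1'' : (1%:M - P1) *m (A0 + h *: M) = (A0 + h *: M) *m (1%:M - P1).
  by rewrite mulmxBl mulmxBr mul1mx mulmx1 c1'.
have nE0 : nm E0 <= p' by exact: nm_compl.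
have nP0 : nm P0 <= p' by rewrite lerDr ler0n.
have q' : nm ((1%:M - P1) - E0) <= L * nc h.
  by rewrite (_ : _ - _ = - (P1 - P0)) ?nmN // !opprB addrC addrA subrK.
have r1 := half_expansion K00 (erefl (A0 + h *: M)) iE0 i0 E0P0 c0'' c0' i1 c1'
  (fun U u1 u2 => eigproj_sylv c0 N0 h0 h0 g0 g0 n0 n0 (or_introl (conj u1 u2))) nE0 nP0 hq hX1.
have r2 := half_expansion K00 (erefl (A0 + h *: M)) i0 iE0 P0E0 c0' c0'' iE1 c1''
  (fun U u1 u2 => eigproj_sylv c0 N0 h0 h0 g0 g0 n0 n0 (or_intror (conj u1 u2))) nP0 nE0 q' hX2.
rewrite (_ : P1 - P0 - _ = (E0 *m P1 - h *: (E0 *m X1 *m P0)) -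
    (P0 *m (1%:M - P1) - h *: (P0 *m X2 *m E0))); last first.
  have e1 : E0 *m P1 = P1 - P0 *m P1 by rewrite mulmxBl mul1mx.
  have e2 : P0 *m (1%:M - P1) = P0 - P0 *m P1 by rewrite mulmxBr mulmx1.
  by rewrite e1 e2 scalerBr; apply: sub_sub_cancel.
apply: le_trans (nmB _ _) _; apply: le_trans (lerD r1 r2) _.
have eqB (k m p l x : R) : 2 * (k * (2 * m * p ^+ 2 * l) + p * l ^+ 2) * x ^+ 2 =
    (k * (2 * x * m * p ^+ 2 * (l * x)) + p * (l * x) ^+ 2) +
    (k * (2 * x * m * p ^+ 2 * (l * x)) + p * (l * x) ^+ 2) by ring.
by rewrite le_eqVlt; apply/orP; left; apply/eqP; symmetry; exact: eqB.
Qed.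

(** The reflection $x\mapsto-x$ changes the sign of the matrix, so the left half-line also leads to
    a stable projection. *)
Lemma eigproj_oppr A P : is_eigenprojection A (@unstable_eig R) P -> eigproj (- A) P.
Proof.
move=> h a k u hu; rewrite (h (- a) k u).
  by rewrite /unstable_eig /stable_eig ReCN oppr_gt0.
have e : - A - a%:M = - (A - (- a)%:M) by rewrite raddfN opprK opprD.
move: hu; rewrite e exprNn => hu.
have : (-1) ^+ k *: ((A - (- a)%:M) ^+ k *m u) = 0.
  by rewrite -hu -mulmxE -mulmxA -mul_scalar_mx; congr (_ *m _); rewrite rmorphXn /= raddfN.
by move/eqP; rewrite scaler_eq0 signr_eq0 /= => /eqP.
Qed.

End ProjectionPerturbation.

(** * Neighbourhoods, limits and derivatives in terms of the real norms *)

Section TopologyOfNorms.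
Variable R : realType.
Local Notation C := (Cplx R).

Lemma pos_toC (e : C) : 0 < e -> exists2 d : R, 0 < d & e = toC d.
Proof.
case: e => a b; rewrite ltcE /= => /andP[/eqP b0 a0]; exists a => //.
by apply: ReIm_eq; rewrite !ReCE.
Qed.

Lemma toC_gt0 (d : R) : 0 < d -> 0 < toC d.
Proof. by move=> d0; rewrite ltcE /= eqxx. Qed.

Lemma toC_lt (a b : R) : (toC a < toC b) = (a < b).
Proof. by rewrite /toC ltcR. Qed.

Lemma norm_nc_lt (z : C) (d : R) : nc z < d -> `|z| < toC d.
Proof. by move=> h; apply: le_lt_trans (norm_nc z) _; rewrite toC_lt. Qed.

Lemma nbhs_nc (l : C) (P : set C) :
  nbhs l P <-> exists2 d : R, 0 < d & forall l', nc (l' - l) < d -> P l'.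
Proof.
split.
  move=> /nbhs_ballP[e /= e0 h]; have [d d0 ed] := pos_toC e0; exists d => // l' hl; apply: h.
  by rewrite /ball /= ed distrC norm_nc_lt.
move=> [d d0 h]; apply/nbhs_ballP; exists (toC (d / 2)); first by apply: toC_gt0; lra.
move=> l' /=; rewrite /ball /= distrC => hl; apply: h.
by have := nc_norm hl; lra.
Qed.

Lemma nbhs_nm m n (M : 'M[C]_(m, n)) (P : set 'M[C]_(m, n)) :
  nbhs M P <-> exists2 d : R, 0 < d & forall M', nm (M' - M) < d -> P M'.
Proof.
split.
  move=> /nbhs_ballP[e /= e0 h]; have [d d0 ed] := pos_toC e0; exists d => // M' hl; apply: h.
  split=> [|i j]; rewrite ?ed; first exact: toC_gt0.
  rewrite /ball /= distrC; apply: norm_nc_lt.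
  by apply: le_lt_trans hl; have := nc_nm (M' - M) i j; rewrite !mxE.
move=> [d d0 h]; set N : R := (m * n)%:R + 1.
have N0 : 0 < N by rewrite ltr_wpDl.
apply/nbhs_ballP; exists (toC (d / (2 * N))); first by apply: toC_gt0; rewrite divr_gt0 // mulr_gt0.
move=> M' /= hM; apply: h.
have h1 i j : nc ((M' - M) i j) <= d / N.
  have := hM.2 i j; rewrite /ball /= distrC => /nc_norm; rewrite !mxE.
  have -> : 2 * (d / (2 * N)) = d / N by field; rewrite gt_eqF.
  exact: ltW.
apply: le_lt_trans (nm_entries h1) _; rewrite mulrCA -ltr_pdivlMl // mulVf ?gt_eqF //.
by rewrite ltr_pdivrMr // mul1r ltrDl.
Qed.

Lemma cvg_nm (T : Type) (F : set_system T) (FF : Filter F) m n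
  (f : T -> 'M[C]_(m, n)) (M : 'M[C]_(m, n)) :
  f @ F --> M <-> forall e : R, 0 < e -> \forall x \near F, nm (f x - M) < e.
Proof.
split.
  by move=> h e e0; apply: (h [set M' | nm (M' - M) < e]); apply/nbhs_nm; exists e.
move=> h P /nbhs_nm[d d0 hP]; have := h d d0; apply: filterS => x; exact: hP.
Qed.

Lemma derivable_eps m n (f : C -> 'M[C]_(m, n)) (l : C) D : is_derive l (1 : C) f D ->
  forall e : R, 0 < e -> exists2 d : R, 0 < d & forall h, nc h < d ->
    nm (f (l + h) - f l - h *: D) <= e * nc h.
Proof.
move=> [hd hD] e e0.
have : (fun h : C => h^-1 *: (f (h *: 1 + l) - f l)) @ 0^' --> D.
  by rewrite -hD; exact: hd.
move/cvg_nm => /(_ e e0); rewrite near_withinE => /nbhs_nc[d d0 h].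
exists d => // z hz; have [->|z0] := eqVneq z 0.
  by rewrite addr0 scale0r subrr subr0 nm0 nc0 mulr0.
have := h z; rewrite subr0 => /(_ hz z0) hn.
have -> : f (l + z) - f l - z *: D = z *: (z^-1 *: (f (z *: 1 + l) - f l) - D).
  have ez : z *: (1 : C) + l = l + z by rewrite addrC; congr (_ + _); exact: mulr1.
  by rewrite scalerBr scalerA mulfV // scale1r ez.
by apply: le_trans (nmZ _ _) _; rewrite mulrC ler_wpM2r ?nc_ge0 // ltW.
Qed.

Lemma eps_derivable m n (f : C -> 'M[C]_(m, n)) (l : C) D :
  (forall e : R, 0 < e -> exists2 d : R, 0 < d & forall h, nc h < d ->
    nm (f (l + h) - f l - h *: D) <= e * nc h) -> is_derive l (1 : C) f D.
Proof.
move=> h.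
have hc : (fun h : C => h^-1 *: (f (h *: 1 + l) - f l)) @ 0^' --> D.
  apply/cvg_nm => e e0; rewrite near_withinE; apply/nbhs_nc.
  (* [nmZ_ge] costs one factor 2, the strict inequality another. *)
  have [|d d0 hd] := h (e / 4); first by lra.
  exists d => // z; rewrite subr0 => hz z0.
  have zp : 0 < nc z.
    by rewrite lt_neqAle nc_ge0 andbT; apply: contraNneq z0 => /esym/eqP; rewrite eq_le => /andP[/nc_eq0 ->].
  rewrite -(ltr_pM2l zp); apply: le_lt_trans (nmZ_ge _ _) _.
  have -> : z *: (z^-1 *: (f (z *: 1 + l) - f l) - D) = f (l + z) - f l - z *: D.
    have ez : z *: (1 : C) + l = l + z by rewrite addrC; congr (_ + _); exact: mulr1.
    by rewrite scalerBr scalerA mulfV // scale1r ez.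
  have := hd z hz; nra.
by apply: DeriveDef; [apply/cvg_ex; exists D | apply: cvg_lim].
Qed.

Lemma rder_eps (f : R -> R) (x d : R) :
  (forall e : R, 0 < e -> exists2 r : R, 0 < r & forall h, `|h| < r ->
    `|f (x + h) - f x - h * d| <= e * `|h|) -> rder f x d.
Proof.
move=> h.
have hc : (fun h : R => h^-1 *: (f (h *: 1 + x) - f x)) @ 0^' --> d.
  apply/cvgrPdist_lt => e e0; rewrite near_withinE; apply/nbhs_ballP.
  have [|r r0 hd] := h (e / 2); first by lra.
  exists r => // z; rewrite /ball /= sub0r normrN => hz z0.
  have zp : 0 < `|z| by rewrite normr_gt0.
  rewrite distrC -(ltr_pM2l zp) -normrM.
  have -> : z * (z^-1 *: (f (z *: (1 : R) + x) - f x) - d) = f (x + z) - f x - z * d.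
    have ez : z *: (1 : R) + x = x + z by rewrite addrC; congr (_ + _); exact: mulr1.
    by rewrite ez mulrBr; congr (_ - _); exact: (mulVKf z0).
  have := hd z hz; nra.
by apply: DeriveDef; [apply/cvg_ex; exists d | apply: cvg_lim].
Qed.

Lemma mder_eps m n (F : R -> 'M[C]_(m, n)) (x : R) D :
  (forall e : R, 0 < e -> exists2 r : R, 0 < r & forall h, `|h| < r ->
    nm (F (x + h) - F x - toC h *: D) <= e * `|h|) -> mder F x D.
Proof.
move=> h i j.
have key (e : R) : 0 < e -> exists2 r : R, 0 < r & forall h, `|h| < r ->
    nc (F (x + h) i j - F x i j - toC h * D i j) <= e * `|h|.
  move=> /h[r r0 hr]; exists r => // z /hr; apply: le_trans.
  by have := nc_nm (F (x + z) - F x - toC z *: D) i j; rewrite !mxE.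
split; apply: rder_eps => e /key[r r0 hr]; exists r => // z /hr; apply: le_trans.
  by apply: le_trans (ReC_nc _); rewrite !ReCE mul0r subr0.
by apply: le_trans (ImC_nc _); rewrite !ReCE mul0r addr0.
Qed.

Lemma mder_line m n (f : C -> 'M[C]_(m, n)) (a b : C) (t : R) D :
  is_derive (a + toC t * b : C) (1 : C) f D -> mder (fun t => f (a + toC t * b)) t (b *: D).
Proof.
move=> /derivable_eps h; apply: mder_eps => e e0.
set N := nc b + 1; have N0 : 0 < N by have := nc_ge0 b; rewrite /N; lra.
have [|d d0 hd] := h (e / N); first by rewrite divr_gt0.
exists (d / N); first by rewrite divr_gt0.
move=> s hs.
have h1 : nc (toC s * b) <= `|s| * nc b by apply: le_trans (ncM _ _) _; rewrite nc_toC.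
have h2 : `|s| * nc b <= `|s| * N by rewrite ler_wpM2l // /N; lra.
have h3 : `|s| * N < d by rewrite -ltr_pdivlMr.
have := hd (toC s * b); rewrite scalerA toCD mulrDl addrA => /(_ _) h4.
apply: le_trans (h4 _) _; first by lra.
rewrite -mulrA ler_wpM2l ?(ltW e0) // ler_pdivrMl //; lra.
Qed.

Lemma rder_unique (f : R -> R) x d d' : rder f x d -> rder f x d' -> d = d'.
Proof. by move=> [_ <-] [_ <-]. Qed.

Lemma mder_unique m n (F : R -> 'M[C]_(m, n)) x D D' : mder F x D -> mder F x D' -> D = D'.
Proof.
move=> h1 h2; apply/matrixP => i j; apply: ReIm_eq.
  exact: rder_unique (h1 i j).1 (h2 i j).1.
exact: rder_unique (h1 i j).2 (h2 i j).2.
Qed.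

Lemma expR_gronwall (G dG : R -> R) k : (forall t, 0 <= t <= 1 -> rder G t (dG t)) ->
  (forall t, 0 <= t <= 1 -> dG t <= k * G t) -> G 0 <= 0 -> G 1 <= 0.
Proof.
move=> hG hk G0.
have : G 1 * expR (- k * 1) <= G 0 * expR (- k * 0).
  apply: (@nonincreasing_rder _ (fun t => G t * expR (- k * t))
    (fun t => dG t * expR (- k * t) + G t * (- k * expR (- k * t))) 0 1) => //.
  - move=> t ht; apply: rderM; [exact: hG | exact: rder_expM].
  - move=> t /hk; have := expR_gt0 (- k * t); set E := expR _ => E0 h.
    have -> : dG t * E + G t * (- k * E) = (dG t - k * G t) * E by ring.
    by apply: mulr_le0_ge0; [lra | exact: ltW].
rewrite mulr0 expR0 !mulr1 => h.
by have := le_trans h G0; rewrite pmulr_lle0 // expR_gt0.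
Qed.

(** [nm] is not differentiable, so Gronwall's inequality is applied to the sum of the squares of all
    real and imaginary parts, which is comparable to the square of [nm]. *)
Lemma matrix_gronwall m n (F dF : R -> 'M[C]_(m, n)) k : 0 <= k ->
  (forall t, 0 <= t <= 1 -> mder F t (dF t)) ->
  (forall t, 0 <= t <= 1 -> nm (dF t) <= k * nm (F t)) -> F 0 = 0 -> F 1 = 0.
Proof.
move=> k0 hF hd F0.
pose sq (z : C) := ReC z * ReC z + ImC z * ImC z.
have sq0 z : 0 <= sq z by rewrite addr_ge0 // -expr2 sqr_ge0.
pose G t := \sum_i \sum_j sq (F t i j).
pose dsq (z w : C) := (ReC w * ReC z + ReC z * ReC w) + (ImC w * ImC z + ImC z * ImC w).
pose dG t := \sum_i \sum_j dsq (F t i j) (dF t i j).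
have G0 t : 0 <= G t by apply: sumr_ge0 => i _; apply: sumr_ge0 => j _.
have hG t : 0 <= t <= 1 -> rder G t (dG t).
  move=> ht; apply: rder_sum => i; apply: rder_sum => j.
  have [h1 h2] := hF t ht i j.
  by apply: rderD; apply: rderM.
have hsq (z w : C) : dsq z w <= 2 * (nc z * nc w).
  have -> : dsq z w = 2 * (ReC z * ReC w + ImC z * ImC w) by rewrite /dsq; ring.
  rewrite ler_pM2l //; apply: le_trans (ler_norm _) _; apply: le_trans (ler_normD _ _) _.
  rewrite !normrM /nc mulrDl !mulrDr.
  have := mulr_ge0 (normr_ge0 (ReC z)) (normr_ge0 (ImC w)).
  have := mulr_ge0 (normr_ge0 (ImC z)) (normr_ge0 (ReC w)).
  lra.
have hdG t : dG t <= 2 * (nm (F t) * nm (dF t)).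
  rewrite /dG; apply: (@le_trans _ _ (\sum_i \sum_j 2 * (nc (F t i j) * nm (dF t)))).
    apply: ler_sum => i _; apply: ler_sum => j _; apply: le_trans (hsq _ _) _.
    by rewrite ler_pM2l // ler_wpM2l ?nc_ge0 // nc_nm.
  rewrite [in leRHS]/nm mulr_suml mulr_sumr le_eqVlt; apply/orP; left; apply/eqP.
  by apply: eq_bigr => i _; rewrite mulr_suml mulr_sumr.
set N : R := (m * n)%:R.
have hN t : nm (F t) ^+ 2 <= N ^+ 2 * (2 * G t).
  have h i j : nc (F t i j) <= Num.sqrt (2 * G t).
    rewrite -(ler_pXn2r (n := 2)) ?nnegrE ?nc_ge0 ?sqrtr_ge0 // sqr_sqrtr ?mulr_ge0 //.
    apply: (@le_trans _ _ (2 * sq (F t i j))).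
      have := sqD_le `|ReC (F t i j)| `|ImC (F t i j)|.
      by rewrite !real_normK ?num_real // /nc /sq -!expr2.
    rewrite ler_pM2l // /G (bigD1 i) //= (bigD1 j) //= -addrA lerDl addr_ge0 //.
      by apply: sumr_ge0.
    by apply: sumr_ge0 => *; apply: sumr_ge0.
  have := nm_entries h; rewrite -/N => h2.
  rewrite -(sqr_sqrtr (_ : 0 <= 2 * G t)) ?mulr_ge0 // -exprMn.
  by rewrite ler_pXn2r ?nnegrE ?nm_ge0 // mulr_ge0 ?ler0n ?sqrtr_ge0.
have G1 : G 1 <= 0.
  apply: (@expR_gronwall G dG (4 * k * N ^+ 2)) => //.
    move=> t ht; apply: le_trans (hdG t) _.
    apply: (@le_trans _ _ (2 * k * nm (F t) ^+ 2)).
      rewrite -mulrA ler_pM2l // expr2 [nm (F t) * nm (dF t)]mulrC mulrA.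
      by rewrite ler_wpM2r ?nm_ge0 // hd.
    apply: (@le_trans _ _ (2 * k * (N ^+ 2 * (2 * G t)))); first by rewrite ler_wpM2l ?mulr_ge0.
    by rewrite le_eqVlt; apply/orP; left; apply/eqP; ring.
  rewrite /G big1 // => i _; rewrite big1 // => j _.
  by rewrite F0 mxE /sq !ReCE mulr0 addr0.
apply: nm_eq0; rewrite -(ler_pXn2r (n := 2)) ?nnegrE ?nm_ge0 // expr0n.
apply: le_trans (hN 1) _; apply: mulr_ge0_le0; first exact: sqr_ge0.
by apply: mulr_ge0_le0.
Qed.

End TopologyOfNorms.

(** * Kato's equation preserves the range of the projection *)

Section KatoRange.
Variable R : realType.
Local Notation C := (Cplx R).
Local Notation eigproj A P := (is_eigenprojection A (@stable_eig R) P).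
Variables (M0 M1 : 'M[C]_4) (Pi : C -> 'M[C]_4).
Hypothesis hPi : forall l, eigproj (M0 + l *: M1) (Pi l).

(** The ball is not cut down to the half-plane: [Pi] has to be complex differentiable at points of
    the imaginary axis too. *)
Definition locally_gapped (l : C) := exists c d : R, [/\ 0 < c, 0 < d &
  forall l', nc (l' - l) < d -> gap c (M0 + l' *: M1)].

Lemma pencil_shift (l h : C) : M0 + (l + h) *: M1 = (M0 + l *: M1) + h *: M1.
Proof. by rewrite scalerDl addrA. Qed.

Lemma nm_pencil l : nm (M0 + l *: M1) <= nm M0 + nc l * nm M1.
Proof. by apply: le_trans (nmD _ _) _; rewrite lerD2l nmZ. Qed.

Lemma nm_pencil_near l l' : nc (l' - l) <= 1 ->
  nm (M0 + l' *: M1) <= nm M0 + (nc l + 1) * nm M1.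
Proof.
move=> h; apply: le_trans (nm_pencil _) _; rewrite lerD2l ler_wpM2r ?nm_ge0 //.
by rewrite -[l'](subrK l); apply: le_trans (ncD _ _) _; rewrite addrC lerD2l.
Qed.

Lemma eigproj_derivable l : locally_gapped l -> exists Xi, is_derive l (1 : C) Pi Xi.
Proof.
move=> [c [d [c0 d0 hg]]].
set N := nm M0 + (nc l + 1) * nm M1.
have N0 : 0 <= N by rewrite addr_ge0 ?mulr_ge0 ?nm_ge0 // addr_ge0 ?nc_ge0.
have gl : gap c (M0 + l *: M1) by apply: hg; rewrite subrr nc0.
have nl : nm (M0 + l *: M1) <= N by apply: nm_pencil_near; rewrite subrr nc0.
have [Xi [K [d1 [d10 K0 h]]]] := eigproj_expansion M1 c0 N0 (@hPi l) gl nl.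
exists Xi; apply: eps_derivable => e e0.
have K1 : 0 < K + 1 by rewrite ltr_wpDl.
exists (Num.min (Num.min 1 d) (Num.min d1 (e / (K + 1)))).
  by rewrite !lt_min ltr01 d0 d10 divr_gt0.
move=> z; rewrite !lt_min => /andP[/andP[z1 zd] /andP[zd1 ze]].
have el : l + z - l = z by rewrite addrC addKr.
have := h z (Pi (l + z)); rewrite -pencil_shift => h1.
apply: le_trans (h1 (@hPi _) _ _ (ltW zd1)) _.
- by apply: hg; rewrite el.
- by apply: nm_pencil_near; rewrite el ltW.
- rewrite expr2 mulrA ler_wpM2r ?nc_ge0 //.
  move: ze; rewrite ltr_pdivlMr // => ze.
  apply: le_trans (ltW ze); rewrite [nc z * _]mulrC ler_wpM2r ?nc_ge0 //.
  by rewrite lerDl.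
Qed.

(** A local Lipschitz constant bounds the derivative. [eigproj_lipschitz] presupposes a bound on its
    base projection: used at the centre [l] it bounds the projections nearby by [p0 + 1], and with
    this bound it applies at the nearby points themselves. *)
Lemma eigproj_derive_bounded l : locally_gapped l -> exists d K : R, 0 < d /\
  forall l', nc (l' - l) < d ->
  nm (Pi l') <= K /\ forall Xi, is_derive l' (1 : C) Pi Xi -> nm Xi <= K.
Proof.
move=> [c [d [c0 d0 hg]]].
set N := nm M0 + (nc l + 1) * nm M1.
have N0 : 0 <= N by rewrite addr_ge0 ?mulr_ge0 ?nm_ge0 // addr_ge0 ?nc_ge0.
have lip l1 l2 p : nc (l1 - l) <= 1 -> nc (l2 - l) <= 1 -> nc (l1 - l) < d ->
    nc (l2 - l) < d -> nm (Pi l1) <= p ->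
    4 * (sylvK 3 c N * (4%:R + p)) * (nm M1 * nc (l2 - l1)) <= 1 ->
    nm (Pi l2 - Pi l1) <= 4 * (sylvK 3 c N * (4%:R + p) ^+ 2) * (nm M1 * nc (l2 - l1)).
  move=> a1 a2 b1 b2 hp hs.
  have p0 : 0 <= p := le_trans (nm_ge0 _) hp.
  have p4 : 0 <= 4%:R + p by rewrite addr_ge0.
  have K0 : 0 <= sylvK 3 c N by exact: sylvK_ge0.
  have eA : (M0 + l2 *: M1) - (M0 + l1 *: M1) = (l2 - l1) *: M1.
    by rewrite opprD addrACA subrr add0r -scalerBl.
  have hA : nm ((M0 + l2 *: M1) - (M0 + l1 *: M1)) <= nm M1 * nc (l2 - l1).
    by rewrite eA mulrC nmZ.
  have q1 : 0 <= 4 * (sylvK 3 c N * (4%:R + p)).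
    by apply: mulr_ge0 => //; apply: mulr_ge0.
  have q2 : 0 <= 4 * (sylvK 3 c N * (4%:R + p) ^+ 2).
    by apply: mulr_ge0 => //; apply: mulr_ge0 => //; apply: exprn_ge0.
  have := eigproj_lipschitz c0 N0 (@hPi l1) (@hPi l2) (hg _ b1) (hg _ b2)
    (nm_pencil_near a1) (nm_pencil_near a2) hp.
  move=> /(_ (le_trans (ler_wpM2l q1 hA) hs)) h; apply: le_trans h _.
  exact: ler_wpM2l.
have small (a b : R) : 0 <= a -> 0 <= b -> exists2 r : R, 0 < r &
    forall x, 0 <= x -> x < r -> a * (b * x) <= 1.
  move=> a0 b0; exists (a * b + 1)^-1; first by rewrite invr_gt0 ltr_wpDl ?mulr_ge0.
  move=> x x0; rewrite -div1r ltr_pdivlMr ?ltr_wpDl ?mulr_ge0 // => hx.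
  apply: le_trans (ltW hx); rewrite mulrA mulrC ler_wpM2l // lerDl //.
have K0 : 0 <= sylvK 3 c N by exact: sylvK_ge0.
have q1 p : 0 <= p -> 0 <= 4 * (sylvK 3 c N * (4%:R + p)).
  by move=> p0; apply: mulr_ge0 => //; apply: mulr_ge0 => //; apply: addr_ge0.
have q2 p : 0 <= p -> 0 <= 4 * (sylvK 3 c N * (4%:R + p) ^+ 2).
  by move=> p0; apply: mulr_ge0 => //; apply: mulr_ge0 => //; apply: exprn_ge0; apply: addr_ge0.
pose p0 := nm (Pi l); have p00 : 0 <= p0 by exact: nm_ge0.
have [r1 r10 hr1] := small _ (nm M1) (q1 p0 p00) (nm_ge0 _).
have [r2 r20 hr2] := small _ (nm M1) (q2 p0 p00) (nm_ge0 _).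
pose p := p0 + 1; have pp0 : 0 <= p by rewrite addr_ge0.
have [r3 r30 hr3] := small _ (nm M1) (q1 p pp0) (nm_ge0 _).
pose L := 4 * (sylvK 3 c N * (4%:R + p) ^+ 2) * nm M1.
pose dd := Num.min (Num.min 1 d) (Num.min r1 r2).
exists dd, (p + 2 * (L + 1)).
split; first by rewrite !lt_min ltr01 d0 r10.
have bp l' : nc (l' - l) < dd -> nm (Pi l') <= p.
  rewrite !lt_min => /andP[/andP[h1 hd] /andP[hr1' hr2']].
  rewrite -[Pi l'](subrK (Pi l)); apply: le_trans (nmD _ _) _.
  rewrite addrC lerD2l.
  have nn := nc_ge0 (l' - l).
  apply: le_trans (lip l l' p0 _ (ltW h1) _ hd (lexx _) (hr1 _ nn hr1')) (hr2 _ nn hr2').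
  - by rewrite subrr nc0.
  - by rewrite subrr nc0.
move=> l' hl'; have hp := bp l' hl'.
have L0 : 0 <= L by apply: mulr_ge0; [exact: q2 | exact: nm_ge0].
split; first by apply: le_trans hp _; rewrite lerDl mulr_ge0 // addr_ge0.
move=> Xi /derivable_eps /(_ 1 ltr01)[e e0 he].
pose gd := Num.min (dd - nc (l' - l)) (Num.min e r3).
have gd0 : 0 < gd by rewrite !lt_min subr_gt0 hl' e0.
pose z := toC (gd / 2).
have nz : nc z = gd / 2 by rewrite nc_toC ger0_norm // divr_ge0 // ltW.
have z0 : 0 < nc z by rewrite nz divr_gt0.
have : nc z < gd by rewrite nz ltr_pdivrMr // ltr_pMr // ltr1n.
rewrite !lt_min => /andP[z1 /andP[z2 z3]].
have hz : nc (l' + z - l) < dd.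
  by rewrite addrAC; apply: le_lt_trans (ncD _ _) _; rewrite -ltrBrDl.
have ez : l' + z - l' = z by rewrite addrC addKr.
have cl l1 : nc (l1 - l) < dd -> nc (l1 - l) <= 1 /\ nc (l1 - l) < d.
  by rewrite !lt_min => /andP[/andP[/ltW ? ?] _].
have [a1 b1] := cl _ hl'; have [a2 b2] := cl _ hz.
have := lip l' (l' + z) p a1 a2 b1 b2 hp; rewrite ez => /(_ (hr3 _ (ltW z0) z3)) hL.
have h1 : nm (z *: Xi) <= (L + 1) * nc z.
  have -> : z *: Xi = (Pi (l' + z) - Pi l') - (Pi (l' + z) - Pi l' - z *: Xi).
    by rewrite opprB addrC subrK.
  apply: le_trans (nmB _ _) _; rewrite mulrDl; apply: lerD; last exact: he.
  by apply: le_trans hL _; rewrite mulrA.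
have h2 := le_trans (nmZ_ge z Xi) (ler_wpM2l (ler0n R 2) h1).
have h3 : nm Xi <= 2 * (L + 1).
  by rewrite -(ler_pM2l z0); apply: le_trans h2 _; rewrite mulrA mulrC.
by apply: le_trans h3 _; rewrite lerDr.
Qed.

Lemma kato_range (l0 : R) R0 Rs : 0 < l0 ->
  (forall l, puncturedRHP l -> locally_gapped l) ->
  kato_solution Pi l0 R0 Rs ->
  Pi (toC l0) *m map_mx (@toC R) R0 = map_mx (@toC R) R0 ->
  forall l, puncturedRHP l -> Pi l *m Rs l = Rs l.
Proof.
move=> l00 hg [hR hR0] hPi0 l [lre lne].
(* The segment from $\lambda_0>0$ to $\lambda$ avoids $0$: its real part is positive before the
   endpoint, and $\lambda\ne0$. *)
pose b := l - toC l0; pose g (t : R) : C := toC l0 + toC t * b.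
have gp t : 0 <= t <= 1 -> puncturedRHP (g t).
  move=> /andP[t0 t1].
  have eRe : ReC (g t) = (1 - t) * l0 + t * ReC l.
    by rewrite /g /b !ReCE; ring.
  have r0 : 0 <= ReC (g t) by rewrite eRe addr_ge0 ?mulr_ge0 ?subr_ge0 // ltW.
  split => //; apply/eqP => gt0.
  have [t1'|t1'] := eqVneq t 1.
    move: lne; rewrite -gt0 /g t1' (_ : toC 1 = 1) // mul1r /b addrC subrK.
    by rewrite eqxx.
  have : 0 < ReC (g t).
    by rewrite eRe ltr_pwDl ?mulr_ge0 // mulr_gt0 // subr_gt0 lt_neqAle t1'.
  by rewrite gt0 ltxx.
have gD t : 0 <= t <= 1 -> is_derive (g t) (1 : C) Pi ('D_1 Pi (g t)).
  move=> ht; have [Xi hXi] := eigproj_derivable (hg _ (gp t ht)).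
  by have e : 'D_1 Pi (g t) = Xi by exact: derive_val.
(* Compactness of the segment merges the local bounds into one constant, as Gronwall's inequality
   requires. *)
have [k hk] : exists k : R, forall t, 0 <= t <= 1 ->
    nm (Pi (g t)) <= k /\ nm ('D_1 Pi (g t)) <= k.
  have /compact_near_coveringP := @segment_compact R 0 1.
  move=> /(_ R +oo (fun k t => 0 <= t <= 1 -> nm (Pi (g t)) <= k /\ nm ('D_1 Pi (g t)) <= k)).
  have hnear : forall x : R, `[0, 1]%classic x -> \forall x' \near x & i \near +oo,
      0 <= x' <= 1 -> nm (Pi (g x')) <= i /\ nm ('D_1 Pi (g x')) <= i.
    move=> x; rewrite /= in_itv /= => hx.
    have [d [K [d0 hd]]] := eigproj_derive_bounded (hg _ (gp x hx)).
    pose dx := d / (nc b + 1).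
    have nb : 0 < nc b + 1 by rewrite ltr_wpDl ?nc_ge0.
    exists ([set y | `|x - y| < dx], [set i | K <= i]).
      split => /=; last by apply: nbhs_pinfty_ge; rewrite num_real.
      by apply/nbhs_ballP; exists dx => //=; rewrite divr_gt0.
    move=> [y i] /= [hy hi] h01.
    have hyd : nc (g y - g x) < d.
      rewrite /g opprD addrACA subrr add0r -mulrBl -toCN -toCD.
      apply: le_lt_trans (ncM _ _) _; rewrite nc_toC distrC.
      apply: (@le_lt_trans _ _ (`|x - y| * (nc b + 1))); first by rewrite ler_wpM2l ?lerDl.
      by rewrite -ltr_pdivlMr.
    have [h1 h2] := hd _ hyd.
    by split; [apply: le_trans h1 hi | apply: le_trans (h2 _ (gD y h01)) hi].
  move=> /(_ _ hnear) /pinfty_ex_gt0[k _ hk]; exists k => t ht.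
  by apply: hk => //=; rewrite in_itv.
pose Q t := (1%:M - Pi (g t)) *m Rs (g t).
pose dQ t := - (Pi (g t) *m (b *: 'D_1 Pi (g t)) *m Q t).
have hQ t : 0 <= t <= 1 -> mder Q t (dQ t).
  move=> ht; set P := Pi (g t); set D := b *: 'D_1 Pi (g t).
  have hP : mder (fun t => Pi (g t)) t D by apply: mder_line; exact: gD.
  have hRt : mder (fun t => Rs (g t)) t (D *m Rs (g t)).
    by rewrite /D -scalemxAl; apply: mder_line; apply: hR; exact: gp.
  have iP t' : Pi (g t') *m Pi (g t') = Pi (g t') := eigproj_idem (@hPi _).
  have eD : D = D *m P + P *m D.
    apply: (mder_unique hP); have := mderM hP hP.
    by under [fun t => _ *m _]funext => t' do rewrite iP.
  (* Differentiating $\Pi^2=\Pi$ gives $\Pi\Pi'\Pi=0$; this permits replacing [Rs] by [Q] on the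
     right-hand side, so that the equation for [Q] closes. *)
  have PDP : P *m D *m P = 0.
    have := congr1 (fun X => P *m X) eD; rewrite mulmxDr !mulmxA iP -/P.
    by rewrite -{1}[P *m D]add0r => /addIr.
  apply: (mder_eq (mderM (mderB (mder_cst 1%:M t) hP) hRt)).
  have e1 : (1%:M - P) *m (D *m Rs (g t)) = D *m Rs (g t) - P *m D *m Rs (g t).
    by rewrite mulmxBl mul1mx mulmxA.
  have e2 : P *m D *m ((1%:M - P) *m Rs (g t)) = P *m D *m Rs (g t).
    by rewrite mulmxBl mul1mx mulmxBr [P *m D *m (P *m _)]mulmxA PDP mul0mx subr0.
  by rewrite /dQ -/P -/D /Q -/P sub0r mulNmx e1 e2 addKr.
have Q0 : Q 0 = 0.
  by rewrite /Q /g (_ : toC 0 = 0) // mul0r addr0 hR0 mulmxBl mul1mx hPi0 subrr.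
have k0 : 0 <= k.
  by have [] := hk 0 _; rewrite ?lexx ?ler01 //; move=> h _; apply: le_trans h; exact: nm_ge0.
have : Q 1 = 0.
  apply: (@matrix_gronwall R 4 2 Q dQ (k * (nc b * k))) => //.
    by rewrite !mulr_ge0 ?nc_ge0.
  move=> t ht; rewrite /dQ nmN; apply: le_trans (nmM _ _) _.
  rewrite ler_wpM2r ?nm_ge0 //; have [h1 h2] := hk t ht.
  apply: le_trans (nmM _ _) _; apply: ler_pM; rewrite ?nm_ge0 //.
  by apply: le_trans (nmZ _ _) _; rewrite ler_wpM2l ?nc_ge0.
have el : toC l0 + (l - toC l0) = l by rewrite addrC subrK.
rewrite /Q /g (_ : toC 1 = 1) // mul1r /b el mulmxBl mul1mx.
by move/eqP; rewrite subr_eq0 => /eqP.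
Qed.

End KatoRange.

(** * Rearrangements of affine expressions in a module *)

Section ModuleIdentities.
Variables (K : comNzRingType) (V : lmodType K).
Implicit Types (a b c d : V) (x y l : K).

Lemma sub_sub_swap a b c d : a - b - (c - d) = (a - c) - (b - d).
Proof. by rewrite !opprB addrACA [RHS]addrACA [- c - b]addrC. Qed.

Lemma pencil_rearrange a b c d x y l :
  a + x *: (b + l *: c) + y *: d = (a + x *: b + y *: d) + l *: (x *: c).
Proof.
have e : x *: (l *: c) = l *: (x *: c) by rewrite !scalerA mulrC.
by rewrite scalerDr e [a + (_ + _)]addrA [RHS]addrAC.
Qed.

Lemma sub_affine a b d x x' y y' :
  (a + x *: b + y *: d) - (a + x' *: b + y' *: d) = (x - x') *: b + (y - y') *: d.
Proof. by rewrite !scalerBl opprD addrACA opprD [X in X + _ = _]addrACA subrr add0r. Qed.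

Lemma scale_pencil a b x l : x *: (a + l *: b) = x *: a + l *: (x *: b).
Proof. by rewrite scalerDr !scalerA [x * l]mulrC. Qed.

End ModuleIdentities.

Local Notation i0 := (@Ordinal 4 0 isT).
Local Notation i1 := (@Ordinal 4 1 isT).
Local Notation i2 := (@Ordinal 4 2 isT).
Local Notation i3 := (@Ordinal 4 3 isT).

(** * The coefficient matrix as a function of the value of the profile *)

Section ConstantCoefficient.
Variable R : realType.
Local Notation C := (Cplx R).
Local Notation eigproj A P := (is_eigenprojection A (@stable_eig R) P).
Variables (mu0 sigma B : R).
Hypotheses (mu00 : 0 < mu0) (sigma0 : 0 < sigma) (B0 : 0 <= B).

(** [evans_mx] sees $x$ only through the value of the profile, so estimates for this function of [v]
    cover all $x$, all $r$ and both limits at once. *)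
Definition frozen_mx (v : R) (l : C) : 'M[C]_4 := evans_mx 1 mu0 sigma B (fun=> v) 0 l.

Lemma sum_ord4 (V : nmodType) (F : 'I_4 -> V) :
  \sum_i F i = F i0 + F i1 + F i2 + F i3.
Proof.
rewrite !big_ord_recl big_ord0 addr0 !addrA.
by do ![congr (_ + _)]; congr F; apply: val_inj.
Qed.

Lemma ord4P (P : 'I_4 -> Prop) : P i0 -> P i1 -> P i2 -> P i3 -> forall i, P i.
Proof.
move=> h0 h1 h2 h3 [[|[|[|[|//]]]] hi].
- by rewrite (_ : Ordinal hi = i0) //; apply: val_inj.
- by rewrite (_ : Ordinal hi = i1) //; apply: val_inj.
- by rewrite (_ : Ordinal hi = i2) //; apply: val_inj.
- by rewrite (_ : Ordinal hi = i3) //; apply: val_inj.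
Qed.

Definition frozen0 : 'M[C]_4 := delta_mx i0 i1.
Definition frozen1 : 'M[C]_4 := delta_mx i1 i1 + toC (- (sigma * B)) *: delta_mx i1 i3
  + toC (sigma * mu0) *: delta_mx i2 i3 + toC (- B) *: delta_mx i3 i1.
Definition frozen2 : 'M[C]_4 := delta_mx i1 i0 + delta_mx i3 i2.
Definition frozen3 : 'M[C]_4 := toC (sigma * mu0) *: delta_mx i3 i3.

(** Quadratic in [v] and affine in [l]: every Lipschitz estimate below is read off from this form,
    and the affine dependence on [l] is what the results on pencils need. *)
Lemma frozen_mxE v l : frozen_mx v l =
  frozen0 + toC v *: (frozen1 + l *: frozen2) + toC (v ^+ 2) *: frozen3.
Proof.
apply/matrixP; apply: ord4P; apply: ord4P;
  rewrite /frozen_mx /frozen0 /frozen1 /frozen2 /frozen3 !mxE /=;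
  rewrite ?mulr1n ?mulr0n ?mulr0 ?mulr1 ?mul0r ?addr0 ?add0r ?divr1 //.
all: by apply: ReIm_eq; rewrite !ReCE; ring.
Qed.

(** The factor 2 is the Lipschitz constant of $v^2$ on $[0,1]$. *)
Definition frozenK : R := nm frozen0 + nm frozen1 + nm frozen2 + 2 * nm frozen3.

Lemma frozenK_ge0 : 0 <= frozenK.
Proof. by rewrite !addr_ge0 ?mulr_ge0 ?nm_ge0. Qed.

Lemma frozen_pencil v l : frozen_mx v l =
  (frozen0 + toC v *: frozen1 + toC (v ^+ 2) *: frozen3) + l *: (toC v *: frozen2).
Proof.
by rewrite frozen_mxE; exact: pencil_rearrange.
Qed.

Let nb (a b c d t k : R) : 0 <= a -> 0 <= b -> 0 <= c -> 0 <= d -> 0 <= t -> 0 <= k ->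
  k * (b + t * c + 2 * d) <= (a + b + c + 2 * d) * (1 + t) * k.
Proof.
move=> a0 b0 c0 d0 t0 k0; rewrite mulrC ler_wpM2r //.
have := mulr_ge0 a0 t0; have := mulr_ge0 b0 t0; have := mulr_ge0 d0 t0.
by have := mulr_ge0 c0 t0; lra.
Qed.

Let nb2 (a b c d t y z : R) : 0 <= a -> 0 <= b -> 0 <= c -> 0 <= d -> 0 <= t ->
  y <= b + t * c -> z <= d -> a + (y + z) <= (a + b + c + 2 * d) * (1 + t).
Proof.
move=> a0 b0 c0 d0 t0 hy hz.
have := mulr_ge0 a0 t0; have := mulr_ge0 b0 t0; have := mulr_ge0 d0 t0.
by have := mulr_ge0 c0 t0; lra.
Qed.

Lemma frozen_bound v l : 0 <= v <= 1 -> nm (frozen_mx v l) <= frozenK * (1 + nc l).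
Proof.
move=> /andP[v0 v1]; rewrite frozen_mxE.
have a0 := nm_ge0 frozen0; have a1 := nm_ge0 frozen1; have a2 := nm_ge0 frozen2.
have a3 := nm_ge0 frozen3; have t0 := nc_ge0 l.
have h1 : nm (toC v *: (frozen1 + l *: frozen2)) <= nm frozen1 + nc l * nm frozen2.
  apply: le_trans (nmZ _ _) _; rewrite nc_toC ger0_norm //.
  apply: le_trans (ler_wpM2r (nm_ge0 _) v1) _; rewrite mul1r.
  by apply: le_trans (nmD _ _) _; rewrite lerD2l nmZ.
have h2 : nm (toC (v ^+ 2) *: frozen3) <= nm frozen3.
  apply: le_trans (nmZ _ _) _; rewrite nc_toC ger0_norm ?sqr_ge0 //.
  by rewrite ler_piMl // exprn_ile1.
rewrite /frozenK; apply: le_trans (nb2 a0 a1 a2 a3 t0 h1 h2).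
by rewrite addrA; apply: le_trans (nmD _ _) _; rewrite lerD2r; exact: nmD.
Qed.

Lemma frozen_lip v v' l : 0 <= v <= 1 -> 0 <= v' <= 1 ->
  nm (frozen_mx v l - frozen_mx v' l) <= frozenK * (1 + nc l) * `|v - v'|.
Proof.
move=> /andP[v0 v1] /andP[w0 w1].
have -> : frozen_mx v l - frozen_mx v' l =
    toC (v - v') *: (frozen1 + l *: frozen2) + toC ((v - v') * (v + v')) *: frozen3.
  by rewrite !frozen_mxE -subr_sqr !toCD !toCN; exact: sub_affine.
apply: le_trans (nmD _ _) _.
have h1 : nm (toC (v - v') *: (frozen1 + l *: frozen2)) <=
    `|v - v'| * (nm frozen1 + nc l * nm frozen2).
  apply: le_trans (nmZ _ _) _; rewrite nc_toC ler_wpM2l //.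
  by apply: le_trans (nmD _ _) _; rewrite lerD2l nmZ.
have h2 : nm (toC ((v - v') * (v + v')) *: frozen3) <= `|v - v'| * (2 * nm frozen3).
  apply: le_trans (nmZ _ _) _; rewrite nc_toC normrM -mulrA ler_wpM2l //.
  by rewrite ler_wpM2r ?nm_ge0 // ger0_norm ?addr_ge0 //; lra.
apply: le_trans (lerD h1 h2) _; rewrite -mulrDr.
by apply: nb; rewrite ?nm_ge0 ?nc_ge0.
Qed.

Lemma frozen_slope v l l' : frozen_mx v l - frozen_mx v l' = (l - l') *: (toC v *: frozen2).
Proof. by rewrite !frozen_pencil opprD addrACA subrr add0r -scalerBl. Qed.

Lemma frozen_lip_param v l l' : 0 <= v <= 1 ->
  nm (frozen_mx v l - frozen_mx v l') <= frozenK * nc (l - l').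
Proof.
move=> /andP[v0 v1]; rewrite frozen_slope; apply: le_trans (nmZ _ _) _.
rewrite mulrC ler_wpM2r ?nc_ge0 //; apply: le_trans (nmZ _ _) _.
rewrite nc_toC ger0_norm //; apply: (@le_trans _ _ (nm frozen2)).
  by rewrite ler_piMl ?nm_ge0.
by rewrite /frozenK -addrA addrC -addrA lerDl !addr_ge0 ?mulr_ge0 ?nm_ge0.
Qed.

(** In the mixed difference only the term proportional to $\lambda v$ survives. The estimate keeps
    the factor $|v-v'|$, and thus the weight, when two values of $\lambda$ are compared. *)
Lemma frozen_lip2 v v' l l' :
  nm ((frozen_mx v l - frozen_mx v' l) - (frozen_mx v l' - frozen_mx v' l'))
    <= frozenK * nc (l - l') * `|v - v'|.
Proof.
have -> : (frozen_mx v l - frozen_mx v' l) - (frozen_mx v l' - frozen_mx v' l') =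
    (l - l') *: (toC (v - v') *: frozen2).
  rewrite sub_sub_swap !frozen_slope -scalerBr -scalerBl.
  by rewrite toCD toCN.
apply: le_trans (nmZ _ _) _; rewrite [frozenK * _]mulrC -mulrA ler_wpM2l ?nc_ge0 //.
apply: le_trans (nmZ _ _) _; rewrite nc_toC mulrC ler_wpM2r //.
by rewrite /frozenK -addrA addrC -addrA lerDl !addr_ge0 ?mulr_ge0 ?nm_ge0.
Qed.

Lemma frozen_act v l (u : 'cV[C]_4) (w := frozen_mx v l *m u) :
  [/\ w i0 0 = u i1 0,
      w i1 0 = l * toC v * u i0 0 + toC v * u i1 0 - toC (sigma * B * v) * u i3 0,
      w i2 0 = toC (sigma * mu0 * v) * u i3 0 &
      w i3 0 = - toC (B * v) * u i1 0 + l * toC v * u i2 0 + toC (sigma * mu0 * v ^+ 2) * u i3 0].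
Proof.
by split; rewrite /w mxE sum_ord4 /frozen_mx !mxE /= ?divr1 ?mul0r ?add0r ?addr0 ?mul1r
  ?toCN ?mulNr // (_ : toC 1 = 1) // mul1r.
Qed.

(** For $p=0$ and $m\ge0$ the first equation forces $q=0$ and then both force $m=n=0$. This is the
    quantitative version: if $|p|<c$, then $q$ is small, hence $m$ and $n$ are, against
    $L\le|m|+|n|$. Admitting $m\ge-c$ makes the conclusion hold on a full neighbourhood of a point
    of the closed half-plane. *)
Lemma gap_arith (k s L : R) : 0 < k -> 0 < s -> 0 < L -> exists2 c : R, 0 < c &
  forall p q m n S0 S1 S2 : R, s <= S2 <= k -> s <= S0 <= k -> `|S1| <= k ->
  (p ^+ 2 - q ^+ 2) * S2 - p * S1 = m * S0 -> 2 * p * q * S2 - q * S1 = n * S0 ->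
  - c <= m -> L <= `|m| + `|n| -> c <= `|p|.
Proof.
move=> k0 s0 L0.
(* [t] is a size of $q$ that contradicts [L]; the [c] below is a size of $p$ that forces $|q|\le
   t$. *)
pose t := Num.min 1 (L * s / (7 * k)).
have t0 : 0 < t by rewrite lt_min ltr01 divr_gt0 ?mulr_gt0.
have t1 : t <= 1 by rewrite ge_min lexx.
have tL : 7 * k * t <= L * s.
  by rewrite mulrC -ler_pdivlMr ?mulr_gt0 // ge_min lexx orbT.
pose c := Num.min t (t ^+ 2 * s / (3 * k)).
have c0 : 0 < c by rewrite lt_min t0 divr_gt0 ?mulr_gt0 ?exprn_gt0.
have ct : c <= t by rewrite ge_min lexx.
have cL : 3 * k * c <= t ^+ 2 * s.
  by rewrite mulrC -ler_pdivlMr ?mulr_gt0 // ge_min lexx orbT.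
exists c => // p q m n S0 S1 S2 /andP[s2 k2] /andP[s0' k0'] h1 e1 e2 hm hL.
clearbody c t; rewrite leNgt; apply/negP => pc.
have p1 : `|p| <= 1 by lra.
have hp2 : p ^+ 2 <= c.
  rewrite -real_normK ?num_real // expr2; apply: le_trans (ler_pM _ _ p1 (ltW pc)) _ => //.
  by rewrite mul1r.
have hpS : `|p * S1| <= c * k by rewrite normrM ler_pM // ltW.
have q2 : q ^+ 2 * s <= 3 * k * c.
  apply: (@le_trans _ _ (q ^+ 2 * S2)); first by rewrite ler_wpM2l ?sqr_ge0.
  have -> : q ^+ 2 * S2 = p ^+ 2 * S2 - p * S1 - m * S0 by rewrite -e1; ring.
  have a1 : p ^+ 2 * S2 <= c * k by apply: ler_pM; rewrite ?sqr_ge0 //; lra.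
  have a2 : - (p * S1) <= c * k by apply: le_trans hpS; rewrite -normrN ler_norm.
  have a3 : - (m * S0) <= c * k.
    rewrite -mulNr; apply: (@le_trans _ _ (c * S0)); last by rewrite ler_wpM2l // ltW.
    by rewrite ler_wpM2r //; lra.
  lra.
have qt : `|q| <= t.
  rewrite -(ler_pXn2r (n := 2)) ?nnegrE ?(ltW t0) // real_normK ?num_real //.
  by rewrite -(ler_pM2r s0); apply: le_trans q2 cL.
have hmS : `|m| * S0 <= (c + t + c) * k.
  have -> : `|m| * S0 = `|m * S0| by rewrite normrM (ger0_norm (_ : 0 <= S0)) //; lra.
  rewrite -e1; apply: le_trans (ler_normB _ _) _; rewrite [leRHS]mulrDl; apply: lerD => //.
  rewrite normrM; apply: ler_pM => //; last by rewrite ger0_norm //; lra.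
  apply: le_trans (ler_normB _ _) _; apply: lerD.
    by rewrite ger0_norm ?sqr_ge0.
  rewrite normrX expr2; apply: le_trans (ler_pM _ _ qt (le_trans qt t1)) _ => //.
  by rewrite mulr1.
have hnS : `|n| * S0 <= (2 * t + t) * k.
  have -> : `|n| * S0 = `|n * S0| by rewrite normrM (ger0_norm (_ : 0 <= S0)) //; lra.
  rewrite -e2; apply: le_trans (ler_normB _ _) _; rewrite [leRHS]mulrDl.
  apply: lerD; last by rewrite normrM ler_pM.
  rewrite !normrM (ger0_norm (_ : 0 <= S2)); last by lra.
  apply: ler_pM => //; first by lra.
  rewrite ger0_norm // -mulrA ler_pM2l //.
  by apply: le_trans (ler_pM _ _ p1 qt) _; rewrite ?mul1r.
have hLs : L * s <= (`|m| + `|n|) * S0 by apply: ler_pM; lra.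
have : (`|m| + `|n|) * S0 <= 6 * (k * t).
  have : c * k <= t * k by rewrite ler_wpM2r // ltW.
  by rewrite mulrDl; lra.
by have := mulr_gt0 k0 t0; lra.
Qed.

End ConstantCoefficient.

(** * Spectral gap of the limit matrices away from $\lambda=0$ *)

Section SpectralGap.
Variable R : realType.
Local Notation C := (Cplx R).
Variables (mu0 sigma B : R).
Hypotheses (mu00 : 0 < mu0) (sigma0 : 0 < sigma) (B0 : 0 <= B).

(* Pairing the two second-order eigenvalue equations with mu0 v conj(u0) and
   conj(u2) / (sigma mu0 v) makes the coupling terms add up to a real number. *)
Lemma dispersion_identity (v x0 y0 x2 y2 p q m n : R)
  (S2 := mu0 * v * (x0 ^+ 2 + y0 ^+ 2) + (x2 ^+ 2 + y2 ^+ 2) / (sigma * mu0 * v))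
  (S0 := mu0 * v ^+ 2 * (x0 ^+ 2 + y0 ^+ 2) + v * (x2 ^+ 2 + y2 ^+ 2))
  (S1 := S0 - 2 * B * v * (x0 * x2 + y0 * y2)) : 0 < v ->
  (p ^+ 2 - q ^+ 2) * x0 - 2 * p * q * y0 =
    v * (m * x0 - n * y0) + v * (p * x0 - q * y0) - B / mu0 * (p * x2 - q * y2) ->
  (p ^+ 2 - q ^+ 2) * y0 + 2 * p * q * x0 =
    v * (m * y0 + n * x0) + v * (p * y0 + q * x0) - B / mu0 * (p * y2 + q * x2) ->
  (p ^+ 2 - q ^+ 2) * x2 - 2 * p * q * y2 = sigma * mu0 * v *
    (- B * v * (p * x0 - q * y0) + v * (m * x2 - n * y2) + v * (p * x2 - q * y2)) ->
  (p ^+ 2 - q ^+ 2) * y2 + 2 * p * q * x2 = sigma * mu0 * v *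
    (- B * v * (p * y0 + q * x0) + v * (m * y2 + n * x2) + v * (p * y2 + q * x2)) ->
  (p ^+ 2 - q ^+ 2) * S2 - p * S1 = m * S0 /\ 2 * p * q * S2 - q * S1 = n * S0.
Proof.
move=> v0; set L1 := LHS; set R1 := RHS => r1; set L2 := LHS; set R2 := RHS => r2.
set L3 := LHS; set R3 := RHS => r3; set L4 := LHS; set R4 := RHS => r4.
have nz : [/\ mu0 != 0, sigma != 0 & v != 0] by rewrite !gt_eqF.
have [n1 n2 n3] := nz.
have z1 : L1 - R1 = 0 by rewrite r1 subrr.
have z2 : L2 - R2 = 0 by rewrite r2 subrr.
have z3 : L3 - R3 = 0 by rewrite r3 subrr.
have z4 : L4 - R4 = 0 by rewrite r4 subrr.
split; apply/eqP; rewrite -subr_eq0; apply/eqP.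
  have -> : (p ^+ 2 - q ^+ 2) * S2 - p * S1 - m * S0 =
      mu0 * v * (x0 * (L1 - R1) + y0 * (L2 - R2)) +
      (x2 * (L3 - R3) + y2 * (L4 - R4)) / (sigma * mu0 * v).
    by rewrite /S1 /S2 /S0 /L1 /L2 /L3 /L4 /R1 /R2 /R3 /R4; field; rewrite n1 n2 n3.
  by rewrite z1 z2 z3 z4 !(mulr0, addr0, mul0r).
have -> : 2 * p * q * S2 - q * S1 - n * S0 =
    mu0 * v * (x0 * (L2 - R2) - y0 * (L1 - R1)) +
    (x2 * (L4 - R4) - y2 * (L3 - R3)) / (sigma * mu0 * v).
  by rewrite /S1 /S2 /S0 /L1 /L2 /L3 /L4 /R1 /R2 /R3 /R4; field; rewrite n1 n2 n3.
by rewrite z1 z2 z3 z4 !(mulr0, subr0, addr0, mul0r).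
Qed.

Let form_lower (a b s X Y : R) : 0 <= X -> 0 <= Y -> s <= a -> s <= b -> s * (X + Y) <= a * X + b * Y.
Proof. by move=> hX hY ha hb; rewrite mulrDr lerD // ler_wpM2r. Qed.

Let form_upper (a b k X Y : R) : 0 <= X -> 0 <= Y -> a <= k -> b <= k -> a * X + b * Y <= k * (X + Y).
Proof. by move=> hX hY ha hb; rewrite mulrDr lerD // ler_wpM2r. Qed.

Let cross_le (x0 y0 x2 y2 : R) :
  `|2 * (x0 * x2 + y0 * y2)| <= (x0 ^+ 2 + y0 ^+ 2) + (x2 ^+ 2 + y2 ^+ 2).
Proof.
have h1 := sqr_ge0 (x0 - x2); have h2 := sqr_ge0 (y0 - y2).
have h3 := sqr_ge0 (x0 + x2); have h4 := sqr_ge0 (y0 + y2).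
by rewrite ler_norml; apply/andP; split; lra.
Qed.

(** An eigenvector cannot have both components $w$ and $\alpha$ zero. After division by
    $|u_0|^2+|u_2|^2$ the coefficients in [dispersion_identity] are bounded independently of the
    eigenvector, two of them also from below, as [gap_arith] demands. *)
Lemma frozen_gap v l : 0 < v -> 0 <= ReC l -> l != 0 -> exists c d : R, [/\ 0 < c, 0 < d &
  forall l', nc (l' - l) < d -> gap c (frozen_mx mu0 sigma B v l')].
Proof.
move=> v0 lre l0.
pose kap := sigma * mu0 * v; have kap0 : 0 < kap by rewrite !mulr_gt0.
pose s := Num.min (Num.min (mu0 * v) kap^-1) (Num.min (mu0 * v ^+ 2) v).
pose k := mu0 * v + kap^-1 + mu0 * v ^+ 2 + v + B * v.
have p1 : 0 < mu0 * v by rewrite mulr_gt0.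
have p2 : 0 < kap^-1 by rewrite invr_gt0.
have p3 : 0 < mu0 * v ^+ 2 by rewrite mulr_gt0 // exprn_gt0.
have p4 : 0 <= B * v by rewrite mulr_ge0 // ltW.
have s0 : 0 < s by rewrite !lt_min p1 p2 p3 v0.
have k0 : 0 < k by rewrite /k; lra.
have sle : [/\ s <= mu0 * v, s <= kap^-1, s <= mu0 * v ^+ 2 & s <= v].
  by rewrite /s !ge_min !lexx !orbT; split.
have [sl1 sl2 sl3 sl4] := sle.
have kle : [/\ mu0 * v <= k, kap^-1 <= k & v + mu0 * v ^+ 2 + B * v <= k].
  by rewrite /k; split; lra.
have [kl1 kl2 kl3] := kle.
clearbody s k.
have nl : 0 < nc l.
  by rewrite lt_neqAle nc_ge0 andbT; apply: contraNneq l0 => /esym/eqP; rewrite eq_le => /andP[/nc_eq0 ->].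
have [|c c0 hc] := @gap_arith R k s (nc l / 2) k0 s0; first by rewrite divr_gt0.
exists c, (Num.min c (nc l / 2)); split => //; first by rewrite lt_min c0 divr_gt0.
move=> l'; rewrite lt_min => /andP[h1 h2] z u u0 hu.
have [a0 a1 a2 a3] := frozen_act mu0 sigma B v l' u.
move: a0 a1 a2 a3; rewrite hu !mxE.
set U0 := u i0 0; set U1 := u i1 0.
set U2 := u i2 0; set U3 := u i3 0 => a0 a1 a2 a3.
have e1 : z * (z * U0) = l' * toC v * U0 + toC v * (z * U0) - toC (B / mu0) * (z * U2).
  rewrite a0 a1 a2 [toC (B / mu0) * (_ * _)]mulrA -toCM; congr (_ - toC _ * _).
  by rewrite /kap; field; rewrite gt_eqF.
have e2 : z * (z * U2) = toC kap * (- toC (B * v) * (z * U0) + l' * toC v * U2 + toC v * (z * U2)).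
  rewrite a2 mulrCA a3 -a0; congr (_ * (_ + _)).
  by rewrite [RHS]mulrA -toCM; congr (toC _ * _); rewrite /kap; ring.
have U00 : (U0 == 0) && (U2 == 0) = false.
  apply/negP => /andP[/eqP z0 /eqP z2]; move/negP: u0; apply; apply/eqP/matrixP => i j.
  rewrite ord1 mxE; move: i; apply: ord4P => //; first by rewrite -/U1 -a0 z0 mulr0.
  move: a2; rewrite z2 mulr0 => /esym/eqP; rewrite mulf_eq0 toC_eq0 gt_eqF //=.
  by move/eqP.
pose X := ReC U0 ^+ 2 + ImC U0 ^+ 2; pose Y := ReC U2 ^+ 2 + ImC U2 ^+ 2.
have X0 : 0 <= X by rewrite addr_ge0 ?sqr_ge0.
have Y0 : 0 <= Y by rewrite addr_ge0 ?sqr_ge0.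
have T0 : 0 < X + Y.
  rewrite lt_neqAle addr_ge0 // andbT eq_sym; apply/negP; rewrite paddr_eq0 // => /andP[].
  rewrite !paddr_eq0 ?sqr_ge0 // !sqrf_eq0 => /andP[/eqP q1 /eqP q2] /andP[/eqP q3 /eqP q4].
  by move/negP: U00; apply; apply/andP; split; apply/eqP; apply: ReIm_eq; rewrite !ReCE.
have [||||E1 E2] := @dispersion_identity v (ReC U0) (ImC U0) (ReC U2) (ImC U2)
    (ReC z) (ImC z) (ReC l') (ImC l') v0.
- by have := congr1 (@ReC R) e1; rewrite !ReCE => e; lra.
- by have := congr1 (@ImC R) e1; rewrite !ReCE => e; lra.
- have := congr1 (@ReC R) e2; rewrite !ReCE ?mul0r ?subr0 ?add0r -/kap => e.
  by move: e; clear; clearbody kap; lra.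
- have := congr1 (@ImC R) e2; rewrite !ReCE ?mul0r ?subr0 ?add0r ?addr0 -/kap => e.
  by move: e; clear; clearbody kap; lra.
move: E1 E2; rewrite -/X -/Y -/kap.
set S2 := _ + Y / kap; set S0 := _ + v * Y; set S1 := S0 - _ => E1 E2.
have iT : (X + Y)^-1 * (X + Y) = 1 by rewrite mulVf // gt_eqF.
have b2 : s * (X + Y) <= S2 <= k * (X + Y).
  rewrite /S2 [Y / _]mulrC; apply/andP.
  by split; [apply: form_lower | apply: form_upper].
have b0 : s * (X + Y) <= S0 <= k * (X + Y).
  apply/andP; split; [exact: form_lower|apply: form_upper => //]; lra.
have b1 : `|S1| <= k * (X + Y).
  have S00 : 0 <= S0 by rewrite addr_ge0 // mulr_ge0 // ltW.
  apply: le_trans (ler_normB _ _) _; rewrite ger0_norm //.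
  have hcr : `|2 * B * v * (ReC U0 * ReC U2 + ImC U0 * ImC U2)| <= B * v * (X + Y).
    rewrite (_ : 2 * B * v * _ = (B * v) * (2 * (ReC U0 * ReC U2 + ImC U0 * ImC U2))); last by ring.
    by rewrite normrM ger0_norm // ler_wpM2l // cross_le.
  apply: le_trans (lerD (form_upper X0 Y0 (_ : _ <= v + mu0 * v ^+ 2) _) hcr) _; [by lra|by lra|].
  by rewrite -mulrDl ler_wpM2r // ltW.
apply: (hc (ReC z) (ImC z) (ReC l') (ImC l') (S0 / (X + Y)) (S1 / (X + Y)) (S2 / (X + Y))).
- by rewrite ler_pdivlMr // ler_pdivrMr.
- by rewrite ler_pdivlMr // ler_pdivrMr.
- by rewrite normrM [`|_^-1|]ger0_norm ?invr_ge0 ?(ltW T0) // ler_pdivrMr.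
- by rewrite !mulrA -mulrBl E1.
- by rewrite !mulrA -mulrBl E2.
- have := le_trans (ler_norm _) (ReC_nc (- (l' - l))); rewrite ncN !ReCE; lra.
- have := ncD (l' - l) (- l'); rewrite addrAC subrr add0r !ncN /nc; rewrite -/(nc _) -/(nc _); lra.
Qed.

End SpectralGap.

(** * An energy for the constant-coefficient system *)

Section Energy.
Variable R : realType.
Local Notation C := (Cplx R).
Variables (mu0 sigma B : R).
Hypotheses (mu00 : 0 < mu0) (sigma0 : 0 < sigma) (B0 : 0 <= B).

(** The subtracted squares cancel the transport terms and the last product cancels the magnetic
    coupling, so that for $\mathrm{Re}\,\lambda\ge0$ only terms of one sign remain in the
    derivative. *)
Lemma energy_rder (s v m n t : R) (x0 y0 x1 y1 x2 y2 x3 y3 : R -> R) :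
  rder x0 t (s * x1 t) -> rder y0 t (s * y1 t) ->
  rder x1 t (s * (v * (m * x0 t - n * y0 t) + v * x1 t - sigma * B * v * x3 t)) ->
  rder y1 t (s * (v * (m * y0 t + n * x0 t) + v * y1 t - sigma * B * v * y3 t)) ->
  rder x2 t (s * (sigma * mu0 * v * x3 t)) -> rder y2 t (s * (sigma * mu0 * v * y3 t)) ->
  rder x3 t (s * (- (B * v * x1 t) + v * (m * x2 t - n * y2 t) + sigma * mu0 * v ^+ 2 * x3 t)) ->
  rder y3 t (s * (- (B * v * y1 t) + v * (m * y2 t + n * x2 t) + sigma * mu0 * v ^+ 2 * y3 t)) ->
  rder (fun t => mu0 * v * (x0 t * x1 t + y0 t * y1 t) + (x2 t * x3 t + y2 t * y3 t)
    - (mu0 * v ^+ 2 / 2 * (x0 t * x0 t + y0 t * y0 t) + v / 2 * (x2 t * x2 t + y2 t * y2 t))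
    + B * v * (x0 t * x2 t + y0 t * y2 t)) t
   (s * (mu0 * v * (x1 t ^+ 2 + y1 t ^+ 2) + sigma * mu0 * v * (x3 t ^+ 2 + y3 t ^+ 2)
     + m * (mu0 * v ^+ 2 * (x0 t ^+ 2 + y0 t ^+ 2) + v * (x2 t ^+ 2 + y2 t ^+ 2)))).
Proof.
move=> hx0 hy0 hx1 hy1 hx2 hy2 hx3 hy3.
have cm (c : R) (f : R -> R) df : rder f t df -> rder (fun t => c * f t) t (c * df).
  by move=> hf; apply: (rder_eq (rderM (rder_cst c t) hf)); rewrite mul0r add0r.
have h := rderD (rderB (rderD (cm (mu0 * v) _ _ (rderD (rderM hx0 hx1) (rderM hy0 hy1)))
    (rderD (rderM hx2 hx3) (rderM hy2 hy3)))
  (rderD (cm (mu0 * v ^+ 2 / 2) _ _ (rderD (rderM hx0 hx0) (rderM hy0 hy0)))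
    (cm (v / 2) _ _ (rderD (rderM hx2 hx2) (rderM hy2 hy2)))))
  (cm (B * v) _ _ (rderD (rderM hx0 hx2) (rderM hy0 hy2))).
apply: (rder_eq h); clear.
move: (x0 t) (y0 t) (x1 t) (y1 t) (x2 t) (y2 t) (x3 t) (y3 t) => a b c d e f g i.
by field.
Qed.

Lemma rder_flat (f : R -> R) x d : rder f x d -> (forall y, x <= y -> f y = 0) -> d = 0.
Proof.
move=> [hd <-] hf; apply/eqP/negPn/negP => dn.
have : (fun h : R => h^-1 *: (f (h *: (1 : R) + x) - f x)) @ 0^' --> 'D_1 f x by exact: hd.
move/cvgrPdist_lt => /(_ `|'D_1 f x|); rewrite normr_gt0 => /(_ dn).
rewrite near_withinE => /nbhs_ballP[e /= e0 h].
have e2 : 0 < e / 2 by rewrite divr_gt0.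
have := h (e / 2); rewrite /ball /= sub0r normrN gtr0_norm //.
rewrite (hf x (lexx x)) hf; last by rewrite lerDr mulr_ge0 ?ler01 // ltW.
rewrite subrr scaler0 subr0 ltxx => h1.
suff : false by []. 
apply: h1; first by rewrite ltr_pdivrMr // ltr_pMr // ltr1n.
by rewrite gt_eqF.
Qed.

End Energy.

(** * Plane coordinates as antisymmetric matrices *)

Section Wedge.
Variable R : realType.
Local Notation C := (Cplx R).

Definition symp2 : 'M[C]_2 := delta_mx ord0 ord_max - delta_mx ord_max ord0.

Definition wedge (X : 'M[C]_(4, 2)) : 'M[C]_4 := X *m symp2 *m X^T.

Lemma sum_ord2 (V : nmodType) (F : 'I_2 -> V) : \sum_i F i = F ord0 + F ord_max.
Proof. by rewrite !big_ord_recl big_ord0 addr0; congr (_ + F _); apply: val_inj. Qed.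

Lemma wedgeE X i j :
  wedge X i j = X i ord0 * X j ord_max - X i ord_max * X j ord0.
Proof.
rewrite /wedge mxE sum_ord2 !mxE !sum_ord2 !mxE /=.
by rewrite ?(subr0, sub0r, mulr0, mulr1, addr0, add0r, mulrN, mulNr) addrC.
Qed.

Lemma wedge_mul (P : 'M[C]_4) X : wedge (P *m X) = P *m wedge X *m P^T.
Proof. by rewrite /wedge trmx_mul !mulmxA. Qed.

Lemma tr_symp2 : symp2^T = - symp2.
Proof. by rewrite /symp2 linearB /= !trmx_delta opprB. Qed.

Lemma wedge_tr X : (wedge X)^T = - wedge X.
Proof. by rewrite /wedge !trmx_mul trmxK tr_symp2 mulNmx mulmxN mulmxA. Qed.

Lemma skew2 (S : 'M[C]_2) : S^T = - S -> exists d, S = d *: symp2.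
Proof.
move=> h; exists (S ord0 ord_max); have h1 i j : S j i = - S i j.
  by have := congr1 (fun M : 'M[C]_2 => M i j) h; rewrite !mxE.
have hd i : S i i = 0.
  have h2 := h1 i i; have : S i i *+ 2 = 0 by rewrite mulr2n {1}h2 addNr.
  by move/eqP; rewrite mulrn_eq0 /= => /eqP.
have o2 (P : 'I_2 -> Prop) : P ord0 -> P ord_max -> forall i, P i.
  move=> p0 p1 [[|[|//]]] hi.
    by rewrite (_ : Ordinal hi = ord0) //; apply: val_inj.
  by rewrite (_ : Ordinal hi = ord_max) //; apply: val_inj.
apply/matrixP; apply: (o2); apply: (o2); rewrite !mxE /= ?hd ?subr0 ?sub0r ?mulr0 ?mulr1 //.
by rewrite ?mulrN ?mulr1 h1.
Qed.

Lemma wedge_dependent (X : 'M[C]_(4, 2)) (c : 'cV[C]_2) : c != 0 -> X *m c = 0 -> wedge X = 0.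
Proof.
move=> c0 h; have e i : X i ord0 * c ord0 0 + X i ord_max * c ord_max 0 = 0.
  by have := congr1 (fun M : 'cV_4 => M i 0) h; rewrite !mxE sum_ord2.
apply/matrixP => i j; rewrite wedgeE mxE.
have [z0|z0] := eqVneq (c ord0 0) 0; last first.
  apply: (mulfI z0); rewrite mulr0.
  have ei : X i ord0 * c ord0 0 = - (X i ord_max * c ord_max 0) by apply/eqP; rewrite -addr_eq0 e.
  have ej : X j ord0 * c ord0 0 = - (X j ord_max * c ord_max 0) by apply/eqP; rewrite -addr_eq0 e.
  rewrite mulrBr mulrA [c _ _ * X i _]mulrC ei mulrCA [c _ _ * _]mulrC ej.
  by rewrite mulrN opprK mulNr mulrAC mulrA addNr.
have z1 : c ord_max 0 != 0.
  apply: contraNneq c0 => z1; apply/eqP/matrixP => a b; rewrite ord1 mxE.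
  case: a => [[|[|//]]] ha.
    by rewrite -[RHS]z0; congr (c _ _); apply: val_inj.
  by rewrite -[RHS]z1; congr (c _ _); apply: val_inj.
have xi a : X a ord_max = 0.
  by apply: (mulIf z1); rewrite mul0r -[RHS](e a) z0 mulr0 add0r.
by rewrite !xi mulr0 mul0r subrr.
Qed.

End Wedge.

(** * Stable vectors and stable planes of the limit system *)

Section Dichotomy.
Variable R : realType.
Local Notation C := (Cplx R).
Variables (mu0 sigma B : R).
Hypotheses (mu00 : 0 < mu0) (sigma0 : 0 < sigma) (B0 : 0 <= B).

Lemma mul2_le (a b n : R) : `|a| <= n -> `|b| <= n -> `|a * b| <= n ^+ 2.
Proof. by move=> h1 h2; rewrite normrM expr2 ler_pM. Qed.

Lemma energy_bound (v N x0 y0 x1 y1 x2 y2 x3 y3 : R) : 0 < v ->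
  `|x0| <= N -> `|y0| <= N -> `|x1| <= N -> `|y1| <= N ->
  `|x2| <= N -> `|y2| <= N -> `|x3| <= N -> `|y3| <= N ->
  `|mu0 * v * (x0 * x1 + y0 * y1) + (x2 * x3 + y2 * y3)
    - (mu0 * v ^+ 2 / 2 * (x0 * x0 + y0 * y0) + v / 2 * (x2 * x2 + y2 * y2))
    + B * v * (x0 * x2 + y0 * y2)| <=
  (2 * (mu0 * v) + 2 + mu0 * v ^+ 2 + v + 2 * (B * v)) * N ^+ 2.
Proof.
move=> v0 hx0 hy0 hx1 hy1 hx2 hy2 hx3 hy3.
have s (a b c d : R) : `|a| <= N -> `|b| <= N -> `|c| <= N -> `|d| <= N ->
    `|a * b + c * d| <= 2 * N ^+ 2.
  move=> ha hb hc hd; apply: le_trans (ler_normD _ _) _; rewrite mulr_natl mulr2n.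
  by apply: lerD; apply: mul2_le.
have cs (k a : R) : 0 <= k -> `|a| <= 2 * N ^+ 2 -> `|k * a| <= k * (2 * N ^+ 2).
  by move=> k0 ha; rewrite normrM ger0_norm // ler_wpM2l.
have k1 : 0 <= mu0 * v by rewrite mulr_ge0 // ltW.
have k2 : 0 <= mu0 * v ^+ 2 / 2 by rewrite divr_ge0 // mulr_ge0 ?sqr_ge0 // ltW.
have k3 : 0 <= v / 2 by rewrite divr_ge0 // ltW.
have k4 : 0 <= B * v by rewrite mulr_ge0 // ltW.
apply: le_trans (ler_normD _ _) _.
apply: le_trans (lerD (ler_normB _ _) (cs _ _ k4 (s _ _ _ _ hx0 hx2 hy0 hy2))) _.
apply: le_trans (lerD (lerD (ler_normD _ _) (ler_normD _ _)) (lexx _)) _.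
have g1 := cs _ _ k1 (s _ _ _ _ hx0 hx1 hy0 hy1).
have g2 := s _ _ _ _ hx2 hx3 hy2 hy3.
have g3 := cs _ _ k2 (s _ _ _ _ hx0 hx0 hy0 hy0).
have g4 := cs _ _ k3 (s _ _ _ _ hx2 hx2 hy2 hy2).
apply: le_trans (lerD (lerD (lerD g1 g2) (lerD g3 g4)) (lexx _)) _.
by rewrite le_eqVlt; apply/orP; left; apply/eqP; field.
Qed.

(** [s = -1] gives the system seen after the reflection $x\mapsto-x$. *)
Definition side_mx (s v : R) (l : C) : 'M[C]_4 := toC s *: frozen_mx mu0 sigma B v l.

(* The energy is nondecreasing (for s = 1) along a solution decaying at +oo and
   vanishes where w = alpha = 0, so w' and alpha' vanish there as well. *)
Lemma stable_dirichlet (s v : R) (l : C) P (u : 'cV[C]_4) : s ^+ 2 = 1 -> 0 < v -> 0 <= ReC l ->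
  is_eigenprojection (side_mx s v l) (@stable_eig R) P -> P *m u = u ->
  u i0 0 = 0 -> u i2 0 = 0 -> u = 0.
Proof.
move=> s2 v0 m0 hP hu u0 u2.
have [Z [Z0 dZ Zl]] := stable_flow u hP; rewrite hu in Z0.
pose xx (i : 'I_4) t := ReC (Z t i 0); pose yy (i : 'I_4) t := ImC (Z t i 0).
pose m := ReC l; pose n := ImC l.
pose F t := mu0 * v * (xx i0 t * xx i1 t +
    yy i0 t * yy i1 t) +
  (xx i2 t * xx i3 t +
    yy i2 t * yy i3 t) -
  (mu0 * v ^+ 2 / 2 * (xx i0 t * xx i0 t +
    yy i0 t * yy i0 t) +
   v / 2 * (xx i2 t * xx i2 t +
    yy i2 t * yy i2 t)) +
  B * v * (xx i0 t * xx i2 t +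
    yy i0 t * yy i2 t).
pose G t := mu0 * v * (xx i1 t ^+ 2 + yy i1 t ^+ 2) +
  sigma * mu0 * v * (xx i3 t ^+ 2 + yy i3 t ^+ 2) +
  m * (mu0 * v ^+ 2 * (xx i0 t ^+ 2 + yy i0 t ^+ 2) +
    v * (xx i2 t ^+ 2 + yy i2 t ^+ 2)).
have comp t (i : 'I_4) : rder (xx i) t (s * ReC ((frozen_mx mu0 sigma B v l *m Z t) i 0)) /\
    rder (yy i) t (s * ImC ((frozen_mx mu0 sigma B v l *m Z t) i 0)).
  have [h1 h2] := dZ t i 0; split.
    by apply: (rder_eq h1); rewrite /side_mx -scalemxAl mxE !ReCE; ring.
  by apply: (rder_eq h2); rewrite /side_mx -scalemxAl mxE !ReCE; ring.
have dF t : rder F t (s * G t).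
  have [a0 a1 a2 a3] := frozen_act mu0 sigma B v l (Z t).
  have c0 := comp t i0; have c1 := comp t i1.
  have c2 := comp t i2; have c3 := comp t i3.
  rewrite a0 in c0; rewrite a1 in c1; rewrite a2 in c2; rewrite a3 in c3.
  apply: (@energy_rder R mu0 sigma B s v m n t).
  - exact: c0.1.
  - exact: c0.2.
  - by apply: (rder_eq c1.1); rewrite !ReCE /xx /yy /m /n; ring.
  - by apply: (rder_eq c1.2); rewrite !ReCE /xx /yy /m /n; ring.
  - by apply: (rder_eq c2.1); rewrite !ReCE /xx /yy; ring.
  - by apply: (rder_eq c2.2); rewrite !ReCE /xx /yy; ring.
  - by apply: (rder_eq c3.1); rewrite !ReCE /xx /yy /m /n; ring.
  - by apply: (rder_eq c3.2); rewrite !ReCE /xx /yy /m /n; ring.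
have G0 t : 0 <= G t.
  have sq2 (a b : R) : 0 <= a ^+ 2 + b ^+ 2 by rewrite addr_ge0 ?sqr_ge0.
  have q1 : 0 <= mu0 * v by rewrite mulr_ge0 // ltW.
  have q2 : 0 <= mu0 * v ^+ 2 by rewrite mulr_ge0 ?sqr_ge0 // ltW.
  have q3 : 0 <= sigma * mu0 * v by rewrite !mulr_ge0 // ltW.
  have q4 : 0 <= v by rewrite ltW.
  rewrite /G; apply: addr_ge0; first by apply: addr_ge0; apply: mulr_ge0.
  by apply: mulr_ge0 => //; apply: addr_ge0; apply: mulr_ge0.
have F0 : F 0 = 0.
  by rewrite /F /xx /yy Z0 u0 u2 !ReCE; ring.
have Fl : lim0 F.
  pose K := 2 * (mu0 * v) + 2 + mu0 * v ^+ 2 + v + 2 * (B * v).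
  have K0 : 0 <= K by rewrite /K !addr_ge0 ?mulr_ge0 ?sqr_ge0 // ltW.
  have Fb t : `|F t| <= K * nm (Z t) ^+ 2.
    have hx i : `|xx i t| <= nm (Z t) by exact: le_trans (ReC_nc _) (nc_nm _ _ _).
    have hy i : `|yy i t| <= nm (Z t) by exact: le_trans (ImC_nc _) (nc_nm _ _ _).
    by apply: energy_bound.
  move=> e e0; have [|X hX] := Zl (Num.min 1 (e / (K + 1))).
    by rewrite lt_min ltr01 divr_gt0 // ltr_wpDl.
  exists X => t /hX; rewrite ger0_norm ?nm_ge0 // lt_min ltr_pdivlMr ?ltr_wpDl // => /andP[n1 n2].
  apply: le_lt_trans (Fb t) _; have nn := nm_ge0 (Z t).
  apply: le_lt_trans n2; rewrite mulrDr mulr1.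
  apply: (@le_trans _ _ (nm (Z t) * K)); last by rewrite lerDl.
  by rewrite mulrC ler_wpM2r // expr2 ler_piMl // ltW.
have eG : G 0 = mu0 * v * (ReC (u i1 0) ^+ 2 + ImC (u i1 0) ^+ 2) +
    sigma * mu0 * v * (ReC (u i3 0) ^+ 2 + ImC (u i3 0) ^+ 2).
  by rewrite /G /xx /yy Z0 u0 u2 !ReCE; ring.
clearbody F G.
have Fz t : 0 <= t -> F t = 0.
  have mono a b : a <= b -> s * F a <= s * F b.
    move=> ab.
    have := @nonincreasing_rder R (fun t => - (s * F t)) (fun t => - (0 * F t + s * (s * G t))) a b ab.
    rewrite lerN2; apply.
      by move=> x _; apply: rderN; apply: rderM; [exact: rder_cst | exact: dF].
    by move=> x _; rewrite mul0r add0r mulrA -expr2 s2 mul1r oppr_le0.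
  have s0 : s != 0 by apply: contra_eq_neq s2 => ->; rewrite expr0n /= eq_sym oner_eq0.
  have sl : lim0 (fun t => s * F t).
    by apply: (lim0_le (normr_ge0 s) Fl) => x _; rewrite normrM.
  move=> t0; have h1 : 0 <= s * F t by have := mono _ _ t0; rewrite F0 mulr0.
  have h2 : s * F t <= 0.
    rewrite leNgt; apply/negP => hp; have [X hX] := sl _ hp.
    have := hX (Num.max X t + 1); have ha : Num.max X t < Num.max X t + 1 by rewrite ltrDl.
    move=> /(_ (le_lt_trans _ ha)); rewrite le_max lexx => /(_ isT).
    have tb : t <= Num.max X t + 1 by apply: le_trans (ltW ha); rewrite le_max lexx orbT.
    have h3 := mono _ _ tb; rewrite ger0_norm; last exact: le_trans h1 h3.
    by rewrite ltNge h3.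
  have : s * F t = 0 by apply/eqP; rewrite eq_le h1 h2.
  by move/eqP; rewrite mulf_eq0 (negPf s0) => /eqP.
have := rder_flat (dF 0) Fz => /(congr1 (fun x => s * x)).
rewrite mulrA -expr2 s2 mul1r mulr0 eG => /eqP.
have q1 : 0 < mu0 * v by rewrite mulr_gt0.
have q3 : 0 < sigma * mu0 * v by rewrite !mulr_gt0.
rewrite paddr_eq0; [|by rewrite mulr_ge0 ?addr_ge0 ?sqr_ge0 // ltW..].
rewrite !mulf_eq0 !(gt_eqF q1, gt_eqF mu00, gt_eqF sigma0, gt_eqF v0) /=.
rewrite !paddr_eq0 ?sqr_ge0 // !sqrf_eq0 => /andP[/andP[/eqP r1 /eqP r2] /andP[/eqP r3 /eqP r4]].
apply/matrixP => i j; rewrite ord1 mxE; move: i; apply: ord4P => //; exact: ReIm_eq.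
Qed.

(** By [stable_dirichlet] a stable vector is determined by the components $w$ and $\alpha$ that
    [Sel] extracts. If [Sel *m X] is invertible, $X(\mathrm{Sel}X)^{-1}\mathrm{Sel}P$ and $P$ agree
    after [Sel], hence coincide; otherwise a kernel vector of [Sel *m X] is one of [X]. *)
Lemma stable_plane_dichotomy (s v : R) (l : C) P (X : 'M[C]_(4, 2)) :
  s ^+ 2 = 1 -> 0 < v -> 0 <= ReC l ->
  is_eigenprojection (side_mx s v l) (@stable_eig R) P -> P *m X = X ->
  wedge X = 0 \/ exists S : 'M[C]_(2, 4), P = X *m S.
Proof.
move=> s2 v0 m0 hP hX.
pose Sel : 'M[C]_(2, 4) := \matrix_(i, j) (if i == ord0 then (j == i0)%:R
  else (j == i2)%:R).
have SelE (u : 'cV[C]_4) : (Sel *m u) ord0 0 = u i0 0 /\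
    (Sel *m u) ord_max 0 = u i2 0.
  by split; rewrite mxE sum_ord4 !mxE /= !mul0r mul1r ?addr0 ?add0r.
have key (u : 'cV[C]_4) : P *m u = u -> Sel *m u = 0 -> u = 0.
  move=> hu h; have [e0 e1] := SelE u; apply: (stable_dirichlet s2 v0 m0 hP hu).
    by rewrite -e0 h mxE.
  by rewrite -e1 h mxE.
have [hu|hu] := boolP (Sel *m X \in unitmx).
  right; exists (invmx (Sel *m X) *m (Sel *m P)).
  apply: matrix_cols => u; apply/eqP; rewrite -subr_eq0; apply/eqP; apply: key.
    by rewrite mulmxBr !mulmxA hX (eigproj_idem hP).
  by rewrite mulmxBr !mulmxA mulmxV // mul1mx subrr.
left.
have : \det (Sel *m X)^T == 0 by rewrite det_tr; move: hu; rewrite unitmxE unitfE negbK.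
move=> /det0P[w w0 hw].
have w0' : w^T != 0 by rewrite -trmx0 (inj_eq trmx_inj).
apply: (wedge_dependent w0'); apply: key; first by rewrite mulmxA hX.
by rewrite mulmxA -[Sel *m X]trmxK -trmx_mul hw trmx0.
Qed.

End Dichotomy.

(** * Decay for equations $f'=Af+fB-\eta f+g$ *)

Section ListTail.
Variables (R : realType) (n : nat) (rho : R) (w dw : R -> R).
Local Notation C := (Cplx R).
Hypothesis W : is_weight rho w dw.
Implicit Types (A B : 'M[C]_n.+1) (s t : seq C) (f g : R -> 'M[C]_n.+1).

Lemma lim0_nm_le m p m' p' (F : R -> 'M[C]_(m, p)) (G : R -> 'M[C]_(m', p')) k :
  0 <= k -> lim0 (fun x => nm (G x)) -> (forall x, 0 < x -> nm (F x) <= k * nm (G x)) ->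
  lim0 (fun x => nm (F x)).
Proof.
move=> k0 hG h; apply: (lim0_le k0 hG) => x x0.
by rewrite !ger0_norm ?nm_ge0 // h.
Qed.

Let comm_left A B L eta (f g : 'M[C]_n.+1) : L *m A = A *m L ->
  L *m (A *m f + f *m B - eta *: f + g) =
  A *m (L *m f) + (L *m f) *m B - eta *: (L *m f) + L *m g.
Proof. by move=> h; rewrite !mulmxDr mulmxN -scalemxAr !mulmxA h. Qed.

Let comm_right A B L eta (f g : 'M[C]_n.+1) : B *m L = L *m B ->
  (A *m f + f *m B - eta *: f + g) *m L =
  A *m (f *m L) + (f *m L) *m B - eta *: (f *m L) + g *m L.
Proof. by move=> h; rewrite !mulmxDl mulNmx -scalemxAl -!mulmxA h. Qed.

Let comm_shift A (a : C) : (A - a%:M) *m A = A *m (A - a%:M).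
Proof. by rewrite mulmxBl mulmxBr scalar_mxC. Qed.

Let shift_split A B (a b eta : C) (f g : 'M[C]_n.+1) :
  A *m f + f *m B - eta *: f + g =
  (a + b - eta) *: f + ((A - a%:M) *m f + f *m (B - b%:M) + g).
Proof.
rewrite mulmxBl mulmxBr mul_scalar_mx mul_mx_scalar.
move: (A *m f) (f *m B) (f) => p q y.
rewrite scalerBl scalerDl addrA; congr (_ + g).
rewrite [RHS]addrAC; congr (_ - _); rewrite [RHS]addrACA [a *: y + _]addrC subrK.
by rewrite [b *: y + _]addrC subrK.
Qed.

(** The double induction of [sylv_bound], now for a differential equation: $(A-a)f$ and $f(B-b)$
    solve equations of the same kind with shorter annihilators, so they are $O(w)$. What is left for
    $f$ is a scalar coefficient $a+b-\eta$ with this forcing, to which [tail_matrix] applies. *)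
Lemma tail_lists A B eta s t : (forall a b, a \in s -> b \in t -> 0 <= ReC (a + b - eta)) ->
  forall f g M, (forall x, 0 < x -> mder f x (A *m f x + f x *m B - eta *: f x + g x)) ->
  (forall x, 0 < x -> nm (g x) <= M * w x) -> lim0 (fun x => nm (f x)) ->
  (forall x, kp s A *m f x = 0) -> (forall x, f x *m kp t B = 0) ->
  exists M', forall x, 0 < x -> nm (f x) <= M' * w x.
Proof.
elim: s t => [|a s ihs] t.
  move=> _ f g M _ _ _ h _; exists 0 => x _.
  by have := h x; rewrite kp_nil mul1mx => ->; rewrite nm0 mul0r.
elim: t => [|b t iht] hst f g M hf hg fl ks kt.
  exists 0 => x _.
  by have := kt x; rewrite kp_nil mulmx1 => ->; rewrite nm0 mul0r.
have [||||||M1 h1] := ihs (b :: t) _ (fun x => (A - a%:M) *m f x)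
    (fun x => (A - a%:M) *m g x) (nm (A - a%:M) * M).
- by move=> c d cs dt; apply: hst; rewrite // inE cs orbT.
- move=> x x0; apply: (mder_eq (mderMl _ (hf x x0))).
  exact: comm_left (comm_shift A a).
- move=> x x0; apply: le_trans (nmM _ _) _.
  by rewrite -mulrA ler_wpM2l ?nm_ge0 // hg.
- by apply: (lim0_nm_le (nm_ge0 (A - a%:M)) fl) => x _; apply: nmM.
- by move=> x; rewrite mulmxA -kp_consC.
- by move=> x; rewrite -mulmxA kt mulmx0.
have [||||||M2 h2] := iht _ (fun x => f x *m (B - b%:M))
    (fun x => g x *m (B - b%:M)) (M * nm (B - b%:M)).
- by move=> c d cs dt; apply: hst; rewrite // inE dt orbT.
- move=> x x0; apply: (mder_eq (mderMr _ (hf x x0))).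
  exact: comm_right (esym (comm_shift B b)).
- move=> x x0; apply: le_trans (nmM _ _) _.
  by rewrite mulrAC ler_wpM2r ?nm_ge0 // hg.
- apply: (lim0_nm_le (nm_ge0 (B - b%:M)) fl) => x _.
  by rewrite mulrC; apply: nmM.
- by move=> x; rewrite mulmxA ks mul0mx.
- by move=> x; rewrite -mulmxA -kp_cons.
exists ((n.+1 * n.+1)%:R * (4 * (M1 + M2 + M) / rho)).
apply: (@tail_matrix R rho w dw n.+1 n.+1 (a + b - eta) f
  (fun x => (A - a%:M) *m f x + f x *m (B - b%:M) + g x)) => //.
- by apply: hst; rewrite mem_head.
- by move=> x x0; apply: (mder_eq (hf x x0)); exact: shift_split.
- move=> x x0; rewrite !mulrDl; apply: le_trans (nmD _ _) _; apply: lerD; last exact: hg.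
  by apply: le_trans (nmD _ _) _; apply: lerD; [apply: h1 | apply: h2].
Qed.

End ListTail.

(** * Evolution of planes and the notion of a tracked deviation *)

Section Tracking.
Variable R : realType.
Local Notation C := (Cplx R).
Local Notation eigproj A P := (is_eigenprojection A (@stable_eig R) P).

Lemma roots2 (s : 'M[C]_2) : exists a b, [/\ s ord0 ord0 + s ord_max ord_max = a + b,
  kp [:: a; b] s = 0 & forall z, z \in [:: a; b] ->
  exists2 u : 'cV[C]_2, u != 0 & s *m u = z *: u].
Proof.
have [r] := closed_field_poly_normal (char_poly s).
rewrite (monicP (char_poly_monic s)) scale1r => er.
have : size r = 2%N by have := size_char_poly s; rewrite er size_prod_XsubC => -[].
case: r er => [|a [|b [|c r]]] // er _; exists a, b; split.
- have := char_poly_trace s; move=> /(_ isT) /=; rewrite er !big_cons big_nil mulr1.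
  rewrite /mxtrace sum_ord2 coefM !big_ord_recl big_ord0 !coefB !coefX !coefC /=.
  rewrite ?(subr0, sub0r, mulr0, mulr1, mul1r, addr0, add0r) => h.
  by apply: oppr_inj; rewrite -h opprD.
- by rewrite /kp -er Cayley_Hamilton.
- by move=> z zr; apply: root_eigenvector; rewrite er root_prod_XsubC.
Qed.

Lemma symp2_trace (s : 'M[C]_2) :
  s *m symp2 R + symp2 R *m s^T = (s ord0 ord0 + s ord_max ord_max) *: symp2 R.
Proof.
have [|d hd] := @skew2 R (s *m symp2 R + symp2 R *m s^T).
  by rewrite linearD /= !trmx_mul trmxK tr_symp2 mulNmx mulmxN opprD addrC.
rewrite hd; congr (_ *: _); have := congr1 (fun M : 'M[C]_2 => M ord0 ord_max) hd.
rewrite !mxE !sum_ord2 !mxE /=.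
by rewrite ?(subr0, sub0r, mulr0, mulr1, addr0, add0r, mul1r, mul0r) => ->.
Qed.

Lemma cder0_cst (f : R -> C) : (forall x, cder f x 0) -> forall x, f x = f 0.
Proof.
move=> hf x.
have key (g : R -> R) : (forall x, rder g x 0) -> g x = g 0.
  move=> hg; have hN y : rder (fun t => - g t) y 0.
    by apply: (rder_eq (rderN (hg y))); rewrite oppr0.
  have le a b : a <= b -> g a = g b.
    move=> ab.
    have h1 := @nonincreasing_rder R g (fun=> 0) a b ab (fun y _ => hg y) (fun y _ => lexx 0).
    have h2 := @nonincreasing_rder R _ (fun=> 0) a b ab (fun y _ => hN y) (fun y _ => lexx 0).
    by rewrite lerN2 in h2; apply/eqP; rewrite eq_le h1 h2.
  by have [x0|/ltW x0] := leP 0 x; [rewrite (le _ _ x0) | exact: le].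
apply: ReIm_eq; first exact: (key (fun t => ReC (f t)) (fun y => (hf y).1)).
exact: (key (fun t => ImC (f t)) (fun y => (hf y).2)).
Qed.

(** Since $EJE^T=(\det E)J$ in dimension two, this is Liouville's formula $\det
    E=e^{x\,\mathrm{tr}\,s}$. *)
Lemma liouville2 (s : 'M[C]_2) (E : R -> 'M[C]_2) (eta := s ord0 ord0 + s ord_max ord_max) :
  E 0 = 1%:M -> (forall x, mder E x (s *m E x)) ->
  forall x, cexp (- eta) x *: (E x *m symp2 R *m (E x)^T) = symp2 R.
Proof.
move=> E0 hE.
have hsk x : exists d, E x *m symp2 R *m (E x)^T = d *: symp2 R.
  by apply: skew2; rewrite !trmx_mul trmxK tr_symp2 mulNmx mulmxN mulmxA.
have /choice[d hd] := hsk.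
have Jn : symp2 R ord0 ord_max = 1 by rewrite !mxE /= subr0.
have dE x : d x = (E x *m symp2 R *m (E x)^T) ord0 ord_max.
  by rewrite hd mxE Jn mulr1.
have dder x : cder d x (eta * d x).
  have h := mderM (mderMr (symp2 R) (hE x)) (mderT (hE x)).
  have := h ord0 ord_max; rewrite (_ : (fun _ => _) = d); last by apply/funext => t; rewrite dE.
  move=> h1; apply: (cder_eq h1).
  have -> : s *m E x *m symp2 R *m (E x)^T + E x *m symp2 R *m (s *m E x)^T =
      d x *: (s *m symp2 R + symp2 R *m s^T).
    rewrite trmx_mul !mulmxA -[s *m E x *m _]mulmxA -[s *m _ *m (E x)^T]mulmxA hd.
    by rewrite -scalemxAr -scalemxAl scalerDr.
  by rewrite symp2_trace scalerA mxE Jn mulr1 mulrC.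
have dcst x : cexp (- eta) x * d x = 1.
  have hc y : cder (fun x => cexp (- eta) x * d x) y 0.
    apply: (cder_eq (cderM (cder_cexp (- eta) y) (dder y))).
    by rewrite mulrA [cexp _ _ * eta]mulrC mulNr mulNr addNr.
  rewrite (cder0_cst hc x) cexp0 mul1r dE E0 trmx1 mulmx1 mul1mx Jn //.
by move=> x; rewrite hd scalerA dcst ?scale1r.
Qed.

(* One-sided form on x > 0 of a conjugator; the behaviour on x < 0 is reduced to
   it by reflection. *)
Definition half_conjugator (A : R -> 'M[C]_4) (Ai : 'M[C]_4) (P : R -> 'M[C]_4) :=
  [/\ exists M theta : R, 0 < theta /\
        forall x, 0 < x -> nm (P x - 1%:M) <= M * expR (- (theta * x)),
      forall e : R, 0 < e -> exists2 d : R, 0 < d &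
        forall x, 0 < x -> x < d -> nm (P x - P 0) < e &
      forall Z : R -> 'cV[C]_4, (forall x, 0 < x -> mder Z x (Ai *m Z x)) ->
        forall x, 0 < x -> mder (fun t => P t *m Z t) x (A x *m (P x *m Z x))].

Definition lyap (A D : 'M[C]_4) := A *m D + D *m A^T.

Lemma nm_lyap A D : nm (lyap A D) <= 2 * (nm A * nm D).
Proof.
apply: le_trans (nmD _ _) _; rewrite mulr_natl mulr2n; apply: lerD; first exact: nmM.
by apply: le_trans (nmM _ _) _; rewrite nmT mulrC.
Qed.

Lemma lyapD (A D E : 'M[C]_4) : lyap A (D + E) = lyap A D + lyap A E.
Proof. by rewrite /lyap mulmxDr mulmxDl addrACA. Qed.

Lemma lyapN (A D : 'M[C]_4) : lyap A (- D) = - lyap A D.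
Proof. by rewrite /lyap mulmxN mulNmx -opprD. Qed.

Lemma lyapDl (A B D : 'M[C]_4) : lyap (A + B) D = lyap A D + lyap B D.
Proof. by rewrite /lyap linearD /= mulmxDl mulmxDr addrACA. Qed.

Lemma lyapNl (A D : 'M[C]_4) : lyap (- A) D = - lyap A D.
Proof. by rewrite /lyap linearN /= mulNmx mulmxN -opprD. Qed.

(** All that the quantitative estimates retain of a conjugated plane; neither the conjugator nor the
    projection appears any more. The constant [M] is only asserted to exist. The degenerate case
    $Y=0$ fits in as well, with deviation zero. *)
Definition tracked (A : R -> 'M[C]_4) (Ai : 'M[C]_4) (w : R -> R)
    (Y : 'M[C]_4) (eta : C) (dev : R -> 'M[C]_4) :=
  [/\ nc eta <= 4 * nm Ai, lyap Ai Y = eta *: Y,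
      forall x, 0 < x -> mder dev x (lyap (A x) (dev x) - eta *: dev x + lyap (A x - Ai) Y),
      exists M, forall x, 0 < x -> nm (dev x) <= M * w x &
      forall e : R, 0 < e -> exists2 d : R, 0 < d &
        forall x, 0 < x -> x < d -> nm (dev x - dev 0) < e].

Lemma tracked0 A Ai w : tracked A Ai w 0 0 (fun=> 0).
Proof.
split.
- by rewrite nc0 mulr_ge0 ?nm_ge0.
- by rewrite /lyap mulmx0 mul0mx addr0 scaler0.
- by move=> x _; rewrite /lyap !mulmx0 !mul0mx scaler0 !addr0 subr0; apply: mder_cst.
- by exists 0 => x _; rewrite nm0 mul0r.
- by move=> e e0; exists 1 => // x _ _; rewrite subrr nm0.
Qed.

Lemma kp_intertwine n m (l : seq C) (A : 'M[C]_n.+1) (s : 'M[C]_m.+1) (X : 'M[C]_(n.+1, m.+1)) :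
  A *m X = X *m s -> kp l A *m X = X *m kp l s.
Proof.
move=> h; elim: l => [|a l ih]; first by rewrite !kp_nil mul1mx mulmx1.
rewrite !kp_cons -mulmxA ih !mulmxA; congr (_ *m _).
by rewrite mulmxBl mulmxBr h scalar_mxC.
Qed.

End Tracking.

(** * The deviation of a conjugated stable plane is tracked *)

Section TrackedDeviation.
Variable R : realType.
Local Notation C := (Cplx R).
Local Notation eigproj A P := (is_eigenprojection A (@stable_eig R) P).
Variables (rho : R) (w dw : R -> R).
Hypothesis W : is_weight rho w dw.
Variables (A : R -> 'M[C]_4) (Ai : 'M[C]_4) (P : R -> 'M[C]_4) (Pi : 'M[C]_4).
Hypothesis hP : half_conjugator A Ai P.
Hypothesis hA : exists c, forall x, 0 < x -> nm (A x - Ai) <= c * w x.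
Hypothesis hPi : eigproj Ai Pi.
Variables (X : 'M[C]_(4, 2)) (S : 'M[C]_(2, 4)).
Hypotheses (PiX : Pi *m X = X) (PiS : Pi = X *m S).
Hypothesis X_free : forall c : 'cV[C]_2, c != 0 -> X *m c != 0.

Let Y := wedge X.
(** The restriction of [Ai] to the plane, in the basis [X]; [eta] is its trace. *)
Let s : 'M[C]_2 := S *m (Ai *m X).
Let eta : C := s ord0 ord0 + s ord_max ord_max.
Let dev x := P x *m Y *m (P x)^T - Y.

Let AiX : Ai *m X = X *m s.
Proof. by rewrite /s mulmxA -PiS mulmxA (eigproj_comm hPi) -mulmxA PiX. Qed.

Let lyapY : lyap Ai Y = eta *: Y.
Proof.
have e1 : Ai *m (X *m symp2 R *m X^T) = X *m (s *m symp2 R) *m X^T.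
  by rewrite (mulmxA Ai (X *m symp2 R)) (mulmxA Ai X) AiX (mulmxA X s).
have e2 : X *m symp2 R *m X^T *m Ai^T = X *m (symp2 R *m s^T) *m X^T.
  rewrite -[LHS]mulmxA -trmx_mul AiX trmx_mul.
  by rewrite (mulmxA (X *m symp2 R)) (mulmxA X (symp2 R)).
by rewrite /lyap /Y /wedge e1 e2 -mulmxDl -mulmxDr symp2_trace -scalemxAr -scalemxAl.
Qed.

(** As the columns of [X] are independent, an eigenvector of [s] gives one of [Ai] inside the range
    of [Pi], so the two eigenvalues of [s] are stable. *)
Let roots : exists a b, [/\ eta = a + b, kp [:: a; b] Ai *m X = 0,
  ReC a < 0 /\ ReC b < 0 & nc eta <= 4 * nm Ai].
Proof.
have [a [b [e k h]]] := roots2 s; exists a, b.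
have st z : z \in [:: a; b] -> ReC z < 0 /\ nc z <= 2 * nm Ai.
  move=> /h[u u0 hu]; have e1 : Ai *m (X *m u) = z *: (X *m u).
    by rewrite mulmxA AiX -mulmxA hu -scalemxAr.
  split; last exact: eigenvalue_bound (X_free u0) e1.
  have : (Ai - z%:M) ^+ 1 *m (X *m u) = 0.
    by rewrite expr1 mulmxBl e1 mul_scalar_mx subrr.
  move=> /hPi; rewrite mulmxA PiX /stable_eig; case: ifP => // _ z0.
  by have := X_free u0; rewrite z0 eqxx.
have [ra na] := st a (mem_head _ _).
have [rb nb] : ReC b < 0 /\ nc b <= 2 * nm Ai by apply: st; rewrite inE mem_head orbT.
split => //; first by rewrite (kp_intertwine _ AiX) k mulmx0.
by rewrite /eta e; apply: le_trans (ncD _ _) _; lra.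
Qed.

Let dev_skew x : (dev x)^T = - dev x.
Proof.
have eY : Y^T = - Y := wedge_tr X.
by rewrite /dev linearB /= eY trmx_mul trmx_mul trmxK eY mulNmx mulmxN mulmxA opprD.
Qed.

(** A conjugator is only known to map solutions to solutions, not to be differentiable. So solutions
    $XE$ are inserted, with $E$ the flow of [s]; their growth is undone by $e^{-\eta x}$ through
    [liouville2]. *)
Let dev_der x : 0 < x -> mder dev x (lyap (A x) (dev x + Y) - eta *: (dev x + Y)).
Proof.
move=> x0; have [_ _ hs] := hP.
have [E [E0 hE]] := flow s.
pose V t := P t *m (X *m E t).
have hV : mder V x (A x *m V x).
  have hcol j : mder (fun t => P t *m (X *m (E t *m delta_mx j (0 : 'I_1)))) x
      (A x *m (P x *m (X *m (E x *m delta_mx j 0)))).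
    apply: (hs (fun t => X *m (E t *m delta_mx j 0))) => // y _.
    by rewrite mulmxA AiX -mulmxA; apply: mderMl; rewrite mulmxA; apply: mderMr.
  move=> i j; have := hcol j i 0.
  have e (M : 'M[C]_(4, 2)) : (M *m delta_mx j (0 : 'I_1)) i 0 = M i j by rewrite -colE mxE.
  have ef : (fun t => (P t *m (X *m (E t *m delta_mx j (0 : 'I_1)))) i 0) = fun t => V t i j.
    by apply/funext => t; rewrite !mulmxA e /V mulmxA.
  rewrite ef => h; apply: (cder_eq h).
  by rewrite !mulmxA e /V ?mulmxA.
have eW t : cexp (- eta) t *: (V t *m symp2 R *m (V t)^T) = dev t + Y.
  have l := liouville2 E0 hE t.
  rewrite /dev subrK /V /Y /wedge -[in RHS]l.
  move: (cexp _ _) (E t) (P t) => z e p.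
  by rewrite !trmx_mul -!(scalemxAr, scalemxAl) !mulmxA.
have h1 := mderM (mderMr (symp2 R) hV) (mderT hV).
have h2 := mderZ (cder_cexp (- eta) x) h1.
have h3 : mder (fun t => dev t + Y) x (lyap (A x) (dev x + Y) - eta *: (dev x + Y)).
  rewrite -[fun t => dev t + Y](_ : (fun t => cexp (- eta) t *: (V t *m symp2 R *m (V t)^T)) = _).
    apply: (mder_eq h2); rewrite -eW /lyap (trmx_mul (A x) (V x)) -scalemxAr -scalemxAl -scalerDr !mulmxA.
    by rewrite addrC scalerA mulNr scaleNr.
  by apply/funext => t; rewrite eW.
by have := mderB h3 (mder_cst Y x); rewrite subr0; under [fun t => _]funext => t do rewrite addrK.
Qed.

Let lyap_split (B D : 'M[C]_4) : lyap B D = lyap Ai D + lyap (B - Ai) D.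
Proof. by rewrite -lyapDl addrC subrK. Qed.

Let dev_der1 x : 0 < x ->
  mder dev x (lyap (A x) (dev x) - eta *: dev x + lyap (A x - Ai) Y).
Proof.
move=> x0; apply: (mder_eq (dev_der x0)).
rewrite lyapD (lyap_split (A x) Y) lyapY scalerDr opprD addrACA [eta *: Y + _]addrC.
by rewrite addrK.
Qed.

Let g x := lyap (A x - Ai) (dev x + Y).

Let dev_der2 x : 0 < x ->
  mder dev x (Ai *m dev x + dev x *m Ai^T - eta *: dev x + g x).
Proof.
move=> x0; apply: (mder_eq (dev_der1 x0)).
rewrite (lyap_split (A x) (dev x)) /g (lyapD (A x - Ai) (dev x) Y).
have <- : lyap Ai (dev x) = Ai *m dev x + dev x *m Ai^T by [].
move: (lyap Ai (dev x)) (lyap (A x - Ai) (dev x)) (lyap (A x - Ai) Y) (eta *: dev x) => p q r z.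
by rewrite addrA [p + q - z]addrAC.
Qed.

Let P_decay : exists2 m : R, 0 <= m &
  (forall x, 0 < x -> nm (P x - 1%:M) <= m) /\ lim0 (fun x => nm (P x - 1%:M)).
Proof.
have [[M [theta [t0 hM]]] _ _] := hP.
have M0 : 0 <= M.
  by have := le_trans (nm_ge0 _) (hM 1 ltr01); rewrite pmulr_lge0 // expR_gt0.
exists M => //; split.
  move=> x x0; apply: le_trans (hM x x0) _; rewrite ler_piMr // -expR0 ler_expR.
  by rewrite oppr_le0 mulr_ge0 // ltW.
apply: (lim0_le M0 (lim0_expX 0 t0)) => x x0.
by rewrite expr0 mul1r !ger0_norm ?nm_ge0 ?expR_ge0 // hM.
Qed.

Let dev_split x : dev x = (P x - 1%:M) *m Y *m (P x)^T + Y *m (P x - 1%:M)^T.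
Proof.
rewrite /dev linearB /= trmx1 mulmxBl mulmxBl mulmxBr mul1mx mulmx1.
by rewrite addrA subrK.
Qed.

Let dev_lim : lim0 (fun x => nm (dev x)).
Proof.
have [m m0 [hm hl]] := P_decay.
apply: (@lim0_nm_le R 4 4 4 4 dev (fun x => P x - 1%:M) (nm Y * (m + 4%:R) + nm Y)) => //.
  by rewrite addr_ge0 ?mulr_ge0 ?nm_ge0 ?addr_ge0.
move=> x x0; rewrite dev_split; apply: le_trans (nmD _ _) _; rewrite mulrDl; apply: lerD.
  apply: le_trans (nmM _ _) _; rewrite nmT [leRHS]mulrC mulrA.
  apply: ler_pM; rewrite ?nm_ge0 ?nmM //.
  rewrite -[P x](subrK 1%:M); apply: le_trans (nmD _ _) _; rewrite lerD ?hm //.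
  by rewrite nm_scalar nc1 mulr1.
by apply: le_trans (nmM _ _) _; rewrite nmT.
Qed.

Let g_bound : exists K, forall x, 0 < x -> nm (g x) <= K * w x.
Proof.
have [m m0 [hm hl]] := P_decay; have [c hc] := hA.
have [_ _ _ wp _] := W.
have hdY x : 0 < x -> nm (dev x + Y) <= (m + 4%:R) * nm Y * (m + 4%:R).
  move=> x0; rewrite /dev subrK.
  have hp : nm (P x) <= m + 4%:R.
    rewrite -[P x](subrK 1%:M); apply: le_trans (nmD _ _) _; rewrite lerD ?hm //.
    by rewrite nm_scalar nc1 mulr1.
  apply: le_trans (nmM _ _) _; rewrite nmT; apply: ler_pM; rewrite ?nm_ge0 //.
  by apply: le_trans (nmM _ _) _; rewrite ler_wpM2r ?nm_ge0.
exists (2 * (c * ((m + 4%:R) * nm Y * (m + 4%:R)))) => x x0.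
apply: le_trans (nm_lyap _ _) _; rewrite -mulrA ler_pM2l // mulrAC.
by apply: ler_pM; rewrite ?nm_ge0 ?hc ?hdY.
Qed.

(* Left and right multiplication by the two eigenprojections commute with the
   Lyapunov operator, so each of the four blocks of dev solves the same equation. *)
Let block_der (L K : 'M[C]_4) x : L *m Ai = Ai *m L -> K *m Ai = Ai *m K -> 0 < x ->
  mder (fun t => L *m dev t *m K^T) x (Ai *m (L *m dev x *m K^T) +
    (L *m dev x *m K^T) *m Ai^T - eta *: (L *m dev x *m K^T) + L *m g x *m K^T).
Proof.
move=> cL cK x0.
have cK' : Ai^T *m K^T = K^T *m Ai^T by rewrite -!trmx_mul cK.
apply: (mder_eq (mderMr K^T (mderMl L (dev_der2 x0)))).
move: (dev x) (g x) => D G.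
rewrite !mulmxDr !mulmxDl mulmxN mulNmx -scalemxAr -scalemxAl.
by rewrite !mulmxA cL -!mulmxA cK'.
Qed.

Let block_bound (L K : 'M[C]_4) : exists M, forall x, 0 < x -> nm (L *m g x *m K^T) <= M * w x.
Proof.
have [M hM] := g_bound; exists (nm L * M * nm K) => x x0.
apply: le_trans (nmM _ _) _; rewrite nmT mulrAC ler_wpM2r ?nm_ge0 //.
by apply: le_trans (nmM _ _) _; rewrite -mulrA ler_wpM2l ?nm_ge0 // hM.
Qed.

Let block_lim (L K : 'M[C]_4) : lim0 (fun x => nm (L *m dev x *m K^T)).
Proof.
apply: (lim0_nm_le (mulr_ge0 (nm_ge0 L) (nm_ge0 K)) dev_lim) => x _.
apply: le_trans (nmM _ _) _; rewrite nmT mulrAC ler_wpM2r ?nm_ge0 //.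
exact: nmM.
Qed.

(** The block $\Pi D\Pi^T$ is antisymmetric on a plane, hence a multiple of [Y], on which the
    operator [lyap Ai] minus [eta] vanishes. On the other blocks at least one of two stable
    eigenvalues is traded for an unstable or neutral one, so no sum of eigenvalues has smaller real
    part than [eta]. *)
Let dev_bound : exists M, forall x, 0 < x -> nm (dev x) <= M * w x.
Proof.
have [l [t [_ lt _ _ [_ kt]]]] := eigproj_lists hPi.
have [a [b [e kab [ra rb] _]]] := roots.
set Q := 1%:M - Pi in kt *.
have cPi := eigproj_comm hPi.
have cQ : Q *m Ai = Ai *m Q by rewrite /Q mulmxBl mulmxBr mul1mx mulmx1 cPi.
have iQ : Q *m Q = Q := idem_compl (eigproj_idem hPi).
have kPi : kp [:: a; b] Ai *m Pi = 0 by rewrite PiS mulmxA kab mul0mx.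
have nt z : z \in t -> 0 <= ReC z.
  by move=> /(allP lt) /=; rewrite /stable_eig -leNgt.
have killr K r x L : kp r Ai *m K = 0 -> L *m dev x *m K^T *m kp r Ai^T = 0.
  by move=> h; rewrite kp_tr -mulmxA -trmx_mul h trmx0 mulmx0.
have killl K r x L : kp r Ai *m L = 0 -> kp r Ai *m (L *m dev x *m K^T) = 0.
  by move=> h; rewrite !mulmxA h !mul0mx.
have [M1 h1] : exists M, forall x, 0 < x -> nm (Pi *m dev x *m Pi^T) <= M * w x.
  have [M hM] := block_bound Pi Pi.
  exists ((4 * 4)%:R * (4 * M / rho)).
  apply: (@tail_matrix R rho w dw 4 4 0 (fun x => Pi *m dev x *m Pi^T)
    (fun x => Pi *m g x *m Pi^T) M W (lexx 0) _ hM (block_lim Pi Pi)).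
  move=> x x0; apply: (mder_eq (block_der cPi cPi x0)); rewrite scale0r; congr (_ + _).
  have [|d hd] := @skew2 R (S *m dev x *m S^T).
    by rewrite !trmx_mul trmxK dev_skew mulNmx mulmxN mulmxA.
  have -> : Pi *m dev x *m Pi^T = d *: Y.
    rewrite PiS trmx_mul /Y /wedge scalemxAl scalemxAr -hd.
    by move: (dev x) => D; rewrite !mulmxA.
  rewrite -scalemxAr -scalemxAl -scalerDr -/(lyap Ai Y) lyapY scalerA mulrC -scalerA.
  exact: subrr.
(* With $\eta=a+b$ this is the real part of [u] minus the one of $a,b$ that is not [v]. *)
have sgn u v : u \in t -> v \in [:: a; b] -> 0 <= ReC (u + v - eta).
  move=> /nt ut; rewrite !inE => /orP[] /eqP ->; rewrite e !ReCE; lra.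
have sgn' u v : u \in t -> v \in t -> 0 <= ReC (u + v - eta).
  by move=> /nt ut /nt vt; rewrite e !ReCE; lra.
have [M2 h2] : exists M, forall x, 0 < x -> nm (Q *m dev x *m Pi^T) <= M * w x.
  have [M hM] := block_bound Q Pi.
  apply: (tail_lists W sgn (fun x x0 => block_der cQ cPi x0) hM (block_lim Q Pi)).
    by move=> x; apply: killl.
  by move=> x; apply: killr.
have [M3 h3] : exists M, forall x, 0 < x -> nm (Pi *m dev x *m Q^T) <= M * w x.
  exists M2 => x x0; rewrite -nmT !trmx_mul trmxK dev_skew mulNmx mulmxN nmN mulmxA.
  exact: h2.
have [M4 h4] : exists M, forall x, 0 < x -> nm (Q *m dev x *m Q^T) <= M * w x.
  have [M hM] := block_bound Q Q.
  apply: (tail_lists W sgn' (fun x x0 => block_der cQ cQ x0) hM (block_lim Q Q)).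
    by move=> x; apply: killl.
  by move=> x; apply: killr.
exists (M1 + M3 + (M2 + M4)) => x x0.
have -> : dev x = (Pi *m dev x *m Pi^T + Pi *m dev x *m Q^T) +
    (Q *m dev x *m Pi^T + Q *m dev x *m Q^T).
  rewrite -!mulmxDr -linearD /= /Q [Pi + _]addrC subrK trmx1 !mulmx1.
  by rewrite -mulmxDl addrC subrK mul1mx.
rewrite !mulrDl; apply: le_trans (nmD _ _) _.
by apply: lerD; (apply: le_trans (nmD _ _) _; apply: lerD); auto.
Qed.

Let dev_cont (e : R) : 0 < e -> exists2 d : R, 0 < d &
  forall x, 0 < x -> x < d -> nm (dev x - dev 0) < e.
Proof.
move=> e0; have [_ hc _] := hP; have [m m0 [hm _]] := P_decay.
pose K := nm Y * (m + 4%:R) + nm (P 0) * nm Y.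
have K0 : 0 <= K by rewrite addr_ge0 ?mulr_ge0 ?nm_ge0 ?addr_ge0.
have [|d d0 hd] := hc (e / (K + 1)); first by rewrite divr_gt0 // ltr_wpDl.
exists d => // x x0 xd; have := hd x x0 xd; rewrite ltr_pdivlMr ?ltr_wpDl // => h.
have -> : dev x - dev 0 = (P x - P 0) *m Y *m (P x)^T + P 0 *m Y *m (P x - P 0)^T.
  rewrite /dev opprB addrA subrK linearB /= mulmxBl mulmxBl mulmxBr.
  by rewrite addrA subrK.
apply: le_lt_trans h; rewrite mulrDr mulr1.
apply: (@le_trans _ _ (nm (P x - P 0) * K)); last by rewrite lerDl nm_ge0.
apply: le_trans (nmD _ _) _; rewrite mulrDr; apply: lerD.
  apply: le_trans (nmM _ _) _; rewrite nmT mulrA; apply: ler_pM; rewrite ?nm_ge0 ?nmM //.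
  rewrite -[P x](subrK 1%:M); apply: le_trans (nmD _ _) _; rewrite lerD ?hm //.
  by rewrite nm_scalar nc1 mulr1.
apply: le_trans (nmM _ _) _; rewrite nmT mulrC ler_wpM2l ?nm_ge0 //.
exact: nmM.
Qed.

Lemma tracked_wedge : tracked A Ai w Y eta dev.
Proof. by have [a [b [_ _ _ he]]] := roots; split; [exact: he|exact: lyapY|exact: dev_der1|exact: dev_bound|exact: dev_cont]. Qed.

End TrackedDeviation.

(** * Quantitative estimates for tracked deviations *)

Section TrackingEstimates.
Variable R : realType.
Local Notation C := (Cplx R).
Local Notation eigproj A P := (is_eigenprojection A (@stable_eig R) P).
Variables (rho : R) (w dw : R -> R).
Hypothesis W : is_weight rho w dw.
Hypothesis w1 : forall x, 0 < x -> w x <= 1.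

(** Dependent columns of [X] are sent to the case $Y=0$, so that [tracked_wedge] is needed only for
    a basis of the stable subspace. *)
Lemma tracked_exists A Ai P Pi (X : 'M[C]_(4, 2)) : half_conjugator A Ai P ->
  (exists c, forall x, 0 < x -> nm (A x - Ai) <= c * w x) -> eigproj Ai Pi ->
  Pi *m X = X -> wedge X = 0 \/ (exists S : 'M[C]_(2, 4), Pi = X *m S) ->
  exists eta dev, tracked A Ai w (wedge X) eta dev /\
    wedge (P 0 *m X) = wedge X + dev 0.
Proof.
move=> hP hA hPi PiX.
have zero : wedge X = 0 -> exists eta dev, tracked A Ai w (wedge X) eta dev /\
    wedge (P 0 *m X) = wedge X + dev 0.
  move=> X0; exists 0, (fun=> 0); rewrite wedge_mul X0 mulmx0 mul0mx addr0.
  by split => //; apply: tracked0.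
case=> [|[S hS]]; first exact: zero.
have [[c c0 hc]|hX] := pselect (exists2 c : 'cV[C]_2, c != 0 & X *m c = 0).
  by apply: zero; apply: wedge_dependent hc.
have free (c : 'cV[C]_2) : c != 0 -> X *m c != 0.
  by move=> c0; apply/eqP => h; apply: hX; exists c.
have h := tracked_wedge W hP hA hPi PiX hS free.
eexists; eexists; split; first exact: h.
by rewrite /= addrC subrK wedge_mul.
Qed.

Lemma nm_limit (D : R -> 'M[C]_4) (b : R) : (forall x, 0 < x -> nm (D x) <= b) ->
  (forall e : R, 0 < e -> exists2 d : R, 0 < d &
    forall x, 0 < x -> x < d -> nm (D x - D 0) < e) -> nm (D 0) <= b.
Proof.
move=> hb hc; rewrite leNgt; apply/negP => h.
have [|d d0 hd] := hc (nm (D 0) - b); first by rewrite subr_gt0.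
have d2 : 0 < d / 2 by rewrite divr_gt0.
have := hd (d / 2) d2; rewrite ltr_pdivrMr // ltr_pMr // ltr1n => /(_ isT).
have := hb _ d2; have := nmB (D (d / 2)) (D (d / 2) - D 0).
rewrite opprB addrC subrK; lra.
Qed.

(** In [absorb], the linear coefficient is $6K=2K+4K$, from the Lyapunov term and from [eta]. With
    16 entries this gives the threshold $8\cdot16\cdot6K=768K$ and the constant
    $8\cdot16\cdot2=256$. *)
Lemma tracked_bound A Ai Y eta dev K c : tracked A Ai w Y eta dev ->
  0 <= K -> 0 <= c ->
  (forall x, 0 < x -> nm (A x) <= K) -> nm Ai <= K ->
  (forall x, 0 < x -> nm (A x - Ai) <= c * w x) -> 768 * K <= rho ->
  forall x, 0 < x -> nm (dev x) <= 256 * (c * nm Y) / rho * w x.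
Proof.
move=> [he _ hd [M hM] _] K0 c0 hA hAi hT hr x x0.
have Y0 := nm_ge0 Y.
have -> : 256 * (c * nm Y) / rho * w x = 8 * (4 * 4)%:R * (2 * (c * nm Y)) / rho * w x.
  by rewrite natrM; congr (_ / _ * _); ring.
apply: (@absorb R rho w dw 4 4 dev (fun x => lyap (A x) (dev x) - eta *: dev x + lyap (A x - Ai) Y) (6 * K) (2 * (c * nm Y)) M W) => //.
- by rewrite mulr_ge0.
- by rewrite !mulr_ge0.
- by apply: le_trans hr; rewrite natrM; lra.
- move=> y y0 /=; apply: le_trans (nmD _ _) _; apply: lerD.
    apply: le_trans (nmB _ _) _.
    have -> : 6 * K * nm (dev y) = 2 * (K * nm (dev y)) + 4 * K * nm (dev y) by ring.
    apply: lerD.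
      apply: le_trans (nm_lyap _ _) _; rewrite ler_pM2l // ler_wpM2r ?nm_ge0 //.
      exact: hA.
    apply: le_trans (nmZ _ _) _; rewrite ler_wpM2r ?nm_ge0 //.
    by apply: le_trans he _; rewrite ler_pM2l.
  apply: le_trans (nm_lyap _ _) _; rewrite -mulrA ler_pM2l // mulrAC.
  by rewrite ler_wpM2r // hT.
Qed.

Lemma tracked_bound0 A Ai Y eta dev K c : tracked A Ai w Y eta dev ->
  0 <= K -> 0 <= c ->
  (forall x, 0 < x -> nm (A x) <= K) -> nm Ai <= K ->
  (forall x, 0 < x -> nm (A x - Ai) <= c * w x) -> 768 * K <= rho ->
  nm (dev 0) <= 256 * (c * nm Y) / rho.
Proof.
move=> ht K0 c0 hA hAi hT hr; have [_ _ _ _ hc] := ht; have [r0 _ _ _ _] := W.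
apply: nm_limit hc => x x0.
apply: le_trans (tracked_bound ht K0 c0 hA hAi hT hr x0) _.
apply: ler_piMr; last exact: w1.
apply: divr_ge0; last exact: ltW.
by apply: mulr_ge0 => //; apply: mulr_ge0 => //; exact: nm_ge0.
Qed.

Lemma lyap_diff (A1 A2 D1 D2 : 'M[C]_4) :
  lyap A1 D1 - lyap A2 D2 = lyap A1 (D1 - D2) + lyap (A1 - A2) D2.
Proof. by rewrite lyapD lyapN lyapDl lyapNl addrA subrK. Qed.

Let combine (e b y k c x : R) :
  (2 * (e * (b * y * x)) + 2 * (e * (6 * k + 2 * y)) * (b * x)) + (2 * (c * x * e) + 2 * (e * x * y))
  = 2 * e * (b * y + (6 * k + 2 * y) * b + c + y) * x.
Proof. by ring. Qed.

(** The difference solves the first equation with a forcing of size $e\,w$. The scalars [eta1] and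
    [eta2] need not be close when [Y2] is small, and only $(\eta_1-\eta_2)Y_2$ is controlled. This
    suffices, because [dev2] is bounded by a multiple of $|Y_2|$. *)
Lemma tracked_diff A1 Ai1 Y1 eta1 dev1 A2 Ai2 Y2 eta2 dev2 K c y e :
  tracked A1 Ai1 w Y1 eta1 dev1 -> tracked A2 Ai2 w Y2 eta2 dev2 ->
  0 <= K -> 0 <= c -> 0 <= e ->
  (forall x, 0 < x -> nm (A1 x) <= K) -> nm Ai1 <= K ->
  (forall x, 0 < x -> nm (A1 x - Ai1) <= c * w x) ->
  (forall x, 0 < x -> nm (A2 x) <= K) -> nm Ai2 <= K ->
  (forall x, 0 < x -> nm (A2 x - Ai2) <= c * w x) -> 768 * K <= rho ->
  nm Y1 <= y -> nm Y2 <= y ->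
  (forall x, 0 < x -> nm (A1 x - A2 x) <= e) -> nm (Ai1 - Ai2) <= e ->
  (forall x, 0 < x -> nm ((A1 x - Ai1) - (A2 x - Ai2)) <= e * w x) ->
  nm (Y1 - Y2) <= e ->
  nm (dev1 0 - dev2 0) <=
    256 * (256 * c / rho * y + (6 * K + 2 * y) * (256 * c / rho) + c + y) / rho * e.
Proof.
move=> t1 t2 K0 c0 e0 hA1 hAi1 hT1 hA2 hAi2 hT2 hr hy1 hy2 hA hAi hT hY.
have [he1 l1 d1 [M1 m1] c1] := t1; have [he2 l2 d2 [M2 m2] c2] := t2.
have [r0 _ _ wp _] := W.
have y0 : 0 <= y := le_trans (nm_ge0 _) hy1.
set b := 256 * c / rho.
have b0 : 0 <= b by rewrite divr_ge0 ?(ltW r0) // mulr_ge0.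
have hb2 x : 0 < x -> nm (dev2 x) <= b * nm Y2 * w x.
  move=> x0; apply: le_trans (tracked_bound t2 K0 c0 hA2 hAi2 hT2 hr x0) _.
  by rewrite /b mulrA [_ / rho]mulrAC.
have heta : nc (eta1 - eta2) * nm Y2 <= 2 * (e * (6 * K + 2 * y)).
  apply: le_trans (nmZ_ge _ _) _; rewrite ler_pM2l //.
  have -> : (eta1 - eta2) *: Y2 = (lyap Ai1 (Y1 - Y2) + lyap (Ai1 - Ai2) Y2) - eta1 *: (Y1 - Y2).
    by rewrite -lyap_diff l1 l2 scalerBr scalerBl opprB [RHS]addrC subrKA.
  apply: le_trans (nmB _ _) _; apply: (@le_trans _ _ ((2 * (K * e) + 2 * (e * y)) + 4 * K * e)).
    apply: lerD.
      apply: le_trans (nmD _ _) _; apply: lerD; apply: le_trans (nm_lyap _ _) _;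
        by rewrite ler_pM2l //; apply: ler_pM; rewrite ?nm_ge0.
    apply: le_trans (nmZ _ _) _; apply: ler_pM; rewrite ?nc_ge0 ?nm_ge0 //.
    by apply: le_trans he1 _; rewrite ler_pM2l.
  by rewrite le_eqVlt; apply/orP; left; apply/eqP; ring.
pose K2 := 2 * e * (b * y + (6 * K + 2 * y) * b + c + y).
have K20 : 0 <= K2.
  have k6 : 0 <= 6 * K + 2 * y by rewrite addr_ge0 ?mulr_ge0.
  rewrite /K2; apply: mulr_ge0; first exact: mulr_ge0.
  by do !apply: addr_ge0 => //; apply: mulr_ge0.
have hder x : 0 < x -> mder (fun t => dev1 t - dev2 t) x
    (lyap (A1 x) (dev1 x - dev2 x) - eta1 *: (dev1 x - dev2 x) +
     ((lyap (A1 x - A2 x) (dev2 x) - (eta1 - eta2) *: dev2 x) +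
      (lyap (A2 x - Ai2) (Y1 - Y2) + lyap ((A1 x - Ai1) - (A2 x - Ai2)) Y1))).
  move=> x0; apply: (mder_eq (mderB (d1 x x0) (d2 x x0))).
  have -> : lyap (A2 x - Ai2) (Y1 - Y2) + lyap ((A1 x - Ai1) - (A2 x - Ai2)) Y1 =
      lyap (A1 x - Ai1) Y1 - lyap (A2 x - Ai2) Y2.
    by rewrite lyapD lyapN [lyap (_ - _ - _) _]lyapDl lyapNl addrC addrA subrK.
  rewrite opprD addrACA [RHS]addrA; congr (_ + _).
  have -> : lyap (A1 x - A2 x) (dev2 x) =
      lyap (A1 x) (dev1 x) - lyap (A2 x) (dev2 x) - lyap (A1 x) (dev1 x - dev2 x).
    by rewrite lyap_diff addrAC subrr add0r.
  move: (lyap (A1 x) (dev1 x)) (lyap (A2 x) (dev2 x)) (lyap (A1 x) (dev1 x - dev2 x)) => p q r.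
  rewrite scalerBr scalerBl; move: (eta1 *: dev1 x) (eta1 *: dev2 x) (eta2 *: dev2 x) => u v z.
  by rewrite [RHS]addrACA [r + _]addrC subrK -opprD subrKA; exact: sub_sub_swap.
have hbound x : 0 < x -> nm ((lyap (A1 x - A2 x) (dev2 x) - (eta1 - eta2) *: dev2 x) +
      (lyap (A2 x - Ai2) (Y1 - Y2) + lyap ((A1 x - Ai1) - (A2 x - Ai2)) Y1)) <= K2 * w x.
  move=> x0; rewrite /K2 -combine; have w0 := ltW (wp x x0).
  have a1 : nm (lyap (A1 x - A2 x) (dev2 x)) <= 2 * (e * (b * y * w x)).
    apply: le_trans (nm_lyap _ _) _; rewrite ler_pM2l //; apply: ler_pM; rewrite ?nm_ge0 ?hA //.
    by apply: le_trans (hb2 x x0) _; rewrite ler_wpM2r // ler_wpM2l.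
  have a2 : nm ((eta1 - eta2) *: dev2 x) <= 2 * (e * (6 * K + 2 * y)) * (b * w x).
    apply: le_trans (nmZ _ _) _.
    apply: (@le_trans _ _ (nc (eta1 - eta2) * (b * nm Y2 * w x))).
      by rewrite ler_wpM2l ?nc_ge0 // hb2.
    have -> : nc (eta1 - eta2) * (b * nm Y2 * w x) = nc (eta1 - eta2) * nm Y2 * (b * w x) by ring.
    by apply: ler_wpM2r => //; apply: mulr_ge0.
  have a3 : nm (lyap (A2 x - Ai2) (Y1 - Y2)) <= 2 * (c * w x * e).
    by apply: le_trans (nm_lyap _ _) _; rewrite ler_pM2l //; apply: ler_pM; rewrite ?nm_ge0 ?hT2.
  have a4 : nm (lyap ((A1 x - Ai1) - (A2 x - Ai2)) Y1) <= 2 * (e * w x * y).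
    by apply: le_trans (nm_lyap _ _) _; rewrite ler_pM2l //; apply: ler_pM; rewrite ?nm_ge0 ?hT.
  apply: le_trans (nmD _ _) _; apply: lerD.
    by apply: le_trans (nmB _ _) _; apply: lerD.
  by apply: le_trans (nmD _ _) _; apply: lerD.
have hfin x : 0 < x -> nm (dev1 x - dev2 x) <= 8 * (4 * 4)%:R * K2 / rho * w x.
  move: x; apply: (@absorb R rho w dw 4 4 (fun x => dev1 x - dev2 x) _ (6 * K) K2 (M1 + M2) W _ K20 _ hder).
  - by rewrite mulr_ge0.
  - by apply: le_trans hr; rewrite natrM; lra.
  - move=> x x0; apply: le_trans (nmD _ _) _; apply: lerD; last exact: hbound.
    apply: le_trans (nmB _ _) _.
    have -> : 6 * K * nm (dev1 x - dev2 x) =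
        2 * (K * nm (dev1 x - dev2 x)) + 4 * K * nm (dev1 x - dev2 x) by ring.
    apply: lerD.
      apply: le_trans (nm_lyap _ _) _; rewrite ler_pM2l // ler_wpM2r ?nm_ge0 //.
      exact: hA1.
    apply: le_trans (nmZ _ _) _; rewrite ler_wpM2r ?nm_ge0 //.
    by apply: le_trans he1 _; rewrite ler_pM2l.
  - by move=> x x0; apply: le_trans (nmB _ _) _; rewrite mulrDl; apply: lerD; auto.
have -> : 256 * (b * y + (6 * K + 2 * y) * b + c + y) / rho * e = 8 * (4 * 4)%:R * K2 / rho.
  by rewrite natrM /K2; move: (b * y + _ + c + y) => z; field; rewrite gt_eqF.
apply: (@nm_limit (fun x => dev1 x - dev2 x)).
  move=> x x0; apply: le_trans (hfin x x0) _.
  apply: ler_piMr; last exact: w1.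
  apply: divr_ge0; last exact: ltW.
  by apply: mulr_ge0 => //; apply: mulr_ge0.
move=> e' e'0; have [|q1 q10 h1] := c1 (e' / 2); first by lra.
have [|q2 q20 h2] := c2 (e' / 2); first by lra.
exists (Num.min q1 q2); first by rewrite lt_min q10.
move=> x x0; rewrite lt_min => /andP[xq1 xq2].
rewrite sub_sub_swap; apply: le_lt_trans (nmB _ _) _.
by have := h1 x x0 xq1; have := h2 x x0 xq2; lra.
Qed.

End TrackingEstimates.

(** * The shock profile and its rate of convergence *)

Section ProfileWeights.
Variable R : realType.
Variables (gamma vp : R) (v : R -> R).
Hypotheses (hgamma : 1 <= gamma) (hvp : 0 < vp < 1) (hv : is_profile gamma vp v).

Let vp0 : 0 < vp. Proof. by case/andP: hvp. Qed.
Let vp1 : vp < 1. Proof. by case/andP: hvp. Qed.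

Lemma profile_lower x : vp < v x.
Proof.
have [_ hd _ hl] := hv.
have h1 : vp <= v (x + 1).
  rewrite leNgt; apply/negP => h; move/cvgrPdist_lt: hl => /(_ (vp - v (x + 1))).
  rewrite subr_gt0 => /(_ h)[M [_ hM]].
  pose y := Num.max (M + 1) (x + 2).
  have My : M < y by rewrite lt_max ltrDl ltr01.
  have xy : x + 1 < y by rewrite lt_max ltrD2l ltr1n orbT.
  have := hM y My; have := hd _ _ xy; have := ler_norm (vp - v y); lra.
by apply: le_lt_trans h1 _; apply: hd; rewrite ltrDl.
Qed.

Lemma profile_upper x : v x < 1.
Proof.
have [_ hd hl _] := hv.
have h1 : v (x - 1) <= 1.
  rewrite leNgt; apply/negP => h; move/cvgrPdist_lt: hl => /(_ (v (x - 1) - 1)).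
  rewrite subr_gt0 => /(_ h)[M [_ hM]].
  pose y := Num.min (M - 1) (x - 2).
  have My : y < M by rewrite gt_min gtrDl oppr_lt0 ltr01.
  have xy : y < x - 1 by rewrite gt_min ltrD2l ltrN2 ltr1n orbT.
  have := hM y My; have := hd _ _ xy; have := ler_norm (v y - 1).
  by rewrite distrC; lra.
by apply: lt_le_trans h1; apply: hd; rewrite gtrDl oppr_lt0.
Qed.

Let h (x : R) := x `^ (- gamma).

(** Strict convexity of $x^{-\gamma}$ without derivatives: $z^{-\gamma}\ge1-\gamma\ln
    z>1-\gamma(z-1)$ for $z=y/x\ne1$. *)
Let tangent x y : 0 < x -> 0 < y -> y != x -> h x * (1 - gamma * (y / x - 1)) < h y.
Proof.
move=> x0 y0 yx; have z0 : 0 < y / x by rewrite divr_gt0.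
have -> : h y = h x * (y / x) `^ (- gamma).
  rewrite /h -powRM ?ltW //; congr (_ `^ _); field; exact: lt0r_neq0.
rewrite ltr_pM2l ?powR_gt0 // /powR gt_eqF //.
have lz : ln (y / x) != 0.
  rewrite ln_eq0 //; apply: contra_neq yx => e.
  by rewrite -[LHS](divfK (lt0r_neq0 x0)) e mul1r.
have h1 := expR_gt1Dx lz; rewrite lnK ?posrE // in h1.
apply: lt_le_trans (expR_ge1Dx _).
have g0 : 0 < gamma by apply: lt_le_trans hgamma.
rewrite ltrD2l mulNr ltrN2 ltr_pM2l //; lra.
Qed.

Let chord p t q : 0 < p -> p < t -> t < q -> (q - p) * h t < (q - t) * h p + (t - p) * h q.
Proof.
move=> p0 pt tq; have t0 : 0 < t by lra.
have q0 : 0 < q by lra.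
have hp := tangent t0 p0 (negbT (lt_eqF pt)); have hq := tangent t0 q0 (negbT (gt_eqF tq)).
have a0 : 0 < q - t by lra.
have b0 : 0 < t - p by lra.
rewrite -(ltr_pM2l a0) in hp; rewrite -(ltr_pM2l b0) in hq.
apply: le_lt_trans (ltrD hp hq); rewrite le_eqVlt; apply/orP; left; apply/eqP.
by field; apply: lt0r_neq0.
Qed.

Let a := shock_coef gamma vp.
(** The profile equation reads $v'=v\,g(v)$, with [g] strictly convex and zero exactly at both end
    states. *)
Let g (x : R) := x - 1 + a * (h x - 1).

Let q_lt1 : 0 < vp `^ gamma < 1.
Proof.
rewrite powR_gt0 //= /powR gt_eqF // expR_lt1 pmulr_rlt0.
  by apply: ln_lt0; rewrite vp0 vp1.
exact: lt_le_trans hgamma.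
Qed.

Let a0 : 0 < a.
Proof.
have /andP[q0 q1] := q_lt1.
by rewrite /a /shock_coef divr_gt0 ?mulr_gt0 ?subr_gt0.
Qed.

Let g1 : g 1 = 0.
Proof. by rewrite /g /h powR1 !subrr mulr0 addr0. Qed.

Let gvp : g vp = 0.
Proof.
have /andP[q0 q1] := q_lt1.
rewrite /g /h powRN /a /shock_coef; field.
by rewrite !lt0r_neq0 // subr_gt0.
Qed.

Let gchord p t q : 0 < p -> p < t -> t < q -> (q - p) * g t < (q - t) * g p + (t - p) * g q.
Proof.
move=> p0 pt tq; have := chord p0 pt tq; rewrite -(ltr_pM2l a0) /g => h1.
move: h1; move: (h p) (h t) (h q) a a0 => x y z b _ h1.
lra.
Qed.

Let v0 := v 0.

Let gv0 : g v0 < 0.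
Proof.
have := gchord vp0 (profile_lower 0) (profile_upper 0).
rewrite g1 gvp !mulr0 addr0 pmulr_rlt0 // subr_gt0; exact: vp1.
Qed.

(** By convexity [g] lies below its chord over $[v_+,\bar v(0)]$, which serves for $x\ge0$, and
    below the one over $[\bar v(0),1]$, which serves for $x\le0$. Their slopes give [k1] and [k2];
    the remaining factor $v$ is at least $v_+$. *)
Lemma profile_field_decay : exists c : R, [/\ 0 < c,
  forall x, 0 <= x -> v x * (v x - 1 + shock_coef gamma vp * (v x `^ (- gamma) - 1))
     <= - (c * (v x - vp)) &
  forall x, x <= 0 -> v x * (v x - 1 + shock_coef gamma vp * (v x `^ (- gamma) - 1))
     <= - (c * (1 - v x))].
Proof.
have [_ hd _ _] := hv.
have mono x y : x <= y -> v y <= v x.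
  by rewrite le_eqVlt => /predU1P[->//|/hd/ltW].
have l0 := profile_lower 0; have u0 := profile_upper 0.
rewrite -/v0 in l0 u0.
have d1 : 0 < v0 - vp by rewrite subr_gt0.
have d2 : 0 < 1 - v0 by rewrite subr_gt0.
pose k1 := - g v0 / (v0 - vp); pose k2 := - g v0 / (1 - v0).
have k10 : 0 < k1 by rewrite divr_gt0 // oppr_gt0.
have k20 : 0 < k2 by rewrite divr_gt0 // oppr_gt0.
have e1 : k1 * (v0 - vp) = - g v0 by rewrite divfK // gt_eqF.
have e2 : k2 * (1 - v0) = - g v0 by rewrite divfK // gt_eqF.
have cp : 0 < vp * Num.min k1 k2 by rewrite mulr_gt0 // lt_min k10.
exists (vp * Num.min k1 k2).
have m1 : Num.min k1 k2 <= k1 by rewrite ge_min lexx.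
have m2 : Num.min k1 k2 <= k2 by rewrite ge_min lexx orbT.
have m0 : 0 < Num.min k1 k2 by rewrite lt_min k10.
have fin (t k z : R) : vp < t -> 0 <= z -> Num.min k1 k2 <= k -> g t <= - (k * z) ->
    t * g t <= - (vp * Num.min k1 k2 * z).
  move=> ht z0 hk hgt; have hm : Num.min k1 k2 * z <= k * z by rewrite ler_wpM2r.
  have hg : g t <= - (Num.min k1 k2 * z) by lra.
  have n0 : 0 <= Num.min k1 k2 * z by rewrite mulr_ge0 // ltW.
  rewrite -mulrA -mulrN; apply: (@le_trans _ _ (t * - (Num.min k1 k2 * z))).
    by rewrite ler_pM2l //; apply: lt_trans ht.
  by rewrite !mulrN lerN2 ler_wpM2r // ltW.
split=> // x hx.
  apply: (fin (v x) k1 (v x - vp)) => //; first exact: profile_lower.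
    by rewrite subr_ge0 ltW // profile_lower.
  have : v x <= v0 by exact: mono.
  rewrite le_eqVlt => /predU1P[->|hlt]; first by rewrite e1 opprK.
  have := gchord vp0 (profile_lower x) hlt; rewrite gvp mulr0 add0r => hc.
  rewrite -(ler_pM2l d1); apply: le_trans (ltW hc) _.
  have -> : (v0 - vp) * - (k1 * (v x - vp)) = - (k1 * (v0 - vp)) * (v x - vp) by ring.
  by rewrite e1 opprK mulrC.
apply: (fin (v x) k2 (1 - v x)) => //; first exact: profile_lower.
  by rewrite subr_ge0 ltW // profile_upper.
have : v0 <= v x by exact: mono.
rewrite le_eqVlt => /predU1P[<-|hlt]; first by rewrite e2 opprK.
have := gchord (lt_trans vp0 l0) hlt (profile_upper x); rewrite g1 mulr0 addr0 => hc.
rewrite -(ler_pM2l d2); apply: le_trans (ltW hc) _.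
have -> : (1 - v0) * - (k2 * (1 - v x)) = - (k2 * (1 - v0)) * (1 - v x) by ring.
by rewrite e2 opprK mulrC.
Qed.

Let F (x : R) := x * (x - 1 + shock_coef gamma vp * (x `^ (- gamma) - 1)).

(** Rescaling multiplies the rate of decay by [r], which lets it exceed any multiple of $|A|$. The
    second weight belongs to the reflected left half-line. *)
Lemma profile_weights : exists2 c : R, 0 < c & forall r, 0 < r ->
  is_weight (c * r) (fun x => v (r * x) - vp) (fun x => r * F (v (r * x))) /\
  is_weight (c * r) (fun x => 1 - v (- (r * x))) (fun x => r * F (v (- (r * x)))).
Proof.
have [c [c0 h1 h2]] := profile_field_decay.
have [hder _ hm hp] := hv.
exists c => // r r0.
have hr x : rder (fun t => r * t) x r.
  by apply: (rder_eq (rderM (rder_cst r x) (rder_id x))); rewrite /=; ring.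
split; split.
- exact: mulr_gt0.
- move=> x x0; apply: (rder_eq (rderB (rder_comp (hder _) (hr x)) (rder_cst vp x))).
  by rewrite subr0 mulrC.
- move=> x x0; have rx : 0 <= r * x by rewrite mulr_ge0 // ltW.
  have hF := h1 _ rx; rewrite -/(F _) in hF; have -> : - (c * r * (v (r * x) - vp)) = r * - (c * (v (r * x) - vp)) by ring.
  by apply: ler_wpM2l hF; exact: ltW.
- by move=> x _; rewrite subr_gt0 profile_lower.
- move=> e e0; move/cvgrPdist_lt: hp => /(_ e e0)[M [_ hM]].
  exists (M / r) => x; rewrite ltr_pdivrMr // mulrC => /hM.
  by rewrite distrC.
- exact: mulr_gt0.
- move=> x x0; apply: (rder_eq (rderB (rder_cst 1 x) (rder_comp (hder _) (rderN (hr x))))).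
  by rewrite sub0r mulrN opprK mulrC.
- move=> x x0; have rx : - (r * x) <= 0 by rewrite oppr_le0 mulr_ge0 // ltW.
  have hF := h2 _ rx; rewrite -/(F _) in hF; have -> : - (c * r * (1 - v (- (r * x)))) = r * - (c * (1 - v (- (r * x)))) by ring.
  by apply: ler_wpM2l hF; exact: ltW.
- by move=> x _; rewrite subr_gt0 profile_upper.
- move=> e e0; move/cvgrPdist_lt: hm => /(_ e e0)[M [_ hM]].
  exists (- M / r) => x; rewrite ltr_pdivrMr // mulrC ltrNl => /hM.
  by [].
Qed.

End ProfileWeights.

(** * Determinants of order four *)

Section Determinant4.
Variable K : comNzRingType.

(** Entries are indexed by [nat] so that minors are again of this form. *)
Lemma det2_nat (m : nat -> nat -> K) :
  \det (\matrix_(i < 2, j < 2) m i j) = m 0 0 * m 1 1 - m 0 1 * m 1 0.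
Proof.
rewrite (expand_det_row _ ord0) !big_ord_recl big_ord0 /cofactor !det_mx11 !mxE /=.
by rewrite /bump /= ?addn0 ?expr0 ?expr1 ?mul1r ?addr0 mulN1r mulrN.
Qed.

Lemma det3_nat (m : nat -> nat -> K) :
  \det (\matrix_(i < 3, j < 3) m i j) =
  m 0 0 * (m 1 1 * m 2 2 - m 1 2 * m 2 1) - m 0 1 * (m 1 0 * m 2 2 - m 1 2 * m 2 0)
  + m 0 2 * (m 1 0 * m 2 1 - m 1 1 * m 2 0).
Proof.
have minor (j : 'I_3) : \det (row' ord0 (col' j (\matrix_(i < 3, j < 3) m i j))) =
    m 1 (bump j 0) * m 2 (bump j 1) - m 1 (bump j 1) * m 2 (bump j 0).
  rewrite -(det2_nat (fun a b => m a.+1 (bump j b))); congr (\det _).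
  by apply/matrixP => a b; rewrite !mxE.
rewrite (expand_det_row _ ord0) !big_ord_recl big_ord0 /cofactor !minor !mxE /= /bump /=.
by rewrite ?addn0 ?add0n /=; ring.
Qed.

(** Grouped as the Laplace expansion along the first two columns, the form in which the minors of
    the two planes appear. *)
Lemma det4_nat (m : nat -> nat -> K) :
  \det (\matrix_(i < 4, j < 4) m i j) =
  (m 0 0 * m 1 1 - m 0 1 * m 1 0) * (m 2 2 * m 3 3 - m 2 3 * m 3 2)
  - (m 0 0 * m 2 1 - m 0 1 * m 2 0) * (m 1 2 * m 3 3 - m 1 3 * m 3 2)
  + (m 0 0 * m 3 1 - m 0 1 * m 3 0) * (m 1 2 * m 2 3 - m 1 3 * m 2 2)
  + (m 1 0 * m 2 1 - m 1 1 * m 2 0) * (m 0 2 * m 3 3 - m 0 3 * m 3 2)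
  - (m 1 0 * m 3 1 - m 1 1 * m 3 0) * (m 0 2 * m 2 3 - m 0 3 * m 2 2)
  + (m 2 0 * m 3 1 - m 2 1 * m 3 0) * (m 0 2 * m 1 3 - m 0 3 * m 1 2).
Proof.
have minor (j : 'I_4) : \det (row' ord0 (col' j (\matrix_(i < 4, j < 4) m i j))) =
    \det (\matrix_(a < 3, b < 3) m a.+1 (bump j b)).
  by congr (\det _); apply/matrixP => a b; rewrite !mxE.
rewrite (expand_det_row _ ord0) !big_ord_recl big_ord0 /cofactor !minor.
rewrite !(det3_nat (fun a b => m a.+1 (bump _ b))) !mxE /= /bump /=.
by rewrite ?addn0 ?add0n /=; ring.
Qed.

End Determinant4.

(** * The Evans determinant as a pairing of two planes *)

Section Pairing.
Variable R : realType.
Local Notation C := (Cplx R).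
Implicit Types M N D E : 'M[C]_4.

Definition pairing M N : C := M i0 i1 * N i2 i3 - M i0 i2 * N i1 i3 + M i0 i3 * N i1 i2
  + M i1 i2 * N i0 i3 - M i1 i3 * N i0 i2 + M i2 i3 * N i0 i1.

Lemma det_cols_wedge (X Y : 'M[C]_(4, 2)) : det_cols X Y = pairing (wedge X) (wedge Y).
Proof.
pose m (a b : nat) : C := if b is 0 then X (inord a) ord0 else
  if b is 1 then X (inord a) ord_max else
  if b is 2 then Y (inord a) ord0 else Y (inord a) ord_max.
have e : row_mx X Y = \matrix_(i < 4, j < 4) m i j :> 'M[C]_(4, 2 + 2).
  apply/matrixP => i j; rewrite [RHS]mxE /m inord_val; move: j; apply: ord4P => /=.
  - by rewrite -(row_mxEl X Y); congr (row_mx X Y i _); apply: val_inj.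
  - by rewrite -(row_mxEl X Y); congr (row_mx X Y i _); apply: val_inj.
  - by rewrite -(row_mxEr X Y); congr (row_mx X Y i _); apply: val_inj.
  - by rewrite -(row_mxEr X Y); congr (row_mx X Y i _); apply: val_inj.
rewrite /det_cols [X in \det X]e det4_nat /pairing !wedgeE /m.
have i_ k (hk : (k < 4)%N) : inord k = Ordinal hk by apply: val_inj; rewrite /= inordK.
by rewrite (i_ 0%N isT) (i_ 1%N isT) (i_ 2%N isT) (i_ 3%N isT).
Qed.

Lemma nc_pairing M N : nc (pairing M N) <= 6 * (nm M * nm N).
Proof.
have t (x y : C) : nc x <= nm M -> nc y <= nm N -> nc (x * y) <= nm M * nm N.
  by move=> hx hy; apply: le_trans (ncM _ _) _; apply: ler_pM; rewrite ?nc_ge0.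
have h1 := t _ _ (nc_nm M i0 i1) (nc_nm N i2 i3).
have h2 := t _ _ (nc_nm M i0 i2) (nc_nm N i1 i3).
have h3 := t _ _ (nc_nm M i0 i3) (nc_nm N i1 i2).
have h4 := t _ _ (nc_nm M i1 i2) (nc_nm N i0 i3).
have h5 := t _ _ (nc_nm M i1 i3) (nc_nm N i0 i2).
have h6 := t _ _ (nc_nm M i2 i3) (nc_nm N i0 i1).
rewrite /pairing; apply: le_trans (ncD _ _) _.
apply: le_trans (lerD (ncB _ _) (lexx _)) _.
apply: le_trans (lerD (lerD (ncD _ _) (lexx _)) (lexx _)) _.
apply: le_trans (lerD (lerD (lerD (ncD _ _) (lexx _)) (lexx _)) (lexx _)) _.
apply: le_trans (lerD (lerD (lerD (lerD (ncB _ _) (lexx _)) (lexx _)) (lexx _)) (lexx _)) _.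
apply: le_trans (lerD (lerD (lerD (lerD (lerD h1 h2) h3) h4) h5) h6) _.
by rewrite le_eqVlt; apply/orP; left; apply/eqP; ring.
Qed.

Lemma pairingBB M N M' N' :
  pairing M N - pairing M' N' = pairing (M - M') N + pairing M' (N - N').
Proof. by rewrite /pairing !mxE; ring. Qed.

Lemma nc_pairing_diff M N M' N' y e1 e2 : nm N <= y -> nm M' <= y -> 0 <= e1 -> 0 <= e2 ->
  nm (M - M') <= e1 -> nm (N - N') <= e2 ->
  nc (pairing M N - pairing M' N') <= 6 * y * (e1 + e2).
Proof.
move=> hN hM e10 e20 h1 h2; rewrite pairingBB; apply: le_trans (ncD _ _) _.
rewrite mulrDr -!mulrA; apply: lerD; apply: le_trans (nc_pairing _ _) _; rewrite ler_pM2l //.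
  by rewrite mulrC; apply: ler_pM; rewrite ?nm_ge0.
by apply: ler_pM; rewrite ?nm_ge0.
Qed.

End Pairing.

(** * From conjugators on either half-line to the one-sided form *)

Section Reflection.
Variable R : realType.
Local Notation C := (Cplx R).

Lemma norm_nc_le (z : C) (b : R) : `|z| <= toC b -> nc z <= 2 * b.
Proof.
move=> h; rewrite leNgt; apply/negP => hb.
have : `|z| < toC (nc z / 2) by apply: le_lt_trans h _; rewrite toC_lt; lra.
move=> /nc_norm; lra.
Qed.

Lemma half_conjugator_plus (A : R -> 'M[C]_4) Ai P :
  is_conjugator A Ai [set x | 0 < x] P -> half_conjugator A Ai P.
Proof.
move=> [_ hc [M [theta [t0 hb]]] hs]; split.
- exists ((4 * 4)%:R * (2 * M)), theta; split => // x x0.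
  rewrite -mulrA; apply: nm_entries => i j; rewrite -mulrA; apply: norm_nc_le.
  by have := hb x x0 i j; rewrite (gtr0_norm x0) !mxE.
- move=> e e0; move/cvg_nm: hc => /(_ e e0); rewrite near_withinE => /nbhs_ballP[d /= d0 h].
  exists d => // x x0 xd; apply: h => //.
  by rewrite /ball /= sub0r normrN gtr0_norm.
- move=> Z hZ x x0 i j; rewrite ord1.
  have /hs : solves (fun=> Ai) [set x | 0 < x] Z by move=> y y0 k; apply: hZ.
  by move=> /(_ x x0 i).
Qed.

Lemma half_conjugator_minus (A : R -> 'M[C]_4) Ai P :
  is_conjugator A Ai [set x | x < 0] P ->
  half_conjugator (fun x => - A (- x)) (- Ai) (fun x => P (- x)).
Proof.
have rneg (x : R) : rder (fun t => - t) x (-1) by apply: rderN; apply: rder_id.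
have c1 : toC (-1) = -1 :> C by rewrite toCN.
move=> [_ hc [M [theta [t0 hb]]] hs]; split.
- exists ((4 * 4)%:R * (2 * M)), theta; split => // x x0.
  rewrite -mulrA; apply: nm_entries => i j; rewrite -mulrA; apply: norm_nc_le.
  have xn : - x < 0 by rewrite oppr_lt0.
  by have := hb (- x) xn i j; rewrite (ltr0_norm xn) opprK !mxE.
- move=> e e0; move/cvg_nm: hc => /(_ e e0); rewrite near_withinE => /nbhs_ballP[d /= d0 h].
  exists d => // x x0 xd; rewrite oppr0; apply: h; last by rewrite /= oppr_lt0.
  by rewrite /ball /= sub0r opprK gtr0_norm.
- move=> Z hZ x x0.
  have /hs h : solves (fun=> Ai) [set x | x < 0] (fun t => Z (- t)).
    move=> y /= y0 k; have y0' : 0 < - y by rewrite oppr_gt0.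
    have := mder_comp (hZ (- y) y0') (rneg y).
    rewrite c1 scaleN1r mulNmx opprK => hd; exact: hd.
  have xn : - x < 0 by rewrite oppr_lt0.
  have hm : mder (fun t => P t *m Z (- t)) (- x) (A (- x) *m (P (- x) *m Z x)).
    by move=> i j; rewrite ord1; have := h (- x) xn i; rewrite opprK.
  have := mder_comp hm (rneg x); rewrite c1 scaleN1r -mulNmx.
  by under [fun t => _]funext => t do rewrite opprK.
Qed.

End Reflection.

(** * From bounds on the deviations to convergence, including $\lambda=0$ *)

Section UniformLimit.
Variable R : realType.
Local Notation C := (Cplx R).
Local Notation punct := (@puncturedRHP R).

Lemma puncturedRHP_proper : ProperFilter (within punct (nbhs (0 : C))).
Proof.
apply: Build_ProperFilter_ex => P; rewrite /within /= => /nbhs_nc[d d0 h].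
exists (toC (d / 2)); apply: h.
  by rewrite subr0 nc_toC ger0_norm ?divr_ge0 ?(ltW d0) // ltr_pdivrMr // ltr_pMr // ltr1n.
split; first by rewrite ReC_toC divr_ge0 // ltW.
by rewrite toC_eq0 gt_eqF // divr_gt0.
Qed.

(** Completeness of [R], applied to real and imaginary parts. *)
Lemma cauchy_puncturedRHP (g : C -> C) :
  (forall e : R, 0 < e -> exists2 d : R, 0 < d & forall l1 l2, punct l1 -> punct l2 ->
    nc l1 < d -> nc l2 < d -> nc (g l1 - g l2) < e) ->
  exists2 a : C, g @ within punct (nbhs (0 : C)) --> a &
    forall e : R, 0 < e -> exists2 d : R, 0 < d & forall l, punct l -> nc l < d ->
      nc (g l - a) < e.
Proof.
move=> hg; have PF := puncturedRHP_proper.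
have key (p : C -> R) : (forall z w, p z - p w = p (z - w)) -> (forall z, `|p z| <= nc z) ->
    cvg ((fun l => p (g l)) @ within punct (nbhs (0 : C))).
  move=> pl pb; apply/cauchy_cvgP; apply: cauchy_exP => e e0.
  have [d d0 hd] := hg e e0.
  have d2 : nc (toC (d / 2)) < d.
    by rewrite nc_toC ger0_norm ?divr_ge0 ?(ltW d0) // ltr_pdivrMr // ltr_pMr // ltr1n.
  have p2 : punct (toC (d / 2)).
    split; first by rewrite ReC_toC divr_ge0 // ltW.
    by rewrite toC_eq0 gt_eqF // divr_gt0.
  exists (p (g (toC (d / 2)))).
  rewrite /within /=; apply/nbhs_nc; exists d => // l; rewrite subr0 => hl pl'.
  by rewrite /ball /= pl; apply: le_lt_trans (pb _) _; apply: hd.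
have reB (z w : C) : ReC z - ReC w = ReC (z - w) by rewrite ReCD ReCN.
have imB (z w : C) : ImC z - ImC w = ImC (z - w) by rewrite ImCD ImCN.
have /cvg_ex[a ha] := key (@ReC R) reB (@ReC_nc R).
have /cvg_ex[b hb] := key (@ImC R) imB (@ImC_nc R).
pose z : C := (a +i* b)%C.
have hz (e : R) : 0 < e -> exists2 d : R, 0 < d & forall l, punct l -> nc l < d ->
      nc (g l - z) < e.
  move=> e0; have e2 : 0 < e / 2 by rewrite divr_gt0.
  move/cvgrPdist_lt: ha => /(_ _ e2); rewrite near_withinE => /nbhs_nc[d1 d10 h1].
  move/cvgrPdist_lt: hb => /(_ _ e2); rewrite near_withinE => /nbhs_nc[d2 d20 h2].
  exists (Num.min d1 d2); first by rewrite lt_min d10.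
  move=> l pl; rewrite lt_min => /andP[n1 n2].
  have := h1 l; rewrite subr0 distrC => /(_ n1 pl) k1.
  have := h2 l; rewrite subr0 distrC => /(_ n2 pl) k2.
  by rewrite /nc !ReCE /z /=; lra.
exists z => // P /nbhs_nc[d d0 hd]; rewrite /= /within.
have [d' d'0 h] := hz d d0; apply/nbhs_nc; exists d' => // l; rewrite subr0 => hl pl.
by apply: hd; apply: h.
Qed.

(** The first clause is the uniform $O(1/r)$ bound. The second is a continuity estimate in $\lambda$
    at fixed [r]; its constant [Q] may depend on [r], as it only serves to show that a limit at $0$
    exists. *)
Definition controlled (Y : C -> 'M[C]_4) (D : R -> C -> 'M[C]_4) :=
  (forall L : R, 0 <= L -> exists k r1 : R, [/\ 0 <= k, 0 < r1 &
    forall r l y, r1 <= r -> punct l -> nc l <= L -> nm (Y l) <= y ->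
      nm (D r l) <= k * y / r]) /\
  (exists2 F : R, 0 <= F & forall L y : R, 0 <= L -> 0 <= y -> exists2 r1 : R, 0 < r1 &
    forall r, r1 <= r -> exists2 Q : R, 0 <= Q & forall l1 l2 e, punct l1 -> punct l2 ->
      nc l1 <= L -> nc l2 <= L -> nm (Y l1) <= y -> nm (Y l2) <= y -> 0 <= e ->
      F * nc (l1 - l2) <= e -> nm (Y l1 - Y l2) <= e -> nm (D r l1 - D r l2) <= Q * e).

Variables (Yp Ym : C -> 'M[C]_4) (Dp Dm : R -> C -> 'M[C]_4).
Hypotheses (cp : controlled Yp Dp) (cm : controlled Ym Dm).

Let f r l := pairing (Yp l + Dp r l) (Ym l + Dm r l).
Let f0 l := pairing (Yp l) (Ym l).

Lemma local_closeness (L y e : R) : 0 <= L -> 0 <= y -> 0 < e -> exists2 r1 : R, 0 < r1 &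
  forall r l, r1 <= r -> punct l -> nc l <= L -> nm (Yp l) <= y -> nm (Ym l) <= y ->
  [/\ nm (Ym l + Dm r l) <= y + 1, nm (Yp l + Dp r l) <= y + 1 & nc (f r l - f0 l) < e].
Proof.
move=> L0 y0 e0; have [k1 [r1 [k10 r10 h1]]] := cp.1 L L0.
have [k2 [r2 [k20 r20 h2]]] := cm.1 L L0.
pose k := (k1 + k2) * y; have k0 : 0 <= k by rewrite mulr_ge0 // addr_ge0.
have y1 : 0 < y + 1 by rewrite ltr_wpDl.
(* Ensures both $k/r\le1$ and $12(y+1)k/r<e$. *)
pose r3 := 12 * (y + 1) * k / e + k + 1.
have k12 : 0 <= 12 * (y + 1) * k / e.
  apply: divr_ge0; last exact: ltW.
  by apply: mulr_ge0 => //; apply: mulr_ge0 => //; exact: ltW.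
have r30 : 0 < r3 by apply: ltr_wpDl => //; apply: addr_ge0.
exists (Num.max (Num.max r1 r2) r3); first by rewrite lt_max r30 orbT.
move=> r l; rewrite !ge_max => /andP[/andP[hr1 hr2] hr3] pl nl hp hm.
have r0 : 0 < r by apply: lt_le_trans hr3.
have kr : k / r <= 1.
  rewrite ler_pdivrMr // mul1r; apply: le_trans hr3; rewrite /r3.
  by rewrite -addrA addrCA lerDl addr_ge0.
have d1 : nm (Dp r l) <= k / r.
  apply: le_trans (h1 r l y hr1 pl nl hp) _; rewrite ler_wpM2r ?invr_ge0 ?(ltW r0) //.
  by rewrite /k ler_wpM2r // lerDl.
have d2 : nm (Dm r l) <= k / r.
  apply: le_trans (h2 r l y hr2 pl nl hm) _; rewrite ler_wpM2r ?invr_ge0 ?(ltW r0) //.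
  by rewrite /k ler_wpM2r // lerDr.
have b1 : nm (Ym l + Dm r l) <= y + 1.
  by apply: le_trans (nmD _ _) _; apply: lerD => //; apply: le_trans d2 kr.
have b2 : nm (Yp l + Dp r l) <= y + 1.
  by apply: le_trans (nmD _ _) _; apply: lerD => //; apply: le_trans d1 kr.
split => //; have kr0 : 0 <= k / r by rewrite divr_ge0 // ltW.
have hp1 : nm (Yp l) <= y + 1 by apply: le_trans hp _; rewrite lerDl.
have e1 : Yp l + Dp r l - Yp l = Dp r l by rewrite addrC addKr.
have e2 : Ym l + Dm r l - Ym l = Dm r l by rewrite addrC addKr.
have h := @nc_pairing_diff R _ _ _ _ (y + 1) (k / r) (k / r) b1 hp1 kr0 kr0.
have {}h : nc (f r l - f0 l) <= 6 * (y + 1) * (k / r + k / r) by apply: h; rewrite ?e1 ?e2.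
apply: le_lt_trans h _.
have -> : 6 * (y + 1) * (k / r + k / r) = 12 * (y + 1) * k / r by field; rewrite gt_eqF.
rewrite ltr_pdivrMr // -ltr_pdivrMl // mulrC; apply: lt_le_trans hr3.
by rewrite /r3 -addrA ltrDl ltr_wpDl.
Qed.

Hypothesis (Yp0 : forall e : R, 0 < e -> exists2 d : R, 0 < d & forall l, punct l -> nc l < d ->
  nm (Yp l - Yp 0) < e).
Hypothesis (Ym0 : forall e : R, 0 < e -> exists2 d : R, 0 < d & forall l, punct l -> nc l < d ->
  nm (Ym l - Ym 0) < e).

Let y0 := nm (Yp 0) + nm (Ym 0) + 1.

Let y0_ge0 : 0 <= y0.
Proof. by rewrite !addr_ge0 ?nm_ge0. Qed.

Let near0 (e : R) : 0 < e -> exists2 d : R, 0 < d & forall l, punct l -> nc l < d ->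
  [/\ nm (Yp l) <= y0, nm (Ym l) <= y0, nm (Yp l - Yp 0) < e & nm (Ym l - Ym 0) < e].
Proof.
move=> e0; have m0 : 0 < Num.min e 1 by rewrite lt_min e0 ltr01.
have [d1 d10 h1] := Yp0 m0; have [d2 d20 h2] := Ym0 m0.
exists (Num.min d1 d2); first by rewrite lt_min d10.
move=> l pl; rewrite lt_min => /andP[n1 n2].
have := h1 l pl n1; rewrite lt_min => /andP[a1 b1].
have := h2 l pl n2; rewrite lt_min => /andP[a2 b2].
have p0 := nm_ge0 (Yp 0); have q0 := nm_ge0 (Ym 0).
split => //; rewrite /y0.
  by rewrite -[Yp l](subrK (Yp 0)); apply: le_trans (nmD _ _) _; lra.
by rewrite -[Ym l](subrK (Ym 0)); apply: le_trans (nmD _ _) _; lra.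
Qed.

(** At fixed [r] the continuity estimate makes the Evans function Cauchy at $0$, so [ext0] is a true
    limit. The comparison with [f0 0] goes through one small point [l] chosen after [r]; this is
    harmless since the threshold from [local_closeness] does not depend on [l]. *)
Lemma closeness_at_zero (e : R) : 0 < e -> exists2 r1 : R, 0 < r1 & forall r, r1 <= r ->
  nc (ext0 (f r) 0 - f0 0) < e.
Proof.
move=> e0; have e3 : 0 < e / 4 by rewrite divr_gt0.
have [r1 r10 h1] := local_closeness ler01 y0_ge0 e3.
have [F1 F10 g1] := cp.2; have [F2 F20 g2] := cm.2.
have [r2 r20 {}g1] := g1 1 y0 ler01 y0_ge0.
have [r3 r30 {}g2] := g2 1 y0 ler01 y0_ge0.
exists (Num.max r1 (Num.max r2 r3)); first by rewrite lt_max r10.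
move=> r; rewrite !ge_max => /and3P[hr1 hr2 hr3].
have [Q1 Q10 {}g1] := g1 r hr2; have [Q2 Q20 {}g2] := g2 r hr3.
have [a ha hlim] : exists2 a : C, f r @ within punct (nbhs (0 : C)) --> a &
    forall e : R, 0 < e -> exists2 d : R, 0 < d & forall l, punct l -> nc l < d ->
      nc (f r l - a) < e.
  apply: cauchy_puncturedRHP => t t0.
  pose c := 6 * (y0 + 1) * ((1 + Q1) + (1 + Q2)).
  have c00 : 0 <= c.
    apply: mulr_ge0; last by apply: addr_ge0; apply: addr_ge0.
    by apply: mulr_ge0 => //; apply: addr_ge0.
  pose q := t / (c + 1); have q0 : 0 < q by rewrite divr_gt0 // ltr_wpDl.
  have q2 : 0 < q / 2 by rewrite divr_gt0.
  have [d d0 hd] := near0 q2.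
  pose G := F1 + F2 + 1; have G0 : 0 < G by rewrite ltr_wpDl // addr_ge0.
  exists (Num.min (Num.min 1 d) (q / (2 * G))).
    by rewrite !lt_min ltr01 d0 divr_gt0 // mulr_gt0.
  move=> l1 l2 p1 p2; rewrite !lt_min => /andP[/andP[u1 v1] w1] /andP[/andP[u2 v2] w2].
  have [m1 m2 m3 m4] := hd l1 p1 v1; have [n1 n2 n3 n4] := hd l2 p2 v2.
  have [b1 _ _] := h1 r l1 hr1 p1 (ltW u1) m1 m2.
  have [_ b2 _] := h1 r l2 hr1 p2 (ltW u2) n1 n2.
  have hn : G * nc (l1 - l2) <= q.
    apply: (@le_trans _ _ (G * (q / (2 * G) + q / (2 * G)))).
      by rewrite ler_pM2l //; apply: le_trans (ncB _ _) _; apply: lerD; apply: ltW.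
    by rewrite le_eqVlt; apply/orP; left; apply/eqP; field; rewrite gt_eqF.
  have nn := nc_ge0 (l1 - l2).
  have hF1 : F1 * nc (l1 - l2) <= q.
    by apply: le_trans hn; rewrite ler_wpM2r // /G -addrA lerDl addr_ge0.
  have hF2 : F2 * nc (l1 - l2) <= q.
    by apply: le_trans hn; rewrite ler_wpM2r // /G addrAC lerDr addr_ge0.
  have eY (Z : C -> 'M[C]_4) : nm (Z l1 - Z 0) < q / 2 -> nm (Z l2 - Z 0) < q / 2 ->
      nm (Z l1 - Z l2) <= q.
    move=> z1 z2; have -> : Z l1 - Z l2 = (Z l1 - Z 0) - (Z l2 - Z 0) by rewrite opprB addrA subrK.
    by apply: le_trans (nmB _ _) _; lra.
  have y1 := eY Yp m3 n3; have y2 := eY Ym m4 n4.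
  have k1 := g1 l1 l2 q p1 p2 (ltW u1) (ltW u2) m1 n1 (ltW q0) hF1 y1.
  have k2 := g2 l1 l2 q p1 p2 (ltW u1) (ltW u2) m2 n2 (ltW q0) hF2 y2.
  have s1 : nm ((Yp l1 + Dp r l1) - (Yp l2 + Dp r l2)) <= (1 + Q1) * q.
    by rewrite opprD addrACA; apply: le_trans (nmD _ _) _; rewrite mulrDl mul1r; apply: lerD.
  have s2 : nm ((Ym l1 + Dm r l1) - (Ym l2 + Dm r l2)) <= (1 + Q2) * q.
    by rewrite opprD addrACA; apply: le_trans (nmD _ _) _; rewrite mulrDl mul1r; apply: lerD.
  have P1 : 0 <= (1 + Q1) * q by apply: mulr_ge0; [exact: addr_ge0 | exact: ltW].
  have P2 : 0 <= (1 + Q2) * q by apply: mulr_ge0; [exact: addr_ge0 | exact: ltW].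
  apply: le_lt_trans (nc_pairing_diff b1 b2 P1 P2 s1 s2) _.
  have -> : 6 * (y0 + 1) * ((1 + Q1) * q + (1 + Q2) * q) = c * q.
    have id (y q' a b : R) : 6 * (y + 1) * ((1 + a) * q' + (1 + b) * q') =
        6 * (y + 1) * ((1 + a) + (1 + b)) * q' by ring.
    exact: id.
  by rewrite /q mulrCA gtr_pMr // ltr_pdivrMr ?ltr_wpDl // mul1r ltrDl.
have -> : ext0 (f r) 0 = a.
  rewrite /ext0 eqxx; have PF := puncturedRHP_proper.
  by apply: cvg_lim => //; exact: norm_hausdorff.
have [d1 d10 hd1] := hlim _ e3.
have c0 : 0 < 6 * (y0 + 1) * 2 by rewrite !mulr_gt0 // ltr_wpDl.
have [d2 d20 hd2] := @near0 (e / 4 / (6 * (y0 + 1) * 2)) (divr_gt0 e3 c0).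
pose d := Num.min 1 (Num.min d1 d2).
have d0 : 0 < d by rewrite !lt_min ltr01 d10.
pose l := toC (d / 2); have nl : nc l < d.
  by rewrite nc_toC ger0_norm ?divr_ge0 ?(ltW d0) // ltr_pdivrMr // ltr_pMr // ltr1n.
have pl : punct l.
  split; first by rewrite ReC_toC divr_ge0 // ltW.
  by rewrite toC_eq0 gt_eqF // divr_gt0.
move: nl; rewrite !lt_min => /and3P[n1 n2 n3].
have [m1 m2 m3 m4] := hd2 l pl n3.
have [_ _ hc] := h1 r l hr1 pl (ltW n1) m1 m2.
have ha' := hd1 l pl n2.
have z1 : nm (Ym l) <= y0 + 1 by apply: le_trans m2 _; rewrite lerDl.
have z2 : nm (Yp 0) <= y0 + 1.
  by rewrite /y0; have := nm_ge0 (Ym 0); lra.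
have hf : nc (f0 l - f0 0) <= e / 4.
  apply: le_trans (nc_pairing_diff z1 z2 (ltW (divr_gt0 e3 c0)) (ltW (divr_gt0 e3 c0)) (ltW m3) (ltW m4)) _.
  rewrite le_eqVlt; apply/orP; left; apply/eqP; field.
  by rewrite gt_eqF // ltr_wpDl.
have -> : a - f0 0 = ((f r l - f0 l) + (f0 l - f0 0)) - (f r l - a).
  by rewrite subrKA opprB [RHS]addrC subrKA.
apply: le_lt_trans (ncB _ _) _; have := ncD (f r l - f0 l) (f0 l - f0 0).
by lra.
Qed.

End UniformLimit.

(** * The Evans system on one half-line *)

Section OneSide.
Variable R : realType.
Local Notation C := (Cplx R).
Local Notation eigproj A P := (is_eigenprojection A (@stable_eig R) P).
Variables (mu0 sigma B : R).
Hypotheses (mu00 : 0 < mu0) (sigma0 : 0 < sigma) (B0 : 0 <= B).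
(* s = 1 for the half-line x > 0, s = -1 for x < 0 reflected to x > 0;
   u r is the reflected rescaled profile and vi its limit. *)
Variables (s vi c0 : R) (u : R -> R -> R).
Hypotheses (s2 : s ^+ 2 = 1) (vi01 : 0 < vi <= 1) (c00 : 0 < c0).
Hypothesis hu : forall r, 0 < r -> exists w dw, [/\ is_weight (c0 * r) w dw,
  forall x, 0 < x -> w x <= 1, forall x, 0 < x -> `|u r x - vi| <= w x &
  forall x, 0 < x -> 0 <= u r x <= 1].
Variables (Pi : C -> 'M[C]_4) (l0 : R) (R0 : 'M[R]_(4, 2)) (Rs : C -> 'M[C]_(4, 2)).
Local Notation SM := (side_mx mu0 sigma B s).
Hypothesis hPi : forall l, eigproj (SM vi l) (Pi l).
Hypotheses (l00 : 0 < l0) (hRs : kato_solution Pi l0 R0 Rs).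
Hypothesis hR0 : Pi (toC l0) *m map_mx (@toC R) R0 = map_mx (@toC R) R0.
Variable P : R -> C -> R -> 'M[C]_4.
Hypothesis hP : forall r, 0 < r -> forall l, puncturedRHP l ->
  half_conjugator (fun x => SM (u r x) l) (SM vi l) (P r l).

Let s_norm : `|s| = 1.
Proof.
apply/eqP; rewrite -(eqrXn2 (n := 2)) //.
by rewrite real_normK ?num_real // s2 expr1n.
Qed.

Let vi0 : 0 < vi. Proof. by case/andP: vi01. Qed.
Let vi_le : 0 <= vi <= 1. Proof. by case/andP: vi01 => /ltW -> ->. Qed.

Let nm_sgn (M : 'M[C]_4) : nm (toC s *: M) <= nm M.
Proof. by apply: le_trans (nmZ _ _) _; rewrite nc_toC s_norm mul1r. Qed.

Let fm := frozen_mx mu0 sigma B.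
Let FK := frozenK mu0 sigma B.
Let FK0 : 0 <= FK := frozenK_ge0 mu0 sigma B.

Let side_pencil l : SM vi l =
  toC s *: (frozen0 R + toC vi *: frozen1 mu0 sigma B + toC (vi ^+ 2) *: frozen3 mu0 sigma) +
  l *: (toC s *: (toC vi *: frozen2 R)).
Proof.
by rewrite /side_mx frozen_pencil; exact: scale_pencil.
Qed.

Lemma side_gap l : puncturedRHP l -> locally_gapped
  (toC s *: (frozen0 R + toC vi *: frozen1 mu0 sigma B + toC (vi ^+ 2) *: frozen3 mu0 sigma))
  (toC s *: (toC vi *: frozen2 R)) l.
Proof.
move=> [m0 n0]; have [c [d [cp dp h]]] := frozen_gap mu00 sigma0 B0 vi0 m0 n0.
exists c, d; split => // l' hl' z x x0; rewrite -side_pencil /side_mx -scalemxAl => e.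
have ss : toC s * toC s = 1 by rewrite -toCM -expr2 s2.
have e1 : frozen_mx mu0 sigma B vi l' *m x = (toC s * z) *: x.
  by rewrite -scalerA -e scalerA ss scale1r.
have := h l' hl' _ _ x0 e1; rewrite ReCM ReC_toC ImC_toC mul0r subr0 normrM s_norm.
by rewrite mul1r.
Qed.

Lemma side_range l : puncturedRHP l -> Pi l *m Rs l = Rs l.
Proof.
apply: (@kato_range R _ _ Pi _ l0 R0 Rs l00 side_gap hRs hR0).
by move=> l'; rewrite -side_pencil; apply: hPi.
Qed.

Definition deviation r l := wedge (P r l 0 *m Rs l) - wedge (Rs l).

Let bnd l L v : nc l <= L -> 0 <= v <= 1 -> nm (SM v l) <= FK * (1 + L).
Proof.
move=> hl hv; apply: le_trans (nm_sgn _) _; apply: le_trans (frozen_bound _ _ _ _ hv) _.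
by rewrite ler_wpM2l // lerD2l.
Qed.

Let lip l L v w : nc l <= L -> 0 <= v <= 1 -> `|v - vi| <= w ->
  nm (SM v l - SM vi l) <= FK * (1 + L) * w.
Proof.
move=> hl hv hw; rewrite /side_mx -scalerBr; apply: le_trans (nm_sgn _) _.
apply: le_trans (frozen_lip _ _ _ _ hv vi_le) _.
apply: ler_pM => //; first by rewrite mulr_ge0 // addr_ge0 ?nc_ge0.
by rewrite ler_wpM2l // lerD2l.
Qed.

Let tracked_side r l w dw : 0 < r -> puncturedRHP l -> is_weight (c0 * r) w dw ->
  (forall x, 0 < x -> `|u r x - vi| <= w x) -> (forall x, 0 < x -> 0 <= u r x <= 1) ->
  exists eta dev, tracked (fun x => SM (u r x) l) (SM vi l) w (wedge (Rs l)) eta dev /\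
    deviation r l = dev 0.
Proof.
move=> r0 hl W hw h01; have [m0 _] := hl.
have hd := stable_plane_dichotomy mu00 sigma0 B0 s2 vi0 m0 (@hPi l) (side_range hl).
have [|eta [dev [h1 h2]]] := tracked_exists W (hP r0 hl) _ (@hPi l) (side_range hl) hd.
  by exists (FK * (1 + nc l)) => x x0; apply: lip; rewrite ?h01 ?hw.
by exists eta, dev; split => //; rewrite /deviation h2 addrC addKr.
Qed.

Lemma deviation_bound r l L y : 0 < r -> puncturedRHP l -> nc l <= L ->
  nm (wedge (Rs l)) <= y -> 768 * (FK * (1 + L)) <= c0 * r ->
  nm (deviation r l) <= 256 * (FK * (1 + L) * y) / (c0 * r).
Proof.
move=> r0 hl hL hy hr; have [w [dw [W w1 hw h01]]] := hu r0.
have [eta [dev [ht ->]]] := tracked_side r0 hl W hw h01.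
have L0 : 0 <= L := le_trans (nc_ge0 _) hL.
have K0 : 0 <= FK * (1 + L) by rewrite mulr_ge0 // addr_ge0.
apply: le_trans (tracked_bound0 W w1 ht K0 K0 _ _ _ hr) _.
- by move=> x x0; apply: bnd => //; apply: h01.
- exact: bnd.
- by move=> x x0; apply: lip => //; [apply: h01 | apply: hw].
- apply: ler_wpM2r; first by rewrite invr_ge0 mulr_ge0 // ltW.
  by rewrite ler_pM2l // ler_wpM2l.
Qed.

Lemma deviation_cauchy r L y : 0 < r -> 0 <= L -> 768 * (FK * (1 + L)) <= c0 * r ->
  0 <= y -> exists2 Q : R, 0 <= Q & forall l1 l2 e, puncturedRHP l1 -> puncturedRHP l2 ->
  nc l1 <= L -> nc l2 <= L -> nm (wedge (Rs l1)) <= y -> nm (wedge (Rs l2)) <= y ->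
  0 <= e -> FK * nc (l1 - l2) <= e -> nm (wedge (Rs l1) - wedge (Rs l2)) <= e ->
  nm (deviation r l1 - deviation r l2) <= Q * e.
Proof.
move=> r0 L0 hr y0; have [w [dw [W w1 hw h01]]] := hu r0.
have K0 : 0 <= FK * (1 + L) by rewrite mulr_ge0 // addr_ge0.
have cr : 0 < c0 * r by rewrite mulr_gt0.
move: (FK * (1 + L)) K0 hr (fun l => @bnd l L) (fun l => @lip l L) => K K0 hr hb hl.
pose b := 256 * K / (c0 * r).
have b0 : 0 <= b by apply: divr_ge0; [exact: mulr_ge0 | exact: ltW].
exists (256 * (b * y + (6 * K + 2 * y) * b + K + y) / (c0 * r)).
  apply: divr_ge0; last exact: ltW.
  apply: mulr_ge0 => //; do !apply: addr_ge0 => //; apply: mulr_ge0 => //.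
  by apply: addr_ge0; apply: mulr_ge0.
move=> l1 l2 e p1 p2 n1 n2 y1 y2 e0 he hY.
have [eta1 [dev1 [t1 ->]]] := tracked_side r0 p1 W hw h01.
have [eta2 [dev2 [t2 ->]]] := tracked_side r0 p2 W hw h01.
apply: (tracked_diff W w1 t1 t2 K0 K0 e0 _ _ _ _ _ _ hr y1 y2 _ _ _ hY).
- by move=> x x0; apply: hb => //; apply: h01.
- exact: hb.
- by move=> x x0; apply: hl => //; [apply: h01 | apply: hw].
- by move=> x x0; apply: hb => //; apply: h01.
- exact: hb.
- by move=> x x0; apply: hl => //; [apply: h01 | apply: hw].
- move=> x x0; rewrite /side_mx -scalerBr; apply: le_trans (nm_sgn _) _.
  by apply: le_trans he; apply: frozen_lip_param; apply: h01.
- rewrite /side_mx -scalerBr; apply: le_trans (nm_sgn _) _.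
  by apply: le_trans he; apply: frozen_lip_param.
- move=> x x0; rewrite /side_mx -!scalerBr; apply: le_trans (nm_sgn _) _.
  apply: le_trans (frozen_lip2 _ _ _ _ _ _ _) _.
  by apply: ler_pM; rewrite ?hw // mulr_ge0 ?nc_ge0.
Qed.

Lemma side_controlled : controlled (fun l => wedge (Rs l)) deviation.
Proof.
have large L r : 768 * (FK * (1 + L)) / c0 + 1 <= r -> 768 * (FK * (1 + L)) <= c0 * r.
  by move=> h; rewrite -ler_pdivrMl // mulrC; apply: le_trans h; rewrite lerDl.
have KL L : 0 <= L -> 0 <= FK * (1 + L) by move=> L0; rewrite mulr_ge0 // addr_ge0.
have pos L : 0 <= L -> 0 < 768 * (FK * (1 + L)) / c0 + 1.
  move=> L0; apply: ltr_wpDl; last exact: ltr01.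
  exact: divr_ge0 (mulr_ge0 (ler0n R 768) (KL L L0)) (ltW c00).
split.
  move=> L L0; exists (256 * (FK * (1 + L)) / c0), (768 * (FK * (1 + L)) / c0 + 1); split.
  - exact: divr_ge0 (mulr_ge0 (ler0n R 256) (KL L L0)) (ltW c00).
  - exact: pos.
  - move=> r l y hr pl nl ny; have r0 : 0 < r := lt_le_trans (pos L L0) hr.
    apply: le_trans (deviation_bound r0 pl nl ny (large L r hr)) _.
    have id (k a b z : R) : a != 0 -> b != 0 -> 256 * (k * z) / (a * b) = 256 * k / a * z / b.
      by move=> a0 b0; field; rewrite a0 b0.
    by rewrite id ?gt_eqF.
exists FK => // L y L0 y0; exists (768 * (FK * (1 + L)) / c0 + 1); first exact: pos.
move=> r hr; have r0 : 0 < r := lt_le_trans (pos L L0) hr.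
exact: (deviation_cauchy r0 L0 (large L r hr) y0).
Qed.

End OneSide.

(** * Local boundedness and continuity of the Kato planes *)

Section LocalBounds.
Variable R : realType.
Local Notation C := (Cplx R).

Lemma nm_wedge_diff (X X' : 'M[C]_(4, 2)) :
  nm (wedge X - wedge X') <= nm (symp2 R) * nm (X - X') * (nm X + nm X').
Proof.
have -> : wedge X - wedge X' =
    (X - X') *m symp2 R *m X^T + X' *m symp2 R *m (X - X')^T.
  have eT : (X - X')^T = X^T - X'^T by rewrite linearB.
  by rewrite /wedge eT; move: (symp2 R) => J; rewrite !mulmxBl mulmxBr subrKA.
rewrite mulrDr; apply: le_trans (nmD _ _) _; apply: lerD.
  apply: le_trans (nmM _ _) _; rewrite nmT ler_wpM2r ?nm_ge0 //.
  by rewrite mulrC nmM.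
apply: le_trans (nmM _ _) _; rewrite nmT mulrAC [nm (symp2 R) * _]mulrC.
by rewrite ler_wpM2r ?nm_ge0 // nmM.
Qed.

Lemma derivable_wedge_bounded (Rs : C -> 'M[C]_(4, 2)) (x : C) D :
  is_derive x (1 : C) Rs D -> exists d y : R, [/\ 0 < d, 0 <= y &
    forall l, nc (l - x) < d -> nm (wedge (Rs l)) <= y].
Proof.
move=> /derivable_eps /(_ 1 ltr01)[d d0 hd].
pose b := nm (Rs x) + nm D + 1.
have b0 : 0 <= b by rewrite !addr_ge0 ?nm_ge0.
exists (Num.min d 1), (nm (symp2 R) * b * b); split.
- by rewrite lt_min d0 ltr01.
- by rewrite !mulr_ge0 ?nm_ge0.
- move=> l; rewrite lt_min => /andP[h1 h2]; have ex : x + (l - x) = l by rewrite addrC subrK.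
  have := hd _ h1; rewrite ex => h3.
  have hb : nm (Rs l) <= b.
    have -> : Rs l = (Rs x + (l - x) *: D) + (Rs l - Rs x - (l - x) *: D).
      by rewrite -[Rs l - Rs x - _]addrA -opprD [RHS]addrC subrK.
    apply: le_trans (nmD _ _) _; apply: lerD; last by apply: le_trans h3 _; rewrite mul1r ltW.
    apply: le_trans (nmD _ _) _; rewrite lerD2l; apply: le_trans (nmZ _ _) _.
    by rewrite ler_piMl ?nm_ge0 // ltW.
  apply: le_trans (nmM _ _) _; rewrite nmT; apply: ler_pM; rewrite ?nm_ge0 //.
  by apply: le_trans (nmM _ _) _; rewrite mulrC ler_wpM2l ?nm_ge0.
Qed.

Lemma cvg_wedge0 (Rs : C -> 'M[C]_(4, 2)) :
  Rs @ within (@puncturedRHP R) (nbhs (0 : C)) --> Rs 0 ->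
  forall e : R, 0 < e -> exists2 d : R, 0 < d & forall l, puncturedRHP l -> nc l < d ->
    nm (wedge (Rs l) - wedge (Rs 0)) < e.
Proof.
move=> /cvg_nm h e e0.
pose k := nm (symp2 R) * (2 * nm (Rs 0) + 1).
have k0 : 0 <= k by rewrite mulr_ge0 ?nm_ge0 // addr_ge0 ?mulr_ge0 ?nm_ge0.
have m0 : 0 < Num.min 1 (e / (k + 1)) by rewrite lt_min ltr01 divr_gt0 // ltr_wpDl.
have := h _ m0; rewrite near_withinE => /nbhs_nc[d d0 hd].
exists d => // l pl nl; have := hd l; rewrite subr0 => /(_ nl pl).
rewrite lt_min => /andP[n1]; rewrite ltr_pdivlMr ?ltr_wpDl // => n2.
apply: le_lt_trans n2; apply: le_trans (nm_wedge_diff _ _) _.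
have hn : nm (Rs l) + nm (Rs 0) <= 2 * nm (Rs 0) + 1.
  have : nm (Rs l) <= nm (Rs l - Rs 0) + nm (Rs 0) by rewrite -{1}[Rs l](subrK (Rs 0)) nmD.
  lra.
apply: (@le_trans _ _ (nm (Rs l - Rs 0) * k)); last by rewrite ler_wpM2l ?nm_ge0 // lerDl.
rewrite /k [nm (Rs l - Rs 0) * _]mulrCA mulrA ler_wpM2l //.
by rewrite mulr_ge0 ?nm_ge0.
Qed.

End LocalBounds.

(** * Assembly of the two half-lines *)

Theorem proposition4p3 (R : realType) (gamma vp mu0 sigma B : R)
  (hgamma : 1 <= gamma) (hvp : 0 < vp < 1) (hmu0 : 0 < mu0)
  (hsigma : 0 < sigma) (hB : 0 <= B)
  (vbar : R -> R) (hvbar : is_profile gamma vp vbar)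
  (* A r x l: mu = 1 and 2 mu + eta = 1 / r *)
  (A := fun r => evans_mx 1 mu0 sigma B (rescaled vbar r))
  (Ap Am : Cplx R -> 'M[Cplx R]_4)
  (hAp : forall r, 0 < r -> forall l, A r x l @[x --> +oo] --> Ap l)
  (hAm : forall r, 0 < r -> forall l, A r x l @[x --> -oo] --> Am l)
  (Pip Pim : Cplx R -> 'M[Cplx R]_4)
  (hPip : forall l, is_eigenprojection (Ap l) (@stable_eig R) (Pip l))
  (hPim : forall l, is_eigenprojection (Am l) (@unstable_eig R) (Pim l))
  (l0 : R) (hl0 : 0 < l0) (Rp0 Rm0 : 'M[R]_(4, 2))
  (hRp0 : \rank Rp0 = 2%N) (hRm0 : \rank Rm0 = 2%N)
  (hPiRp0 : Pip (toC l0) *m map_mx (@toC R) Rp0 = map_mx (@toC R) Rp0)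
  (hPiRm0 : Pim (toC l0) *m map_mx (@toC R) Rm0 = map_mx (@toC R) Rm0)
  (Rp Rm : Cplx R -> 'M[Cplx R]_(4, 2))
  (hRp : kato_solution Pip l0 Rp0 Rp) (hRm : kato_solution Pim l0 Rm0 Rm)
  (Pp Pm : R -> R -> Cplx R -> 'M[Cplx R]_4)
  (hPp : forall r, 0 < r -> forall l, puncturedRHP l ->
     is_conjugator (A r ^~ l) (Ap l) [set x | 0 < x] (Pp r ^~ l))
  (hPm : forall r, 0 < r -> forall l, puncturedRHP l ->
     is_conjugator (A r ^~ l) (Am l) [set x | x < 0] (Pm r ^~ l))
  (K : set (Cplx R)) (hK : compact K) (hKsub : K `<=` @closedRHP R)
  (* the values of the Kato bases at 0 are by continuous extension *)
  (hK0 : K 0 -> Rp @ within (@puncturedRHP R) (nbhs 0) --> Rp 0 /\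
                Rm @ within (@puncturedRHP R) (nbhs 0) --> Rm 0) :
  {uniform K, (fun r => reduced_evans (Pp r) (Pm r) Rp Rm) @ +oo -->
              (fun l => det_cols (Rp l) (Rm l))}.
Proof.
have [vp0 vp1] := andP hvp.
have [c c0 hw] := profile_weights hgamma hvp hvbar.
have [_ _ limm limp] := hvbar.
have vlo := profile_lower hvbar; have vup := profile_upper hvbar.
have vb x : 0 <= vbar x <= 1.
  by rewrite (ltW (vup x)) andbT ltW // (lt_trans vp0).
pose fm := frozen_mx mu0 sigma B.
(* The limit matrices are given abstractly; uniqueness of limits, used at $r=1$, identifies them
   with frozen matrices at the end states. *)
have limit (F : set_system R) (FF : Filter F) (w : R) (l : Cplx R) : 0 <= w <= 1 ->
    vbar x @[x --> F] --> w -> A 1 x l @[x --> F] --> fm w l.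
  move=> w01 hF; apply/cvg_nm => e e0.
  pose k := frozenK mu0 sigma B * (1 + nc l).
  have k0 : 0 <= k by rewrite mulr_ge0 ?frozenK_ge0 // addr_ge0 ?nc_ge0.
  move/cvgrPdist_lt: hF => /(_ (e / (k + 1))).
  rewrite divr_gt0 ?ltr_wpDl // => /(_ isT); apply: filterS => x.
  rewrite distrC ltr_pdivlMr ?ltr_wpDl // => hx; apply: le_lt_trans hx.
  have -> : A 1 x l = fm (vbar (1 * x)) l by [].
  rewrite mul1r.
  apply: (le_trans (frozen_lip mu0 sigma B l (vb x) w01)).
  by rewrite mulrC ler_wpM2l // lerDl.
have eAp l : Ap l = fm vp l.
  apply: (cvg_unique (@norm_hausdorff _ _) (hAp 1 ltr01 l)).
  by apply: limit => //; rewrite !ltW.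
have eAm l : Am l = fm 1 l.
  apply: (cvg_unique (@norm_hausdorff _ _) (hAm 1 ltr01 l)).
  by apply: limit => //; rewrite ler01 lexx.
have sp w l : side_mx mu0 sigma B 1 w l = fm w l.
  by rewrite /side_mx (_ : toC 1 = 1) // scale1r.
have sm w l : side_mx mu0 sigma B (-1) w l = - fm w l.
  by rewrite /side_mx (_ : toC (-1) = -1) ?toCN // scaleN1r.
pose Yp l := wedge (Rp l); pose Ym l := wedge (Rm l).
pose P1 r l x := Pp r x l; pose P2 r l x := Pm r (- x) l.
have Cp : controlled Yp (deviation Rp P1).
  apply: (@side_controlled R mu0 sigma B hmu0 hsigma hB 1 vp c (fun r x => vbar (r * x))
    _ _ c0 _ Pip l0 Rp0 Rp _ hl0 hRp hPiRp0 P1).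
  - by rewrite expr1n.
  - by rewrite vp0 ltW.
  - move=> r r0; have [W _] := hw r r0; do 2!eexists; split; first exact: W.
    + by move=> x x0; have := vup (r * x); lra.
    + by move=> x x0; rewrite ger0_norm // subr_ge0 ltW.
    + by move=> x x0; apply: vb.
  - by move=> l; rewrite sp -eAp; apply: hPip.
  - move=> r r0 l pl; have := half_conjugator_plus (hPp r r0 l pl).
    rewrite eAp -sp; congr half_conjugator.
    by apply/funext => x; rewrite sp.
have Cm : controlled Ym (deviation Rm P2).
  apply: (@side_controlled R mu0 sigma B hmu0 hsigma hB (-1) 1 c (fun r x => vbar (- (r * x)))
    _ _ c0 _ Pim l0 Rm0 Rm _ hl0 hRm hPiRm0 P2).
  - by rewrite sqrrN expr1n.
  - by rewrite ltr01 lexx.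
  - move=> r r0; have [_ W] := hw r r0; do 2!eexists; split; first exact: W.
    + by move=> x x0; have := vlo (- (r * x)); lra.
    + by move=> x x0; rewrite distrC ger0_norm // subr_ge0 ltW.
    + by move=> x x0; apply: vb.
  - by move=> l; rewrite sm -eAm; apply: eigproj_oppr; apply: hPim.
  - move=> r r0 l pl; have := half_conjugator_minus (hPm r r0 l pl).
    rewrite eAm -sm; congr half_conjugator.
    apply/funext => x; rewrite sm /A /fm /frozen_mx /evans_mx /rescaled mulrN.
    by [].
have eE r : reduced_evans (Pp r) (Pm r) Rp Rm =
    ext0 (fun l => pairing (Yp l + deviation Rp P1 r l) (Ym l + deviation Rm P2 r l)).
  rewrite /reduced_evans; congr ext0; apply/funext => l.
  rewrite det_cols_wedge /deviation /P1 /P2 oppr0.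
  by rewrite [Yp l + _]addrC [Ym l + _]addrC !subrK.
move=> Q /uniform_nbhs[E [entE hE]].
move: entE; rewrite -entourage_ballE => -[e e0 he].
have [d d0 ed] := pos_toC e0.
pose near_ok r l := K l -> nc (reduced_evans (Pp r) (Pm r) Rp Rm l - det_cols (Rp l) (Rm l)) < d.
suff : \forall r \near +oo, K `<=` near_ok r.
  apply: filterS => r hr; apply: hE => l Kl; apply: he.
  by rewrite /ball /= ed distrC; apply: norm_nc_lt; apply: hr.
(* By compactness it is enough to find, near each point of [K], one threshold for [r]. *)
move/compact_near_coveringP: hK => /(_ R +oo near_ok); apply => x Kx.
have fin (r1 dx : R) : 0 < dx ->
    (forall r l, r1 <= r -> nc (l - x) < dx -> near_ok r l) ->
    \forall x' \near x & i \near +oo, near_ok i x'.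
  move=> dx0 h; exists ([set l | nc (l - x) < dx], [set i | r1 <= i]).
    split => /=; last by apply: nbhs_pinfty_ge; rewrite num_real.
    by apply/nbhs_nc; exists dx.
  by move=> [l i] /= [hl hi]; apply: h.
have nonzero r l : l != 0 -> reduced_evans (Pp r) (Pm r) Rp Rm l =
    pairing (Yp l + deviation Rp P1 r l) (Ym l + deviation Rm P2 r l).
  by move=> l0'; rewrite eE /ext0 (negPf l0').
(* A neighbourhood of $0$ contains $0$ itself, where the Evans function is a limit, and regular
   points; the two thresholds come from [closeness_at_zero] and [local_closeness]. *)
have [x0|xn] := eqVneq x 0.
  rewrite x0 in Kx fin *; have [hp0 hm0] := hK0 Kx.
  have Yp0 := cvg_wedge0 hp0; have Ym0 := cvg_wedge0 hm0.
  have [r1 r10 h1] := closeness_at_zero Cp Cm Yp0 Ym0 d0.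
  have [d1 d10 k1] := Yp0 1 ltr01; have [d2 d20 k2] := Ym0 1 ltr01.
  pose y := nm (Yp 0) + nm (Ym 0) + 1.
  have y0 : 0 <= y by rewrite !addr_ge0 ?nm_ge0.
  have [r2 r20 h2] := local_closeness Cp Cm ler01 y0 d0.
  apply: (fin (Num.max r1 r2) (Num.min 1 (Num.min d1 d2))).
    by rewrite !lt_min ltr01 d10.
  move=> r l; rewrite ge_max !lt_min subr0 => /andP[hr1 hr2] /and3P[n1 n2 n3] Kl.
  have [->|ln] := eqVneq l 0.
    by have := h1 r hr1; rewrite -eE det_cols_wedge.
  have pl : puncturedRHP l by split => //; exact: hKsub.
  rewrite nonzero // det_cols_wedge.
  have bd (Y : Cplx R -> 'M[Cplx R]_4) : nm (Y l - Y 0) < 1 -> nm (Y l) <= nm (Y 0) + 1.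
    by move=> h; rewrite -[Y l](subrK (Y 0)); apply: le_trans (nmD _ _) _; lra.
  have b1 := bd Yp (k1 l pl n2); have b2 := bd Ym (k2 l pl n3).
  have hb1 : nm (Yp l) <= y by apply: le_trans b1 _; rewrite /y lerD2r lerDl nm_ge0.
  have hb2 : nm (Ym l) <= y by apply: le_trans b2 _; rewrite /y -addrA lerDr nm_ge0.
  by have [_ _] := h2 r l hr2 pl (ltW n1) hb1 hb2.
have px : puncturedRHP x by split => //; exact: hKsub.
have [d1 [y1 [d10 y10 k1]]] := derivable_wedge_bounded (hRp.1 x px).
have [d2 [y2 [d20 y20 k2]]] := derivable_wedge_bounded (hRm.1 x px).
have nx : 0 < nc x.
  by rewrite lt_neqAle nc_ge0 andbT; apply: contraNneq xn => /esym/eqP; rewrite eq_le => /andP[/nc_eq0 ->].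
have L0 : 0 <= nc x + nc x by rewrite addr_ge0 ?nc_ge0.
have [r1 r10 h1] := local_closeness Cp Cm L0 (addr_ge0 y10 y20) d0.
(* The radius [nc x] keeps $0$ out of the neighbourhood. *)
apply: (fin r1 (Num.min (nc x) (Num.min d1 d2))); first by rewrite !lt_min nx d10.
move=> r l hr; rewrite !lt_min => /and3P[n1 n2 n3] Kl.
have ln : l != 0.
  by apply: contraTneq n1 => ->; rewrite sub0r ncN ltxx.
have pl : puncturedRHP l by split => //; exact: hKsub.
rewrite nonzero // det_cols_wedge.
have nl : nc l <= nc x + nc x.
  by rewrite -[l in nc l](subrK x); apply: le_trans (ncD _ _) _; rewrite lerD2r ltW.
have [||_ _ //] := h1 r l hr pl nl.
  by apply: le_trans (k1 l n2) _; rewrite lerDl.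
by apply: le_trans (k2 l n3) _; rewrite lerDr.
Qed.
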